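(* Let $n\ge 1$, and let $V = P_n(F)\otimes \Bbbk S_n$ be the $\mathcal{A}_n(F)$-module described in the context. (a) The map $$V = P_n(F)\otimes \Bbbk S_n \to \mathcal{A}_n(F),\qquad a\otimes w\mapsto aw,$$ is an isomorphism of graded $\mathcal{A}_n(F)$-supermodules. (b) The algebra $\mathcal{A}_n(F)$ is free as a $\Bbbk$-module, with graded dimension (when its graded pieces have finite rank, i.e. when $\delta>0$) $$\operatorname{grdim}\mathcal{A}_n(F) = n!\left(\frac{\operatorname{grdim}F}{1-q^\delta}\right)^n .$$
   Context: $\Bbbk$ is a commutative ring of characteristic not equal to $2$; $\mathbb{N}$ is the set of nonnegative integers. ''Algebra'' means associative unital $\mathbb{Z}$-graded $\Bbbk$-superalgebra, ''module'' means $\mathbb{Z}$-graded left supermodule; $|a|$ is the ($\mathbb{Z}$-)degree and $\bar a\in\mathbb{Z}_2$ the parity of a homogeneous element. Tensor products are over $\Bbbk$, with $(a_1\otimes a_2)(b_1\otimes b_2)=(-1)^{\bar a_2\bar b_1}a_1b_1\otimes a_2b_2$. $F$ is an $\mathbb{N}$-graded Frobenius superalgebra, free of finite rank over $\Bbbk$: there is a parity-preserving linear trace map $\operatorname{tr}\colon F\to\Bbbk$, homogeneous in degree, such that $f\mapsto(g\mapsto(-1)^{\bar f\bar g}\operatorname{tr}(gf))$ is an isomorphism $F\to\operatorname{Hom}_\Bbbk(F,\Bbbk)$. The Nakayama automorphism $\psi$ of $F$ is defined by $\operatorname{tr}(fg)=(-1)^{\bar f\bar g}\operatorname{tr}(g\psi(f))$.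 $\delta$ is the maximum degree of elements of $F$ (so $\operatorname{tr}$ has degree $-\delta$). It is assumed that $\psi$ has finite order $\theta$, that the characteristic of $\Bbbk$ does not divide $\theta$, and that $F$ has a basis of eigenvectors of $\psi$. $B$ is a homogeneous basis of $F$ and $\{b^\vee\mid b\in B\}$ its left dual basis: $\operatorname{tr}(b^\vee c)=\delta_{b,c}$. For $f\in F$, $1\le i\le n$: $f_i=1^{\otimes(i-1)}\otimes f\otimes1^{\otimes(n-i)}\in F^{\otimes n}$ and $\psi_i=\operatorname{id}^{\otimes(i-1)}\otimes\psi\otimes\operatorname{id}^{\otimes(n-i)}$. $S_n$ acts on $F^{\otimes n}$ by superpermuting factors, written ${}^\pi\mathbf{f}$: for the simple transposition $s_i$ of $i,i+1$, ${}^{s_i}(f_1\otimes\cdots\otimes f_n)=(-1)^{\bar f_i\bar f_{i+1}}f_1\otimes\cdots\otimes f_{i+1}\otimes f_i\otimes\cdots\otimes f_n$. The affine wreath product algebra $\mathcal{A}_n(F)$ is the free product of $\Bbbk$-algebras $\Bbbk[x_1,\dots,x_n]\star F^{\otimes n}\star\Bbbk S_n$ modulo the relations: $\mathbf{f}x_i=x_i\psi_i(\mathbf{f})$ ($1\le i\le n$, $\mathbf f\in F^{\otimes n}$); $s_ix_j=x_js_i$ ($j\ne i,i+1$); $s_ix_i=x_{i+1}s_i-t_{i,i+1}$ ($1\le i\le n-1$); $\pi\mathbf{f}={}^\pi\mathbf{f}\,\pi$ ($\pi\in S_n$). Here $t_{i,j}=\sum_{b\in B}b_i(b^\vee)_j$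 for $i\neq j$. Gradings: $|x_i|=\delta$, $\bar x_i=0$; $|f_i|=|f|$, $\bar f_i=\bar f$; $|\pi|=0$, $\bar\pi=0$. $P_n(F)$ is the graded superalgebra with $P_n(F)=\Bbbk[x_1,\dots,x_n]\otimes F^{\otimes n}$ as a $\Bbbk$-module, the two factors being subalgebras, with relations $\mathbf{f}x_i=x_i\psi_i(\mathbf{f})$. $S_n$ acts on $P_n(F)$, written ${}^\pi a$, by permuting the $x_i$ and superpermuting the factors of $F^{\otimes n}$. There is a natural homomorphism $P_n(F)\to\mathcal{A}_n(F)$, and elements of $P_n(F)$ and $\Bbbk S_n$ are viewed as elements of $\mathcal{A}_n(F)$ via the natural maps. For $1\le i\le n-1$, $\Delta_i\colon P_n(F)\to P_n(F)$ is the $\Bbbk$-linear map determined by $\Delta_i(F^{\otimes n})=0$, $\Delta_i(x_i)=t_{i,i+1}$, $\Delta_i(x_{i+1})=-t_{i+1,i}$, $\Delta_i(x_j)=0$ for $j\ne i,i+1$, and $\Delta_i(a_1a_2)=\Delta_i(a_1)a_2+{}^{s_i}a_1\,\Delta_i(a_2)$. $V=P_n(F)\otimes\Bbbk S_n$ is an $\mathcal{A}_n(F)$-module via $z\cdot(a\otimes w)=za\otimes w$ and $s_i\cdot(a\otimes w)={}^{s_i}a\otimes s_iw-\Delta_i(a)\otimes w$ for $z,a\in P_n(F)$, $w\in\Bbbk S_n$, $1\le i\le n-1$. The graded dimension of a $(\mathbb{Z}\times\mathbb{Z}_2)$-graded $\Bbbk$-module $W$ with (free) finite-rank graded pieces is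 $\operatorname{grdim}W=\sum_{i,\varepsilon}(\dim W_{i,\varepsilon})q^i\varpi^\varepsilon$, where $\varpi^2=1$. *)

(* Defs.v *)
From HB Require Import structures.
From mathcomp Require Import all_boot all_order all_algebra all_fingroup.
From mathcomp Require Import generic_quotient boolp mpoly.

Set Implicit Arguments.
Unset Strict Implicit.
Unset Printing Implicit Defensive.

Import GRing.Theory.
Local Open Scope ring_scope.

Section GradedModules.

Variables (k : comNzRingType) (M : lmodType k).
Implicit Type W : M -> Prop.

Record is_basis W (J : eqType) (b : J -> M) : Prop := IsBasis {
  basis_in : forall j, W (b j);
  basis_span : forall v, W v ->
    exists (s : seq J) (c : J -> k), v = \sum_(j <- s) c j *: b j;
  basis_free : forall (s : seq J) (c : J -> k), uniq s ->
    \sum_(j <- s) c j *: b j = 0 -> {in s, forall j, c j = 0} }.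

Definition free_module : Prop :=
  exists (J : eqType) (b : J -> M), is_basis (fun=> True) b.

Definition has_rank W (m : nat) : Prop := exists b : 'I_m -> M, is_basis W b.

(* The rank of W; junk value 0 when W is not free of finite rank. *)
Definition rank W : nat :=
  if pselect (exists m, has_rank W m) is left h then sval (cid h) else 0.

(* A grading by degree (in nat, so with no component of negative degree) and
   by parity (true is odd): M is the direct sum of the gr d e. *)
Record is_grading (gr : nat -> bool -> M -> Prop) : Prop := IsGrading {
  gr_zero : forall d e, gr d e 0;
  gr_lin : forall d e (c : k) u v, gr d e u -> gr d e v -> gr d e (c *: u + v);
  gr_span : forall v, exists N (w : nat -> bool -> M),
    (forall d e, gr d e (w d e)) /\ v = \sum_(d < N) \sum_(e : bool) w d e;
  gr_indep : forall N (w : nat -> bool -> M), (forall d e, gr d e (w d e)) ->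
    \sum_(d < N) \sum_(e : bool) w d e = 0 ->
    forall d e, (d < N)%N -> w d e = 0 }.

End GradedModules.

(* Power series in q with coefficients in Z[varpi]/(varpi^2 - 1): s d e is
   the coefficient of q^d varpi^e. *)
Definition qseries := nat -> bool -> int.

Definition qs_one : qseries := fun d e => ((d == 0%N) && ~~ e)%:R.

Definition qs_mul (s t : qseries) : qseries := fun d e =>
  \sum_(i < d.+1) \sum_(u : bool) s i u * t (d - i)%N (u (+) e).

Definition qs_exp (s : qseries) (m : nat) : qseries := iter m (qs_mul s) qs_one.

Definition qs_geom (delta : nat) : qseries :=
  fun d e => ((delta %| d)%N && ~~ e)%:R.

(* qs_geom delta is 1 / (1 - q ^ delta). *)
Lemma qs_geomK (delta : nat) : (0 < delta)%N ->
  qs_mul (fun d e => qs_one d e - ((d == delta) && ~~ e)%:R) (qs_geom delta)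
  = qs_one.
Proof.
move=> delta_gt0; apply/funext => d; apply/funext => e.
rewrite /qs_mul /qs_geom /qs_one.
under eq_bigr => i _ do rewrite big_bool /= !andbF !andbT subrr mul0r add0r.
under eq_bigr => i _ do rewrite mulrBl.
rewrite sumrB big_ord_recl /= mul1r subn0 big1 ?addr0; last first.
  by move=> i _; rewrite mul0r.
have [lt_d|le_d] := ltnP d delta.
  rewrite big1 ?subr0 => [|i _]; last first.
    by rewrite (ltn_eqF (leq_trans (ltn_ord i) lt_d)) mul0r.
  by case: d lt_d => [|d] lt_d; rewrite ?dvdn0 // gtnNdvd.
rewrite (bigD1 (Ordinal (le_d : delta < d.+1)%N)) //= eqxx mul1r big1 ?addr0.
  have dvdB : (delta %| d)%N = (delta %| d - delta)%N.
    by rewrite -{1}(subnK le_d) dvdn_addl.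
  by rewrite dvdB subrr; case: d le_d {dvdB} => //; rewrite leqNgt delta_gt0.
by move=> i /negPf; rewrite -val_eqE /= => ->; rewrite mul0r.
Qed.

Definition grdim (k : comNzRingType) (M : lmodType k)
  (gr : nat -> bool -> M -> Prop) : qseries := fun d e => (rank (gr d e))%:Z.

Definition has_char (R : pzRingType) (p : nat) : Prop :=
  forall m : nat, (m%:R = 0 :> R) <-> (p %| m)%N.

(* An N-graded Frobenius superalgebra, free of finite rank over k, together with
   its maximal degree fdelta, its trace ftr, of degree - fdelta, its Nakayama
   automorphism fpsi, and a homogeneous basis fb with left dual basis fdual.
   By ftr_frob, f |-> (g |-> (-1) ^ (|f| |g|) tr(g f)) is an isomorphism from F
   to Hom(F, k); its values are stated on homogeneous f and g only. *)
Record frob_superalg (k : comNzRingType) := FrobSuperalg {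
  falg :> algType k;
  fgr : nat -> bool -> falg -> Prop;
  fgr_grading : is_grading fgr;
  fgr_one : fgr 0%N false 1;
  fgr_mul : forall d e d' e' f g,
    fgr d e f -> fgr d' e' g -> fgr (d + d')%N (e (+) e') (f * g);

  fdelta : nat;
  fdelta_attained : exists e f, fgr fdelta e f /\ f <> 0;
  fdelta_max : forall d e f, fgr d e f -> f <> 0 -> (d <= fdelta)%N;

  ftr : {scalar falg};
  ftr_even : forall d f, fgr d true f -> ftr f = 0;
  ftr_deg : forall d e f, fgr d e f -> d <> fdelta -> ftr f = 0;
  ftr_frob : exists phi : falg -> {scalar falg},
    [/\ forall c f f' g, phi (c *: f + f') g = c * phi f g + phi f' g,
        forall d e f d' e' g, fgr d e f -> fgr d' e' g ->
          phi f g = (-1) ^+ (e && e') * ftr (g * f),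
        forall f f', (forall g, phi f g = phi f' g) -> f = f'
      & forall l : {scalar falg}, exists f, forall g, phi f g = l g];

  fpsi : {lrmorphism falg -> falg};
  fpsi_gr : forall d e f, fgr d e f -> fgr d e (fpsi f);
  fpsi_tr : forall d e f d' e' g, fgr d e f -> fgr d' e' g ->
    ftr (f * g) = (-1) ^+ (e && e') * ftr (g * fpsi f);

  fB : finType;
  fb : fB -> falg;
  fdeg : fB -> nat;
  fpar : fB -> bool;
  fb_gr : forall b, fgr (fdeg b) (fpar b) (fb b);
  fb_basis : is_basis (fun=> True) fb;
  fdual : fB -> falg;
  fdualP : forall b c, ftr (fdual b * fb c) = (b == c)%:R }.

Definition has_order (T : Type) (f : T -> T) (theta : nat) : Prop :=
  [/\ (0 < theta)%N, iter theta f =1 id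
    & forall j, (0 < j < theta)%N -> ~ (iter j f =1 id)].

Definition has_eigenbasis (k : comNzRingType) (M : lmodType k) (f : M -> M) :=
  exists (J : eqType) (e : J -> M),
    is_basis (fun=> True) e /\ forall j, exists c : k, f (e j) = c *: e j.

Section TensorPower.

Variables (k : comNzRingType) (F : frob_superalg k) (n : nat).
Local Notation W := {ffun 'I_n -> fB F}.
Implicit Types (w v u : W) (h : 'I_n -> F).

(* The n-th tensor power of F, in coordinates on the basis formed by the
   fb (w 0) (x) ... (x) fb (w (n-1)). *)
Definition tens := {ffun W -> k^o}.

HB.instance Definition _ := GRing.Lmodule.on tens.

Definition coord (b : fB F) (f : F) : k := ftr F (fdual b * f).

(* h 0 (x) ... (x) h (n-1) *)
Definition pure h : tens := [ffun w : W => \prod_(i < n) coord (w i) (h i)].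

(* The sign produced when elements of parities q 0, ..., q (n-1) move left
   past elements of parities p 0, ..., p (n-1) into their tensor positions. *)
Definition ksign (p q : 'I_n -> bool) : k :=
  \prod_(i < n) \prod_(j < n | (j < i)%N) (-1) ^+ (p i && q j).

Definition tens_one : tens := pure (fun=> 1).

Definition tens_mul (f g : tens) : tens :=
  \sum_(w : W) \sum_(v : W)
    (f w * g v * ksign (fun i => fpar (w i)) (fun i => fpar (v i)))
    *: pure (fun i => fb (w i) * fb (v i)).

Lemma coordZD b (c : k) f f' :
  coord b (c *: f + f') = c * coord b f + coord b f'.
Proof. by rewrite /coord mulrDr -scalerAr linearP. Qed.

Lemma coord_sum b (J : Type) (s : seq J) (c : J -> k) (f : J -> F) :
  coord b (\sum_(j <- s) c j *: f j) = \sum_(j <- s) c j * coord b (f j).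
Proof.
elim: s => [|j s IHs]; first by rewrite !big_nil /coord mulr0 linear0.
by rewrite !big_cons coordZD IHs.
Qed.

Lemma coord_fb b c : coord b (fb c) = (b == c)%:R.
Proof. exact: fdualP. Qed.

Lemma coordE f : f = \sum_(b : fB F) coord b f *: fb b.
Proof.
have [s [c ->]] := @basis_span _ _ _ _ _ (fb_basis F) f I.
under [RHS]eq_bigr => b _ do rewrite coord_sum scaler_suml.
rewrite exchange_big /=; apply: eq_bigr => j _.
rewrite (bigD1 j) //= coord_fb eqxx mulr1 big1 ?addr0 // => b /negPf b_j.
by rewrite coord_fb b_j mulr0 scale0r.
Qed.

Lemma coord_parity d e f b : fgr d e f -> fpar b != e -> coord b f = 0.
Proof.
move=> f_de b_e.
pose N := (maxn d (\max_(b' : fB F) fdeg b')).+1.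
pose w (d' : nat) (e' : bool) : F :=
  (\sum_(b' | (fdeg b' == d') && (fpar b' == e')) coord b' f *: fb b') + (- ((d' == d) && (e' == e))%:R) *: f.
have w_gr d' e' : fgr d' e' (w d' e').
  rewrite /w addrC; case: andP => [[/eqP-> /eqP->]|_].
    apply: gr_lin (fgr_grading F) _ _ _ _ _ f_de _.
    apply: (big_ind (fgr d e)) => [|u v gu gv|b' /andP[/eqP<- /eqP<-]].
    - exact: gr_zero (fgr_grading F) _ _.
    - by rewrite -[u]scale1r; apply: gr_lin (fgr_grading F) _ _ _ _ _ gu gv.
    rewrite -[_ *: _]addr0; apply: gr_lin (fgr_grading F) _ _ _ _ _ _ _.
      exact: fb_gr.
    exact: gr_zero (fgr_grading F) _ _.
  rewrite oppr0 scale0r add0r.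
  apply: (big_ind (fgr d' e')) => [|u v gu gv|b' /andP[/eqP<- /eqP<-]].
  - exact: gr_zero (fgr_grading F) _ _.
  - by rewrite -[u]scale1r; apply: gr_lin (fgr_grading F) _ _ _ _ _ gu gv.
  rewrite -[_ *: _]addr0; apply: gr_lin (fgr_grading F) _ _ _ _ _ _ _.
    exact: fb_gr.
  exact: gr_zero (fgr_grading F) _ _.
have degN (b' : fB F) : (fdeg b' < N)%N.
  by rewrite ltnS leq_max (leq_bigmax b') orbT.
have dN : (d < N)%N by rewrite ltnS leq_maxl.
have sum0 : \sum_(d' < N) \sum_(e' : bool) w d' e' = 0.
  have -> : \sum_(d' < N) \sum_(e' : bool) w d' e' =
      \sum_b' coord b' f *: fb b' - f.
    under eq_bigr => d' _ do rewrite big_split /=.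
    rewrite big_split /=; congr (_ + _).
      rewrite pair_big /=.
      by rewrite [RHS](partition_big
        (fun b' => (Ordinal (degN b'), fpar b')) predT).
    rewrite (bigD1 (Ordinal dN)) //= (bigD1 e) //= !eqxx scaleN1r.
    rewrite big1 ?addr0 => [|e' /negPf->]; last by rewrite andbF oppr0 scale0r.
    rewrite big1 ?addr0 // => d'; rewrite -val_eqE /= => /negPf->.
    by rewrite big1 // => e' _; rewrite oppr0 scale0r.
  by rewrite -coordE subrr.
have := gr_indep (fgr_grading F) w_gr sum0 (fpar b) (degN b).
rewrite /w (negPf b_e) andbF oppr0 scale0r addr0 -big_filter => s0.
apply: (@basis_free _ _ _ _ _ (fb_basis F) _ (coord^~ f) _ s0 b).
  by rewrite filter_uniq // index_enum_uniq.
by rewrite mem_filter !eqxx mem_index_enum.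
Qed.

Lemma tensE (f : tens) : f = \sum_(w : W) f w *: pure (fun i => fb (w i)).
Proof.
apply/ffunP => u; rewrite sum_ffunE (bigD1 u) //= big1 ?addr0.
  rewrite !ffunE big1 => [|i _]; last by rewrite coord_fb eqxx.
  by rewrite [RHS]mulr1.
move=> w w_u; have [i wi_ui] : exists i, w i != u i.
  apply/existsP; apply: contraR w_u => /existsPn eq_wu.
  by apply/eqP/ffunP => i; have /negPn/eqP := eq_wu i.
rewrite !ffunE (bigD1 i) //= coord_fb eq_sym (negPf wi_ui) mul0r.
exact: mulr0.
Qed.

Lemma pure_map (L : 'I_n -> F -> F) h : (forall i, linear (L i)) ->
  \sum_(w : W) (\prod_i coord (w i) (h i)) *: pure (fun i => L i (fb (w i)))
  = pure (fun i => L i (h i)).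
Proof.
move=> linL; apply/ffunP => u; rewrite sum_ffunE.
have L_sum i f : coord (u i) (L i f)
    = \sum_b coord b f * coord (u i) (L i (fb b)).
  pose A := GRing.isLinear.Build k F F *:%R (L i) (linL i).
  pose Li : {linear F -> F} := HB.pack (L i) A.
  rewrite -[L i]/(Li : F -> F) {1}(coordE f) linear_sum.
  under eq_bigr => b _ do rewrite linearZ.
  by rewrite coord_sum.
rewrite [RHS]ffunE; under [RHS]eq_bigr => i _ do rewrite L_sum.
rewrite bigA_distr_bigA /=; apply: eq_bigr => w _.
by rewrite !ffunE big_split.
Qed.

Definition has_parities (p : 'I_n -> bool) h :=
  forall i, exists d, fgr d (p i) (h i).

Lemma pure_mul p q h g : has_parities p h -> has_parities q g ->
  tens_mul (pure h) (pure g) = ksign p q *: pure (fun i => h i * g i).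
Proof.
move=> hp gq.
have eqh w : pure h w != 0 -> (fun i => fpar (w i)) = p.
  move=> nz; apply/funext => i; apply/eqP; apply: contraNT nz => wi.
  have [d hd] := hp i.
  by rewrite ffunE (bigD1 i) //= (coord_parity hd wi) mul0r.
have eqg w : pure g w != 0 -> (fun i => fpar (w i)) = q.
  move=> nz; apply/funext => i; apply/eqP; apply: contraNT nz => wi.
  have [d hd] := gq i.
  by rewrite ffunE (bigD1 i) //= (coord_parity hd wi) mul0r.
transitivity (ksign p q *: \sum_(w : W) pure h w *: \sum_(v : W) pure g v *:
    pure (fun i => fb (w i) * fb (v i))); last first.
  congr (_ *: _).
  have linl (f : F) : linear (fun a : F => a * f).
    by move=> c a a'; rewrite mulrDl -scalerAl.
  have linr (f : F) : linear (fun a : F => f * a).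
    by move=> c a a'; rewrite mulrDr -scalerAr.
  rewrite -(@pure_map (fun i a => a * g i)) //.
  apply: eq_bigr => w _; rewrite ffunE; congr (_ *: _).
  rewrite -(@pure_map (fun i a => fb (w i) * a)) //.
  by apply: eq_bigr => v _; rewrite ffunE.
rewrite scaler_sumr; apply: eq_bigr => w _; rewrite !scaler_sumr.
apply: eq_bigr => v _; rewrite !scalerA.
have [->|/eqh->] := eqVneq (pure h w) 0; first by rewrite !(mul0r, mulr0, scale0r).
have [->|/eqg->] := eqVneq (pure g v) 0; first by rewrite !(mulr0, mul0r, scale0r).
by congr (_ *: _); rewrite mulrC mulrA.
Qed.

Lemma tens_mulZDl (c : k) f f' g :
  tens_mul (c *: f + f') g = c *: tens_mul f g + tens_mul f' g.
Proof.
rewrite /tens_mul scaler_sumr -big_split; apply: eq_bigr => w _ /=.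
rewrite scaler_sumr -big_split; apply: eq_bigr => v _ /=.
by rewrite scalerA -scalerDl !ffunE !mulrDl !mulrA.
Qed.

Lemma tens_mulZDr (c : k) f g g' :
  tens_mul f (c *: g + g') = c *: tens_mul f g + tens_mul f g'.
Proof.
rewrite /tens_mul scaler_sumr -big_split; apply: eq_bigr => w _ /=.
rewrite scaler_sumr -big_split; apply: eq_bigr => v _ /=.
rewrite scalerA -scalerDl !ffunE; congr (_ *: _).
rewrite [_ *: _ + _]/(c * g v + g' v) mulrDr mulrDl; congr (_ + _).
by rewrite !mulrA (mulrC (f w)).
Qed.

Lemma tens_mul0l g : tens_mul 0 g = 0.
Proof.
by have := tens_mulZDl (-1) 0 0 g; rewrite scaler0 addr0 scaleN1r addNr.
Qed.

Lemma tens_mul0r f : tens_mul f 0 = 0.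
Proof.
by have := tens_mulZDr (-1) f 0 0; rewrite scaler0 addr0 scaleN1r addNr.
Qed.

Lemma tens_mulDl : left_distributive tens_mul +%R.
Proof. by move=> f f' g; have := tens_mulZDl 1 f f' g; rewrite !scale1r. Qed.

Lemma tens_mulDr : right_distributive tens_mul +%R.
Proof. by move=> f g g'; have := tens_mulZDr 1 f g g'; rewrite !scale1r. Qed.

Lemma tens_mulZl (c : k) f g : c *: tens_mul f g = tens_mul (c *: f) g.
Proof. by have := tens_mulZDl c f 0 g; rewrite tens_mul0l !addr0. Qed.

Lemma tens_mulZr (c : k) f g : c *: tens_mul f g = tens_mul f (c *: g).
Proof. by have := tens_mulZDr c f g 0; rewrite tens_mul0r !addr0. Qed.

Lemma tens_suml (J : finType) (f : J -> tens) g :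
  tens_mul (\sum_j f j) g = \sum_j tens_mul (f j) g.
Proof.
apply: (big_morph (tens_mul^~ g)); last exact: tens_mul0l.
by move=> a b; rewrite tens_mulDl.
Qed.

Lemma tens_sumr (J : finType) f (g : J -> tens) :
  tens_mul f (\sum_j g j) = \sum_j tens_mul f (g j).
Proof.
apply: (big_morph (tens_mul f)); last exact: tens_mul0r.
by move=> a b; rewrite tens_mulDr.
Qed.

Lemma ksignDl p p' q :
  ksign (fun i => p i (+) p' i) q = ksign p q * ksign p' q.
Proof.
rewrite /ksign -big_split; apply: eq_bigr => i _ /=; rewrite -big_split.
by apply: eq_bigr => j _ /=; rewrite andb_addl signr_addb.
Qed.

Lemma ksignDr p q q' :
  ksign p (fun i => q i (+) q' i) = ksign p q * ksign p q'.
Proof.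
rewrite /ksign -big_split; apply: eq_bigr => i _ /=; rewrite -big_split.
by apply: eq_bigr => j _ /=; rewrite andb_addr signr_addb.
Qed.

Lemma ksign0l q : ksign (fun=> false) q = 1.
Proof. by rewrite /ksign big1 // => i _; rewrite big1. Qed.

Lemma ksign0r p : ksign p (fun=> false) = 1.
Proof.
by rewrite /ksign big1 // => i _; rewrite big1 // => j _; rewrite andbF.
Qed.

Lemma has_parities1 : has_parities (fun=> false) (fun=> 1).
Proof. by move=> i; exists 0%N; apply: fgr_one. Qed.

Lemma has_parities_fb w :
  has_parities (fun i => fpar (w i)) (fun i => fb (w i)).
Proof. by move=> i; exists (fdeg (w i)); apply: fb_gr. Qed.

Lemma has_paritiesM p q h g : has_parities p h -> has_parities q g ->
  has_parities (fun i => p i (+) q i) (fun i => h i * g i).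
Proof.
move=> hp gq i; have [d hd] := hp i; have [d' gd] := gq i.
by exists (d + d')%N; apply: fgr_mul.
Qed.

Lemma tens_mul1l : left_id tens_one tens_mul.
Proof.
move=> f; rewrite {1}(tensE f) tens_sumr {2}(tensE f).
apply: eq_bigr => w _; rewrite -tens_mulZr; congr (_ *: _).
rewrite (pure_mul has_parities1 (has_parities_fb w)) ksign0l scale1r.
by congr pure; apply/funext => i; rewrite mul1r.
Qed.

Lemma tens_mul1r : right_id tens_one tens_mul.
Proof.
move=> f; rewrite {1}(tensE f) tens_suml {2}(tensE f).
apply: eq_bigr => w _; rewrite -tens_mulZl; congr (_ *: _).
rewrite (pure_mul (has_parities_fb w) has_parities1) ksign0r scale1r.
by congr pure; apply/funext => i; rewrite mulr1.
Qed.

Lemma tens_ind (Q : tens -> Prop) :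
  (forall f g, Q f -> Q g -> Q (f + g)) -> (forall (c : k) f, Q f -> Q (c *: f)) ->
  (forall w, Q (pure (fun i => fb (w i)))) -> Q 0 -> forall f, Q f.
Proof.
move=> QD QZ Qb Q0 f; rewrite (tensE f).
by apply: (big_ind Q) => // w _; apply/QZ/Qb.
Qed.

Lemma tens_mulA : associative tens_mul.
Proof.
move=> f g h; elim/tens_ind: f => [f f' IHf IHf'|c f IHf|w|].
- by rewrite !tens_mulDl IHf IHf'.
- by rewrite -!tens_mulZl IHf.
- elim/tens_ind: g => [g g' IHg IHg'|c g IHg|v|].
  + by rewrite tens_mulDl !tens_mulDr tens_mulDl IHg IHg'.
  + by rewrite -tens_mulZl -!tens_mulZr -tens_mulZl IHg.
  + elim/tens_ind: h => [h h' IHh IHh'|c h IHh|u|].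
    * by rewrite !tens_mulDr IHh IHh'.
    * by rewrite -!tens_mulZr IHh.
    * have [pw [pv pu]] := (has_parities_fb w, (has_parities_fb v, has_parities_fb u)).
      rewrite (pure_mul pv pu) (pure_mul pw pv) -tens_mulZr -tens_mulZl.
      rewrite (pure_mul pw (has_paritiesM pv pu)).
      rewrite (pure_mul (has_paritiesM pw pv) pu).
      rewrite ksignDl ksignDr !scalerA; congr (_ *: pure _).
        by rewrite mulrC mulrA.
      by apply/funext => i; rewrite mulrA.
    * by rewrite !tens_mul0r.
  + by rewrite tens_mul0l !tens_mul0r tens_mul0l.
- by rewrite !tens_mul0l.
Qed.

Lemma tens_oner_neq0 : tens_one != 0.
Proof.
have [b _|noB] := pickP (mem (fB F)); last first.
  by have /eqP[] := oner_neq0 F; rewrite (coordE 1) big_pred0 ?eqxx.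
apply/eqP => one0; have := tens_mul1l (pure (fun=> fb b)).
rewrite one0 tens_mul0l => /ffunP/(_ [ffun=> b]); rewrite !ffunE.
rewrite big1 => [/esym/eqP|i _]; first by rewrite oner_eq0.
by rewrite ffunE coord_fb eqxx.
Qed.

HB.instance Definition _ := GRing.Zmodule_isNzRing.Build tens
  tens_mulA tens_mul1l tens_mul1r tens_mulDl tens_mulDr tens_oner_neq0.
HB.instance Definition _ := GRing.Lmodule_isLalgebra.Build k tens tens_mulZl.
HB.instance Definition _ := GRing.Lalgebra_isAlgebra.Build k tens tens_mulZr.

Lemma pureM p q h g : has_parities p h -> has_parities q g ->
  pure h * pure g = ksign p q *: pure (fun i => h i * g i).
Proof. exact: pure_mul. Qed.

Definition tens_gr (d : nat) (e : bool) (f : tens) : Prop :=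
  forall w, f w != 0 -> (\sum_i fdeg (w i))%N = d
    /\ \big[addb/false]_i fpar (w i) = e.

Definition tens_at (i : 'I_n) (f : F) : tens :=
  pure (fun j => if j == i then f else 1).

Definition tens_t (i j : 'I_n) : tens :=
  \sum_b tens_at i (fb b) * tens_at j (fdual b).

(* psi_0 ^ (m 0) ... psi_(n-1) ^ (m (n-1)); psi_i is the case m = U_(i). *)
Definition tens_psi (m : 'X_{1..n}) (f : tens) : tens :=
  \sum_(w : W) f w *: pure (fun i => iter (m i) (fpsi F) (fb (w i))).

(* The superpermutation action, for which the factor in position i moves to
   position s i, with a sign for each pair of odd factors that is inverted. *)
Definition tens_perm (s : 'S_n) (f : tens) : tens :=
  \sum_(w : W) (f w * \prod_(i < n) \prod_(j < n | (i < j)%N && (s j < s i)%N)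
                  (-1) ^+ (fpar (w i) && fpar (w j)))
    *: pure (fun i => fb (w ((s^-1)%g i))).

End TensorPower.

Section PolynomialTensor.

Variables (k : comNzRingType) (F : frob_superalg k) (n : nat).
Local Notation T := (tens F n).

(* k[x] (x) F^(x)n as a module, f *: 'X_[m] standing for x^m (x) f. The
   product is not that of {mpoly T[n]}: f x^m = x^m psi^m(f). *)
Definition polt := {mpoly T[n]}.

HB.instance Definition _ := GRing.Zmodule.on polt.

Implicit Types (a b : polt) (m : 'X_{1..n}).

Definition polt_scale (c : k) a : polt := (c%:A : T) *: (a : {mpoly T[n]}).

Lemma polt_scaleA c c' a :
  polt_scale c (polt_scale c' a) = polt_scale (c * c') a.
Proof. by rewrite /polt_scale scalerA -scalerAl mul1r scalerA. Qed.
Lemma polt_scale1 : left_id 1 polt_scale.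
Proof. by move=> a; rewrite /polt_scale !scale1r. Qed.
Lemma polt_scaleDr : right_distributive polt_scale +%R.
Proof. by move=> c a b; rewrite /polt_scale scalerDr. Qed.
Lemma polt_scaleDl a : {morph polt_scale^~ a : c c' / c + c'}.
Proof. by move=> c c'; rewrite /polt_scale !scalerDl. Qed.

HB.instance Definition _ := GRing.Zmodule_isLmodule.Build k polt
  polt_scaleA polt_scale1 polt_scaleDr polt_scaleDl.

Definition mono (f : T) m : polt := (f *: 'X_[m])%R.

Definition polt_one : polt := mono 1 0%MM.

Definition polt_mul a b : polt :=
  \sum_(m <- msupp a) \sum_(m' <- msupp b)
    mono (tens_psi m' a@_m * b@_m') (m + m')%MM.

Lemma tens_psiZD m (c : k) (f g : T) :
  tens_psi m (c *: f + g) = c *: tens_psi m f + tens_psi m g.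
Proof.
rewrite /tens_psi scaler_sumr -big_split; apply: eq_bigr => w _ /=.
by rewrite scalerA -scalerDl !ffunE.
Qed.

Lemma iter_psi_linear j : linear (iter j (fpsi F)).
Proof. by elim: j => // j IHj c f g; rewrite /= IHj linearP. Qed.

Lemma tens_psi_pure m h :
  tens_psi m (pure h) = pure (fun i => iter (m i) (fpsi F) (h i)).
Proof.
rewrite -(@pure_map _ _ _ (fun i => iter (m i) (fpsi F))); last first.
  by move=> i; apply: iter_psi_linear.
by apply: eq_bigr => w _; rewrite ffunE.
Qed.

HB.instance Definition _ m :=
  GRing.isLinear.Build k T T *:%R (@tens_psi k F n m) (tens_psiZD m).

Lemma tens_psi1 m : tens_psi m (1 : T) = 1.
Proof.
rewrite [1]/(tens_one F n) tens_psi_pure; congr pure; apply/funext => i.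
by elim: (m i) => //= j ->; rewrite rmorph1.
Qed.

Lemma has_parities_psi m p (h : 'I_n -> F) : has_parities p h ->
  has_parities p (fun i => iter (m i) (fpsi F) (h i)).
Proof.
move=> hp i; have [d hd] := hp i; exists d.
by elim: (m i) => //= j IHj; apply: fpsi_gr.
Qed.

Lemma tens_psiM m (f g : T) : tens_psi m (f * g) = tens_psi m f * tens_psi m g.
Proof.
rewrite {1 2}(tensE f) mulr_suml !linear_sum mulr_suml.
apply: eq_bigr => w _; rewrite -scalerAl !linearZ -scalerAl; congr (_ *: _).
rewrite (tensE g) mulr_sumr !linear_sum mulr_sumr /=.
apply: eq_bigr => v _; rewrite -scalerAr !linearZ -scalerAr; congr (_ *: _).
have [pw pv] := (has_parities_fb w, has_parities_fb v).
rewrite (pureM pw pv) linearZ /= !tens_psi_pure.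
rewrite (pureM (has_parities_psi m pw) (has_parities_psi m pv)).
congr (_ *: pure _); apply/funext => i.
by elim: (m i) => //= j ->; rewrite rmorphM.
Qed.

Lemma tens_psiD m m' (f : T) :
  tens_psi m (tens_psi m' f) = tens_psi (m + m')%MM f.
Proof.
elim/tens_ind: f => [f f' IHf IHf'|c f IHf|w|]; last by rewrite !linear0.
- by rewrite !linearD /= IHf IHf'.
- by rewrite !linearZ /= IHf.
rewrite !tens_psi_pure; congr pure.
by apply/funext => i; rewrite mnmDE iterD.
Qed.

Lemma tens_psi0 (f : T) : tens_psi 0%MM f = f.
Proof.
rewrite [RHS](tensE f); apply: eq_bigr => w _; congr (_ *: pure _).
by apply/funext => i; rewrite mnm0E.
Qed.

Lemma monoD f g m : mono (f + g) m = mono f m + mono g m.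
Proof. exact: (scalerDl ('X_[m] : {mpoly T[n]}) f g). Qed.
Lemma poltE a : a = \sum_(m <- msupp a) mono a@_m m.
Proof. exact: mpolyE. Qed.
Lemma coeff_mono f m m' : (mono f m)@_m' = (m == m')%:R * f.
Proof. by rewrite mcoeffZ mcoeffX; case: eqP; rewrite ?mulr1 ?mul1r ?mulr0 ?mul0r. Qed.

Section SumSupp.
Variables (E : 'X_{1..n} -> T -> polt).
Hypothesis (E_lin : forall m f g, E m (f + g) = E m f + E m g).

Lemma E_zero m : E m 0 = 0.
Proof. by apply: (@addrI _ (E m 0)); rewrite -E_lin !addr0. Qed.

Lemma sum_msupp_wide a (s : seq 'X_{1..n}) : uniq s -> {subset msupp a <= s} ->
  \sum_(m <- msupp a) E m a@_m = \sum_(m <- s) E m a@_m.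
Proof.
move=> s_uniq sub_s; rewrite [RHS](bigID (mem (msupp a))) /=.
rewrite [X in _ = _ + X]big1 ?addr0; last first.
  by move=> m /memN_msupp_eq0->; rewrite E_zero.
rewrite -[RHS]big_filter; apply: perm_big; apply: uniq_perm => //.
  by rewrite filter_uniq.
by move=> m; rewrite mem_filter /= andb_idr //; apply: sub_s.
Qed.

Lemma sum_msuppD a b : \sum_(m <- msupp (a + b)) E m (a + b)@_m =
  \sum_(m <- msupp a) E m a@_m + \sum_(m <- msupp b) E m b@_m.
Proof.
pose s := undup (msupp a ++ msupp b ++ msupp (a + b)).
have s_in c : {subset msupp c <= msupp a ++ msupp b ++ msupp (a + b)} ->
    \sum_(m <- msupp c) E m c@_m = \sum_(m <- s) E m c@_m.
  by move=> sub; apply: sum_msupp_wide => [|m /sub]; rewrite ?undup_uniq ?mem_undup.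
rewrite !s_in; first 1 last.
- by move=> m; rewrite !mem_cat => ->; rewrite orbT.
- by move=> m; rewrite !mem_cat => ->.
- by move=> m; rewrite !mem_cat => ->; rewrite !orbT.
by rewrite -big_split; apply: eq_bigr => m _; rewrite mcoeffD E_lin.
Qed.

Lemma sum_msupp_mono f m0 :
  \sum_(m <- msupp (mono f m0)) E m (mono f m0)@_m = E m0 f.
Proof.
rewrite (@sum_msupp_wide _ [:: m0]) //.
  by rewrite big_seq1 coeff_mono eqxx mul1r.
move=> m; rewrite mcoeff_msupp coeff_mono inE [m == m0]eq_sym.
by have [//|_] := eqVneq m0 m; rewrite mul0r eqxx.
Qed.
End SumSupp.

Let mulE b m (f : T) : polt :=
  \sum_(m' <- msupp b) mono (tens_psi m' f * b@_m') (m + m')%MM.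

Let mulE_lin b m f g : mulE b m (f + g) = mulE b m f + mulE b m g.
Proof.
rewrite /mulE -big_split; apply: eq_bigr => m' _.
by rewrite linearD mulrDl monoD.
Qed.

Let mulE_lin2 m f m' (g g' : T) :
  mono (tens_psi m' f * (g + g')) (m + m')%MM =
  mono (tens_psi m' f * g) (m + m')%MM + mono (tens_psi m' f * g') (m + m')%MM.
Proof. by rewrite mulrDr monoD. Qed.

Lemma polt_mulDl : left_distributive polt_mul +%R.
Proof. by move=> a a' b; apply: sum_msuppD (mulE_lin b) a a'. Qed.

Lemma polt_mulDr : right_distributive polt_mul +%R.
Proof.
move=> a b b'; rewrite /polt_mul -big_split; apply: eq_bigr => m _ /=.
exact: sum_msuppD (mulE_lin2 m a@_m) b b'.
Qed.

Lemma polt_mul_mono f m f' m' :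
  polt_mul (mono f m) (mono f' m') = mono (tens_psi m' f * f') (m + m')%MM.
Proof.
rewrite [LHS](sum_msupp_mono (mulE_lin (mono f' m'))).
exact: sum_msupp_mono (mulE_lin2 m f) f' m'.
Qed.

Lemma polt_mul0l b : polt_mul 0 b = 0.
Proof. by apply: (@addrI _ (polt_mul 0 b)); rewrite -polt_mulDl !addr0. Qed.
Lemma polt_mul0r a : polt_mul a 0 = 0.
Proof. by apply: (@addrI _ (polt_mul a 0)); rewrite -polt_mulDr !addr0. Qed.

Lemma polt_ind (Q : polt -> Prop) : Q 0 ->
  (forall a b, Q a -> Q b -> Q (a + b)) -> (forall f m, Q (mono f m)) ->
  forall a, Q a.
Proof. by move=> Q0 QD Qm a; rewrite (poltE a); apply: big_ind. Qed.

Lemma polt_mulA : associative polt_mul.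
Proof.
move=> a b c; elim/polt_ind: a => [|a a' IHa IHa'|f m].
- by rewrite !polt_mul0l.
- by rewrite !polt_mulDl IHa IHa'.
elim/polt_ind: b => [|b b' IHb IHb'|f' m'].
- by rewrite polt_mul0r !polt_mul0l polt_mul0r.
- by rewrite polt_mulDl !polt_mulDr polt_mulDl IHb IHb'.
elim/polt_ind: c => [|c c' IHc IHc'|f'' m''].
- by rewrite !polt_mul0r.
- by rewrite !polt_mulDr IHc IHc'.
rewrite (polt_mul_mono f' m') (polt_mul_mono f m) (polt_mul_mono f m).
rewrite (polt_mul_mono _ _ f'') tens_psiM tens_psiD addmA mulrA.
by rewrite [(m'' + m')%MM]addmC.
Qed.

Lemma polt_mul1l : left_id polt_one polt_mul.
Proof.
elim/polt_ind => [|a a' IHa IHa'|f m]; first exact: polt_mul0r.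
  by rewrite polt_mulDr IHa IHa'.
by rewrite polt_mul_mono tens_psi1 mul1r add0m.
Qed.

Lemma polt_mul1r : right_id polt_one polt_mul.
Proof.
elim/polt_ind => [|a a' IHa IHa'|f m]; first exact: polt_mul0l.
  by rewrite polt_mulDl IHa IHa'.
by rewrite polt_mul_mono tens_psi0 mulr1 addm0.
Qed.

Lemma polt_oner_neq0 : polt_one != 0.
Proof.
apply/eqP => /(congr1 (mcoeff 0%MM)); rewrite coeff_mono eqxx mul1r mcoeff0.
exact/eqP/oner_neq0.
Qed.

HB.instance Definition _ := GRing.Zmodule_isNzRing.Build polt
  polt_mulA polt_mul1l polt_mul1r polt_mulDl polt_mulDr polt_oner_neq0.

Lemma poltM f m f' m' :
  mono f m * mono f' m' = mono (tens_psi m' f * f') (m + m')%MM.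
Proof. exact: polt_mul_mono. Qed.

Lemma polt_scale_mono (c : k) f m : c *: mono f m = mono (c *: f) m.
Proof.
transitivity (mono (c%:A * f) m); last by rewrite -scalerAl mul1r.
exact: (scalerA (c%:A : T) f ('X_[m] : {mpoly T[n]})).
Qed.

Lemma polt_scaleAl (c : k) a b : c *: (a * b) = (c *: a) * b.
Proof.
elim/polt_ind: a => [|a a' IHa IHa'|f m].
- by rewrite mul0r !scaler0 mul0r.
- by rewrite mulrDl !scalerDr mulrDl IHa IHa'.
elim/polt_ind: b => [|b b' IHb IHb'|f' m'].
- by rewrite !mulr0 scaler0.
- by rewrite !mulrDr scalerDr IHb IHb'.
rewrite (polt_scale_mono c f) (poltM f) (poltM (c *: f)) polt_scale_mono.
by rewrite linearZ -scalerAl.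
Qed.

Lemma polt_scaleAr (c : k) a b : c *: (a * b) = a * (c *: b).
Proof.
elim/polt_ind: a => [|a a' IHa IHa'|f m].
- by rewrite !mul0r scaler0.
- by rewrite !mulrDl scalerDr IHa IHa'.
elim/polt_ind: b => [|b b' IHb IHb'|f' m'].
- by rewrite mulr0 !scaler0 mulr0.
- by rewrite mulrDr !scalerDr mulrDr IHb IHb'.
rewrite (polt_scale_mono c f') (poltM f _ f') (poltM f) polt_scale_mono.
by rewrite scalerAr.
Qed.

HB.instance Definition _ := GRing.Lmodule_isLalgebra.Build k polt polt_scaleAl.
HB.instance Definition _ := GRing.Lalgebra_isAlgebra.Build k polt polt_scaleAr.

Definition polx (i : 'I_n) : polt := mono 1 U_(i)%MM.
Definition polf (f : T) : polt := mono f 0%MM.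

Definition polt_gr (d : nat) (e : bool) (a : polt) : Prop :=
  forall m, a@_m != 0 ->
    exists d', (d = fdelta F * mdeg m + d')%N /\ tens_gr d' e a@_m.

Definition polt_perm (s : 'S_n) (a : polt) : polt :=
  \sum_(m <- msupp a)
    mono (tens_perm s a@_m) [multinom m ((s^-1)%g i) | i < n].

(* The indices i and i + 1 of the simple transposition s_i, 0 <= i < n - 1. *)
Definition idx_lo (i : 'I_n.-1) : 'I_n := widen_ord (leq_pred n) i.
Lemma idx_hi_subproof (i : 'I_n.-1) : (i.+1 < n)%N.
Proof. by rewrite -ltn_predRL. Qed.
Definition idx_hi (i : 'I_n.-1) : 'I_n := Ordinal (idx_hi_subproof i).

Definition simple_tr (i : 'I_n.-1) : 'S_n := tperm (idx_lo i) (idx_hi i).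

(* Products in S_n are compositions, whereas (p * q)%g applies p first. *)
Definition pcomp (p q : 'S_n) : 'S_n := (q * p)%g.

Record is_Delta (i : 'I_n.-1) (D : polt -> polt) : Prop := IsDelta {
  Delta_lin : forall (c : k) a b, D (c *: a + b) = c *: D a + D b;
  Delta_tens : forall f, D (polf f) = 0;
  Delta_lo : D (polx (idx_lo i)) = polf (tens_t F (idx_lo i) (idx_hi i));
  Delta_hi : D (polx (idx_hi i)) = - polf (tens_t F (idx_hi i) (idx_lo i));
  Delta_far : forall j, j != idx_lo i -> j != idx_hi i -> D (polx j) = 0;
  Delta_mul : forall a b,
    D (a * b) = D a * b + polt_perm (simple_tr i) a * D b }.

(* P_n(F) (x) k S_n, v w being the component of v in P_n(F) (x) w. *)
Definition wreath_mod := {ffun 'S_n -> polt}.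

HB.instance Definition _ := GRing.Lmodule.on wreath_mod.

Definition ptensor (a : polt) (w : 'S_n) : wreath_mod :=
  [ffun w' => if w' == w then a else 0].

Definition wreath_mod_gr (d : nat) (e : bool) (v : wreath_mod) : Prop :=
  forall w, polt_gr d e (v w).

End PolynomialTensor.

(* Unital associative k-algebras presented by generators and relations. *)
Inductive term (k G : Type) :=
  | tgen of G
  | tzero
  | tone
  | tadd of term k G & term k G
  | topp of term k G
  | tmul of term k G & term k G
  | tscale of k & term k G.

Arguments tgen {k G}.
Arguments tzero {k G}.
Arguments tone {k G}.

Declare Scope term_scope.
Delimit Scope term_scope with TM.
Bind Scope term_scope with term.
Notation "0" := tzero : term_scope.
Notation "1" := tone : term_scope.
Notation "s + t" := (tadd s t) : term_scope.
Notation "- t" := (topp t) : term_scope.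
Notation "s - t" := (tadd s (topp t)) : term_scope.
Notation "s * t" := (tmul s t) : term_scope.
Notation "c *: t" := (tscale c t) : term_scope.

HB.instance Definition _ (k G : Type) := gen_eqMixin (term k G).
HB.instance Definition _ (k G : Type) := gen_choiceMixin (term k G).

Section Presentation.

Variables (k : comNzRingType) (G : Type).
Variable R : term k G -> term k G -> Prop.
Implicit Types s t u : term k G.

Inductive pres_eq : term k G -> term k G -> Prop :=
  | pres_rel s t : R s t -> pres_eq s t
  | pres_refl t : pres_eq t t
  | pres_sym s t : pres_eq s t -> pres_eq t s
  | pres_trans s t u : pres_eq s t -> pres_eq t u -> pres_eq s u
  | pres_add s s' t t' : pres_eq s s' -> pres_eq t t' -> pres_eq (s + t) (s' + t')
  | pres_opp s s' : pres_eq s s' -> pres_eq (- s) (- s')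
  | pres_mul s s' t t' : pres_eq s s' -> pres_eq t t' -> pres_eq (s * t) (s' * t')
  | pres_scale c s s' : pres_eq s s' -> pres_eq (c *: s) (c *: s')
  | pres_addA s t u : pres_eq (s + (t + u)) (s + t + u)
  | pres_addC s t : pres_eq (s + t) (t + s)
  | pres_add0 t : pres_eq (0 + t) t
  | pres_addN t : pres_eq (- t + t) 0
  | pres_mulA s t u : pres_eq (s * (t * u)) (s * t * u)
  | pres_mul1l t : pres_eq (1 * t) t
  | pres_mul1r t : pres_eq (t * 1) t
  | pres_mulDl s t u : pres_eq ((s + t) * u) (s * u + t * u)
  | pres_mulDr s t u : pres_eq (s * (t + u)) (s * t + s * u)
  | pres_scaleA c c' t : pres_eq (c *: (c' *: t)) ((c * c')%R *: t)
  | pres_scale1 t : pres_eq (1%R *: t) t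
  | pres_scaleDr c s t : pres_eq (c *: (s + t)) (c *: s + c *: t)
  | pres_scaleDl c c' t : pres_eq ((c + c')%R *: t) (c *: t + c' *: t)
  | pres_scaleAl c s t : pres_eq (c *: (s * t)) (c *: s * t)
  | pres_scaleAr c s t : pres_eq (c *: (s * t)) (s * (c *: t)).

Definition pres_eqb s t := `[< pres_eq s t >].

Lemma pres_eqb_refl : reflexive pres_eqb.
Proof. by move=> t; apply/asboolP/pres_refl. Qed.
Lemma pres_eqb_sym : ssrbool.symmetric pres_eqb.
Proof. by move=> s t; apply/asboolP/asboolP => /pres_sym. Qed.
Lemma pres_eqb_trans : transitive pres_eqb.
Proof.
by move=> t s u /asboolP st /asboolP tu; apply/asboolP; apply: pres_trans st tu.
Qed.

Canonical pres_equiv := EquivRel pres_eqb pres_eqb_refl pres_eqb_sym pres_eqb_trans.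

Definition presented := {eq_quot pres_equiv}%qT.

HB.instance Definition _ := Choice.on presented.

Definition pclass (t : term k G) : presented := (\pi_presented t)%qT.

Lemma pclassP s t : pclass s = pclass t <-> pres_eq s t.
Proof.
rewrite /pclass; split=> [/eqP|st].
  by rewrite eqmodE => /asboolP.
by apply/eqP; rewrite eqmodE; apply/asboolP.
Qed.

Lemma pclass_ind (Q : presented -> Prop) :
  (forall t, Q (pclass t)) -> forall a, Q a.
Proof. by move=> Qt a; rewrite -[a]reprK. Qed.

Definition pres_addp (a b : presented) := pclass (repr a + repr b).
Definition pres_oppp (a : presented) := pclass (- repr a).
Definition pres_mulp (a b : presented) := pclass (repr a * repr b).
Definition pres_scalep (c : k) (a : presented) := pclass (c *: repr a).

Lemma repr_pclass t : pres_eq (repr (pclass t)) t.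
Proof. by apply/pclassP; rewrite /pclass reprK. Qed.

Lemma pres_addpE s t : pres_addp (pclass s) (pclass t) = pclass (s + t).
Proof. by apply/pclassP/pres_add; apply: repr_pclass. Qed.
Lemma pres_opppE s : pres_oppp (pclass s) = pclass (- s).
Proof. by apply/pclassP/pres_opp/repr_pclass. Qed.
Lemma pres_mulpE s t : pres_mulp (pclass s) (pclass t) = pclass (s * t).
Proof. by apply/pclassP/pres_mul; apply: repr_pclass. Qed.
Lemma pres_scalepE c s : pres_scalep c (pclass s) = pclass (c *: s).
Proof. by apply/pclassP/pres_scale/repr_pclass. Qed.

Let presE := (pres_addpE, pres_opppE, pres_mulpE, pres_scalepE).

Lemma pres_addpA : associative pres_addp.
Proof.
elim/pclass_ind=> s; elim/pclass_ind=> t; elim/pclass_ind=> u.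
by rewrite !presE; apply/pclassP/pres_addA.
Qed.
Lemma pres_addpC : commutative pres_addp.
Proof.
elim/pclass_ind=> s; elim/pclass_ind=> t.
by rewrite !presE; apply/pclassP/pres_addC.
Qed.
Lemma pres_add0p : left_id (pclass 0) pres_addp.
Proof. by elim/pclass_ind=> s; rewrite !presE; apply/pclassP/pres_add0. Qed.
Lemma pres_addNp : left_inverse (pclass 0) pres_oppp pres_addp.
Proof. by elim/pclass_ind=> s; rewrite !presE; apply/pclassP/pres_addN. Qed.

HB.instance Definition _ := GRing.isZmodule.Build presented
  pres_addpA pres_addpC pres_add0p pres_addNp.

Lemma pres_mulpA : associative pres_mulp.
Proof.
elim/pclass_ind=> s; elim/pclass_ind=> t; elim/pclass_ind=> u.
by rewrite !presE; apply/pclassP/pres_mulA.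
Qed.
Lemma pres_mul1p : left_id (pclass 1) pres_mulp.
Proof. by elim/pclass_ind=> s; rewrite !presE; apply/pclassP/pres_mul1l. Qed.
Lemma pres_mulp1 : right_id (pclass 1) pres_mulp.
Proof. by elim/pclass_ind=> s; rewrite !presE; apply/pclassP/pres_mul1r. Qed.
Lemma pres_mulpDl : left_distributive pres_mulp +%R.
Proof.
elim/pclass_ind=> s; elim/pclass_ind=> t; elim/pclass_ind=> u.
by rewrite /+%R /= !presE; apply/pclassP/pres_mulDl.
Qed.
Lemma pres_mulpDr : right_distributive pres_mulp +%R.
Proof.
elim/pclass_ind=> s; elim/pclass_ind=> t; elim/pclass_ind=> u.
by rewrite /+%R /= !presE; apply/pclassP/pres_mulDr.
Qed.

HB.instance Definition _ := GRing.Zmodule_isPzRing.Build presented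
  pres_mulpA pres_mul1p pres_mulp1 pres_mulpDl pres_mulpDr.

Lemma pres_scalepA c c' a :
  pres_scalep c (pres_scalep c' a) = pres_scalep (c * c')%R a.
Proof. by elim/pclass_ind: a => s; rewrite !presE; apply/pclassP/pres_scaleA. Qed.
Lemma pres_scale1p : left_id 1%R pres_scalep.
Proof. by elim/pclass_ind=> s; rewrite !presE; apply/pclassP/pres_scale1. Qed.
Lemma pres_scalepDr : right_distributive pres_scalep +%R.
Proof.
move=> c; elim/pclass_ind=> s; elim/pclass_ind=> t.
by rewrite /+%R /= !presE; apply/pclassP/pres_scaleDr.
Qed.
Lemma pres_scalepDl a : {morph pres_scalep^~ a : c c' / (c + c')%R}.
Proof.
move=> c c'; elim/pclass_ind: a => s.
by rewrite [in RHS]/+%R /= !presE; apply/pclassP/pres_scaleDl.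
Qed.

HB.instance Definition _ := GRing.Zmodule_isLmodule.Build k presented
  pres_scalepA pres_scale1p pres_scalepDr pres_scalepDl.

(* MathComp's algType requires 1 != 0, which a presentation need not ensure;
   presented is a ring and a k-module, with compatible scalar action. *)
Lemma presented_scalerAl (c : k) (a b : presented) :
  (c *: (a * b))%R = (c *: a * b)%R.
Proof.
elim/pclass_ind: a => s; elim/pclass_ind: b => t.
rewrite /*%R /*:%R /= !presE; exact/pclassP/pres_scaleAl.
Qed.
Lemma presented_scalerAr (c : k) (a b : presented) :
  (c *: (a * b))%R = (a * (c *: b))%R.
Proof.
elim/pclass_ind: a => s; elim/pclass_ind: b => t.
rewrite /*%R /*:%R /= !presE; exact/pclassP/pres_scaleAr.
Qed.

End Presentation.

Section AffineWreath.

Variables (k : comNzRingType) (F : frob_superalg k) (n : nat).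
Local Notation T := (tens F n).

Inductive awr_gen := gen_x of 'I_n | gen_f of T | gen_s of 'S_n.

Local Notation X i := (tgen (gen_x i)).
Local Notation "'T_' f" := (tgen (gen_f f)) (at level 8, f at level 2).
Local Notation S w := (tgen (gen_s w)).

(* The rules from awr_xx to awr_ss say that the three families of generators
   generate images of k[x], F^(x)n and k S_n; the others are the defining
   relations of the quotient of the free product. *)
Inductive awr_rel : term k awr_gen -> term k awr_gen -> Prop :=
  | awr_xx i j : awr_rel (X i * X j) (X j * X i)
  | awr_flin (c : k) (f g : T) :
      awr_rel (T_ (c *: f + g)%R) (c *: T_ f + T_ g)
  | awr_f1 : awr_rel (T_ 1%R) 1
  | awr_ff (f g : T) : awr_rel (T_ (f * g)%R) (T_ f * T_ g)
  | awr_s1 : awr_rel (S 1%g) 1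
  | awr_ss p q : awr_rel (S (pcomp p q)) (S p * S q)
  | awr_fx i (f : T) : awr_rel (T_ f * X i) (X i * T_ (tens_psi U_(i) f))
  | awr_sx_far (i : 'I_n.-1) j : j != idx_lo i -> j != idx_hi i ->
      awr_rel (S (simple_tr i) * X j) (X j * S (simple_tr i))
  | awr_sx (i : 'I_n.-1) :
      awr_rel (S (simple_tr i) * X (idx_lo i))
        (X (idx_hi i) * S (simple_tr i) - T_ (tens_t F (idx_lo i) (idx_hi i)))
  | awr_sf p (f : T) : awr_rel (S p * T_ f) (T_ (tens_perm p f) * S p).

Definition awr := presented awr_rel.

Definition awx (i : 'I_n) : awr := pclass awr_rel (X i).
Definition awf (f : T) : awr := pclass awr_rel (T_ f).
Definition aws (w : 'S_n) : awr := pclass awr_rel (S w).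

Inductive awr_gr : nat -> bool -> awr -> Prop :=
  | awr_gr_x i : awr_gr (fdelta F) false (awx i)
  | awr_gr_f d e f : tens_gr d e f -> awr_gr d e (awf f)
  | awr_gr_s w : awr_gr 0%N false (aws w)
  | awr_gr_1 : awr_gr 0%N false 1
  | awr_gr_0 d e : awr_gr d e 0
  | awr_gr_lin d e (c : k) a b :
      awr_gr d e a -> awr_gr d e b -> awr_gr d e (c *: a + b)
  | awr_gr_mul d e d' e' a b :
      awr_gr d e a -> awr_gr d' e' b -> awr_gr (d + d')%N (e (+) e') (a * b).

(* The natural map P_n(F) -> A_n(F). *)
Definition awr_pol (a : polt F n) : awr :=
  \sum_(m <- msupp a) (\prod_(i < n) awx i ^+ m i) * awf a@_m.

Record is_module (M : lmodType k) (act : awr -> M -> M) : Prop := IsModule {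
  act_one : forall v, act 1 v = v;
  act_mul : forall a b v, act (a * b) v = act a (act b v);
  act_linl : forall (c : k) a b v, act (c *: a + b) v = c *: act a v + act b v;
  act_linr : forall a (c : k) u v, act a (c *: u + v) = c *: act a u + act a v }.

Record is_graded_supermodule (M : lmodType k) (act : awr -> M -> M)
    (gr : nat -> bool -> M -> Prop) : Prop := IsGradedSupermodule {
  gsm_module : is_module act;
  gsm_grading : is_grading gr;
  gsm_act : forall d e d' e' a v, awr_gr d e a -> gr d' e' v ->
    gr (d + d')%N (e (+) e') (act a v) }.

Record is_graded_iso (M N : lmodType k) (actM : awr -> M -> M)
    (grM : nat -> bool -> M -> Prop) (actN : awr -> N -> N)
    (grN : nat -> bool -> N -> Prop) (phi : M -> N) : Prop := IsGradedIso {
  giso_src : is_graded_supermodule actM grM;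
  giso_tgt : is_graded_supermodule actN grN;
  giso_lin : forall (c : k) u v, phi (c *: u + v) = c *: phi u + phi v;
  giso_act : forall a v, phi (actM a v) = actN a (phi v);
  giso_gr : forall d e v, grM d e v <-> grN d e (phi v);
  giso_bij : bijective phi }.

(* act is the action of A_n(F) on P_n(F) (x) k S_n. *)
Definition is_wreath_action
    (act : awr -> wreath_mod F n -> wreath_mod F n) : Prop :=
  [/\ is_module act,
      forall (z a : polt F n) w,
        act (awr_pol z) (ptensor a w) = ptensor (z * a) w
    & exists D : 'I_n.-1 -> polt F n -> polt F n,
        (forall i, is_Delta i (D i)) /\
        forall i a w, act (aws (simple_tr i)) (ptensor a w)
          = ptensor (polt_perm (simple_tr i) a) (pcomp (simple_tr i) w)
            - ptensor (D i a) w].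

(* The linear map a (x) w |-> a w. *)
Definition wreath_map (v : wreath_mod F n) : awr :=
  \sum_(w : 'S_n) awr_pol (v w) * aws w.

End AffineWreath.

(* Main.v *)
Require Import Defs.
From HB Require Import structures.
From mathcomp Require Import all_boot all_order all_algebra all_fingroup.
From mathcomp Require Import generic_quotient boolp mpoly zify ring.
Import Defs.

Set Implicit Arguments.
Unset Strict Implicit.
Unset Printing Implicit Defensive.

Import GRing.Theory.
Local Open Scope ring_scope.

(** The map a (x) w |-> a w has a short inverse as soon as A_n(F) is known to act
    on V = P_n(F) (x) k S_n by the given formulas: it is z |-> z (1 (x) 1). That
    a (x) w |-> a w is A_n(F)-linear is checked on generators, where for s_i it
    says s_i a = (^s_i a) s_i - Delta_i(a) (lemma aws_pol); so the two maps are
    inverse to each other. All of the difficulty is in the existence of the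
    action: it is what shows that the elements x^m f w do not collapse in A_n(F).

    Delta_i exists because a |-> [[^s_i a, Delta_i a], [0, a]] can be defined as
    an algebra morphism from P_n(F) to matrices, by the universal property of
    P_n(F) (polt_lift). The relations needed come from three properties of
    t_ij = sum_b b_i (b^vee)_j: t_{s i, s j} is the image of t_ij under s in S_n,
    psi_j(t_ij) = t_ji, and (^s_ij f) t_ij = t_ij psi_i(f) (tens_t_exchange).

    The s_i then act on V by operators sigma_i, and these have to be extended
    to S_n. Rather than check the Coxeter relations and invoke the Coxeter
    presentation of S_n, one shows that the effect on v in V of a product of
    operators sigma_i depends only on the permutation w which is the product of
    the s_i (word_independent). This holds for v = f (x) u, and passes from v to
    x_j v, because the commutation rule of a permutation w with x_j is
      w x_j = x_{w j} w + sum_l ([l < j] - [w l < w j]) t_{w l, w j} w s_jl,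
    an expression in w alone. The rule says that the elements
    x_j - sum_{l < j} t_lj s_lj are permuted by S_n; it follows for all w from
    the case w = s_i by induction on words, since its signs form a cocycle in w.

    The basis of V formed by the products of monomials in the x_i, basis
    vectors of F^(x)n and permutations is homogeneous, and is carried over to
    A_n(F). Its elements of given degree and parity are counted by n! times the
    n-th power of the series that counts the products b x^j. *)

(** * Modules with coordinates, gradings and ranks *)

Section Coordinates.

Variables (k : comNzRingType) (M : lmodType k).

(** The matrices of coordinates of two bases in each other are inverse to each
    other; over a nonzero commutative ring such matrices are square. *)
Lemma has_rank_inj W m m' : @has_rank k M W m -> has_rank W m' -> m = m'.
Proof.
suff le q q' : has_rank W q -> has_rank W q' -> (q <= q')%N.
  by move=> hm hm'; apply/eqP; rewrite eqn_leq !le.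
move=> [b hb] [b' hb'].
have expand r (u : 'I_r -> M) (hu : is_basis W u) v : W v ->
    exists c : 'I_r -> k, v = \sum_j c j *: u j.
  move=> /(basis_span hu)[s [c ->]]; exists (fun j => \sum_(i <- s | i == j) c i).
  under [RHS]eq_bigr => j _ do rewrite scaler_suml.
  rewrite (exchange_big_dep predT) //=; apply: eq_bigr => i _.
  by rewrite (eq_bigl (pred1 i)) ?big_pred1_eq // => j; rewrite eq_sym.
have /choice[A hA] j := expand _ _ hb' (b j) (basis_in hb j).
have /choice[B hB] j := expand _ _ hb (b' j) (basis_in hb' j).
apply: (@mulmx1_min k q q' (\matrix_(i, j) A i j) (\matrix_(i, j) B i j)).
apply/matrixP => i l; rewrite !mxE.
have := @basis_free _ _ _ _ _ hb (index_enum 'I_q)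
  (fun l => \sum_j A i j * B j l - (i == l)%:R) (index_enum_uniq _).
move=> /(_ _ l (mem_index_enum l)) h.
under eq_bigr => j _ do rewrite !mxE.
apply/eqP; rewrite -subr_eq0; apply/eqP; apply: h.
under eq_bigr => j _ do rewrite scalerBl scaler_suml.
have delta_b : \sum_l (i == l)%:R *: b l = b i.
  rewrite (bigD1 i) //= eqxx scale1r big1 ?addr0 // => j /negPf.
  by rewrite eq_sym => ->; rewrite scale0r.
rewrite sumrB exchange_big /= delta_b [in X in _ - X]hA.
apply/eqP; rewrite subr_eq0; apply/eqP.
apply: eq_bigr => j _; rewrite [in RHS]hB scaler_sumr.
by apply: eq_bigr => r _; rewrite scalerA.
Qed.

Lemma rankE W m : @has_rank k M W m -> rank W = m.
Proof.
move=> hm; rewrite /rank; case: pselect => [h|[]]; last by exists m.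
by case: (cid h) => m' /= hm'; apply: has_rank_inj hm' hm.
Qed.

Variables (J : eqType) (b : J -> M) (x : J -> M -> k).

(** A basis given with its coordinate functions: these express homogeneity as a
    condition on supports, and are transported along isomorphisms. *)
Record is_coordinates : Prop := IsCoordinates {
  coords_lin : forall j (c : k) u v, x j (c *: u + v) = c * x j u + x j v;
  coords_basis : forall i j, x i (b j) = (i == j)%:R;
  coords_span : forall v, exists2 s, uniq s & v = \sum_(j <- s) x j v *: b j }.

Hypothesis xP : is_coordinates.

Lemma coords0 j : x j 0 = 0.
Proof. by have := coords_lin xP j (-1) 0 0; rewrite scaler0 addr0 mulN1r addNr. Qed.

Lemma coordsD j u v : x j (u + v) = x j u + x j v.
Proof. by have := coords_lin xP j 1 u v; rewrite scale1r mul1r. Qed.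

Lemma coordsZ j c u : x j (c *: u) = c * x j u.
Proof. by have := coords_lin xP j c u 0; rewrite !addr0 coords0 addr0. Qed.

Lemma coords_sum j (I : Type) (s : seq I) (P : pred I) (u : I -> M) :
  x j (\sum_(i <- s | P i) u i) = \sum_(i <- s | P i) x j (u i).
Proof. by apply: (big_morph (x j)); [apply: coordsD | apply: coords0]. Qed.

Lemma coords_inj u v : (forall j, x j u = x j v) -> u = v.
Proof.
move=> eq_uv; apply/eqP; rewrite -subr_eq0; apply/eqP.
have [s _ ->] := coords_span xP (u - v).
apply: big1_seq => j _; rewrite coordsD -scaleN1r coordsZ eq_uv mulN1r subrr.
exact: scale0r.
Qed.

(** Applied with f the inclusion of the indices of one degree and parity, this
    gives the bases of the graded pieces. *)
Lemma coords_is_basis (W : M -> Prop) (I : eqType) (f : I -> J) : injective f ->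
  (forall v, W v <-> forall j, x j v != 0 -> exists i, j = f i) ->
  is_basis W (b \o f).
Proof.
move=> f_inj WP; split=> [i|v /WP Wv|s c s_uniq s0 i si].
- apply/WP => j; rewrite (coords_basis xP) /=; have [->|_] := eqVneq j (f i).
    by exists i.
  by rewrite eqxx.
- have [s s_uniq def_v] := coords_span xP v.
  have [t def_t] : exists t, [seq j <- s | x j v != 0] = map f t.
    have: all (fun j => x j v != 0) [seq j <- s | x j v != 0] by rewrite filter_all.
    elim: filter => [|j r IHr] /= => [_|/andP[/Wv[i ->] /IHr[t ->]]].
      by exists [::].
    by exists (i :: t).
  exists t, (fun i => x (f i) v); rewrite -(big_map f predT (fun j => x j v *: b j)).
  rewrite -def_t big_filter {1}def_v [LHS](bigID (fun j => x j v == 0)) /=.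
  by rewrite big1 ?add0r // => j /eqP->; rewrite scale0r.
have := congr1 (x (f i)) s0; rewrite coords0 coords_sum (bigD1_seq i) //=.
rewrite coordsZ (coords_basis xP) eqxx mulr1 big1 ?addr0 // => j /negPf ji.
by rewrite coordsZ (coords_basis xP) (inj_eq f_inj) eq_sym ji mulr0.
Qed.

Lemma coords_basisT : is_basis (fun=> True) b.
Proof.
apply: (@coords_is_basis _ J id) => // v; split=> // _ j _.
by exists j.
Qed.

Variables (deg : J -> nat) (par : J -> bool) (gr : nat -> bool -> M -> Prop).
Hypothesis grP : forall d e v,
  gr d e v <-> forall j, x j v != 0 -> deg j = d /\ par j = e.

Lemma coords_is_grading : is_grading gr.
Proof.
split=> [d e|d e c u v /grP gu /grP gv|v|N w gw w0 d e ltdN].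
- by apply/grP => j; rewrite coords0 eqxx.
- apply/grP => j; rewrite (coords_lin xP).
  have [u0|/gu//] := eqVneq (x j u) 0; have [v0|/gv//] := eqVneq (x j v) 0.
  by rewrite u0 v0 mulr0 addr0 eqxx.
- have [s s_uniq def_v] := coords_span xP v.
  pose w d e := \sum_(j <- s | (deg j == d) && (par j == e)) x j v *: b j.
  exists (\max_(j <- s) deg j).+1, w; split=> [d e|].
    apply/grP => j; rewrite coords_sum => nz; move: nz.
    have [/andP[/eqP-> /eqP->] //|dej] := boolP ((deg j == d) && (par j == e)).
    rewrite big1 ?eqxx // => i dei; rewrite coordsZ (coords_basis xP).
    have [ji|_] := eqVneq j i; last exact: mulr0.
    by rewrite ji dei in dej.
  have: {in s, forall j, (deg j < (\max_(j <- s) deg j).+1)%N}.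
    by move=> j sj; rewrite ltnS leq_bigmax_seq.
  move: (_.+1) => N ltN; rewrite [LHS]def_v pair_big /= /w.
  rewrite (exchange_big_dep predT) //= !big_seq.
  apply: eq_bigr => j sj; rewrite (big_pred1 (Ordinal (ltN j sj), par j)) //.
  by move=> [d e] /=; rewrite xpair_eqE -val_eqE /= eq_sym; congr (_ && _); apply: eq_sym.
apply: coords_inj => j; rewrite coords0.
have [//|nz] := eqVneq (x j (w d e)) 0.
have /grP/(_ j nz)[dj pj] := gw d e.
have := congr1 (x j) w0; rewrite coords0 coords_sum (bigD1 (Ordinal ltdN)) //=.
rewrite coords_sum (bigD1 e) //= big1 => [|e' ne]; last first.
  apply/eqP; apply: contraR ne => nz'.
  by have /grP/(_ j nz')[_] := gw d e'; rewrite pj => ->.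
rewrite addr0 big1 ?addr0 // => d' ne; rewrite coords_sum big1 // => e' _.
apply/eqP; apply: contraR ne => nz'; apply/eqP/val_inj => /=.
by have /grP/(_ j nz')[] := gw d' e'; rewrite dj => ->.
Qed.

Lemma coords_has_rank d e (I : finType) (f : I -> J) : injective f ->
  (forall j, deg j = d /\ par j = e <-> exists i, j = f i) ->
  has_rank (gr d e) #|I|.
Proof.
move=> f_inj fP; exists (b \o (f \o enum_val)).
apply: coords_is_basis => [|v]; first exact: inj_comp f_inj enum_val_inj.
rewrite grP; split=> h j nz; have := h j nz.
  by move/fP => [i ->]; exists (enum_rank i); rewrite /= enum_rankK.
by move=> [i ->]; apply/fP; exists (enum_val i).
Qed.

End Coordinates.

(** * Counting with power series *)

Section Counting.

Definition qs_count (A : finType) (deg : A -> nat) (par : A -> bool) : qseries :=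
  fun d e => #|[pred a | (deg a == d) && (par a == e)]|%:Z.

Lemma qs_countE (A : finType) (deg : A -> nat) par d e :
  qs_count deg par d e = \sum_a ((deg a == d) && (par a == e))%:R.
Proof.
rewrite /qs_count -sum1_card -natz natr_sum big_mkcond /=.
by apply: eq_bigr => a _; rewrite inE; case: ifP.
Qed.

Lemma qs_count_prod (A B : finType) (dA : A -> nat) (pA : A -> bool)
    (dB : B -> nat) (pB : B -> bool) d e :
  qs_mul (qs_count dA pA) (qs_count dB pB) d e =
  qs_count (fun u : A * B => dA u.1 + dB u.2)%N (fun u => pA u.1 (+) pB u.2) d e.
Proof.
rewrite qs_countE; transitivity (\sum_a \sum_b
  ((dA a + dB b == d)%N && (pA a (+) pB b == e))%:R : int); last first.
  by rewrite pair_bigA.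
transitivity (\sum_(i < d.+1) \sum_(u : bool) \sum_a
    ((dA a == i) && (pA a == u))%:R * qs_count dB pB (d - i)%N (u (+) e) : int).
  apply: eq_bigr => i _; apply: eq_bigr => u _.
  by rewrite [qs_count dA _ _ _]qs_countE mulr_suml.
under eq_bigr => i _ do rewrite exchange_big.
rewrite exchange_big; apply: eq_bigr => a _ /=.
have addbl (x y z : bool) : (x (+) y == z) = (y == x (+) z).
  by case: x; case: y; case: z.
have [le_ad|lt_da] := leqP (dA a) d; last first.
  rewrite [RHS]big1 => [|b _]; last first.
    by rewrite gtn_eqF // (leq_trans lt_da) ?leq_addr.
  rewrite big1 // => i _; rewrite big1 // => u _.
  by rewrite gtn_eqF ?mul0r // (leq_trans (ltn_ord i)).
rewrite (bigD1 (Ordinal (le_ad : dA a < d.+1)%N)) //= (bigD1 (pA a)) //=.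
rewrite !eqxx mul1r [X in _ + X + _]big1 => [|u /negPf nu]; last first.
  by rewrite [pA a == u]eq_sym nu mul0r.
rewrite [X in _ + X]big1 ?addr0 => [|i]; last first.
  rewrite -val_eqE /= eq_sym => /negPf ni.
  by rewrite big1 // => u _; rewrite ni mul0r.
rewrite qs_countE; apply: eq_bigr => b _.
by rewrite -{2}(subnKC le_ad) eqn_add2l addbl.
Qed.

Definition ffun_cons (A : finType) n (u : A * {ffun 'I_n -> A}) :
    {ffun 'I_n.+1 -> A} :=
  [ffun i => if unlift ord0 i is Some j then u.2 j else u.1].

Lemma ffun_cons_bij (A : finType) n : bijective (@ffun_cons A n).
Proof.
exists (fun h : {ffun 'I_n.+1 -> A} =>
  (h ord0, [ffun j : 'I_n => h (lift ord0 j)])) => [[a g]|h].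
  rewrite ffunE unlift_none; congr (_, _); apply/ffunP => j.
  by rewrite !ffunE liftK.
apply/ffunP => i; rewrite ffunE.
by case: unliftP => [j|] -> //=; rewrite ffunE.
Qed.

(** By induction on n: a function on 'I_n.+1 is its value at 0 together with a
    function on 'I_n, and qs_mul counts pairs. *)
Lemma qs_exp_count (A : finType) (deg : A -> nat) (par : A -> bool) n d e :
  qs_exp (qs_count deg par) n d e =
  qs_count (fun g : {ffun 'I_n -> A} => \sum_i deg (g i))%N
    (fun g => \big[addb/false]_i par (g i)) d e.
Proof.
elim: n => [|n IHn] in d e *.
  rewrite qs_countE (big_pred1 (ffun0 (card_ord 0))) => [|g]; last first.
    by apply/esym/eqP/ffunP; case.
  by rewrite !big_ord0 /= /qs_one eq_sym; congr (_ && _)%:R; case: e.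
rewrite /qs_exp iterS -/(qs_exp _ n).
have -> : qs_exp (qs_count deg par) n = qs_count
    (fun g : {ffun 'I_n -> A} => \sum_i deg (g i))%N
    (fun g => \big[addb/false]_i par (g i)).
  by apply/funext => d'; apply/funext => e'.
rewrite qs_count_prod !qs_countE [RHS](reindex (@ffun_cons A n)); last first.
  exact/onW_bij/ffun_cons_bij.
apply: eq_bigr => -[a g] _ /=; rewrite !big_ord_recl ffunE unlift_none /=.
by congr ((_ + _ == _)%N && (_ (+) _ == _))%:R; apply: eq_bigr => i _;
  rewrite ffunE liftK.
Qed.

(** Lets the infinite set of powers of x be replaced by a finite one when a
    single coefficient is considered. *)
Lemma eq_qs_exp (s t : qseries) n d :
  (forall i e, (i <= d)%N -> s i e = t i e) ->
  forall e, qs_exp s n d e = qs_exp t n d e.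
Proof.
elim: n => // n IHn in d * => eq_st e; rewrite /qs_exp !iterS.
apply: eq_bigr => i _; apply: eq_bigr => u _.
rewrite eq_st; last by rewrite -ltnS.
congr (_ * _); apply: IHn => j e' le_j.
by apply: eq_st; apply: leq_trans le_j (leq_subr _ _).
Qed.

(** In degree d the exponents of x are at most d, hence below N. *)
Lemma qs_geom_count delta N : (0 < delta)%N -> forall d e, (d < N)%N ->
  qs_geom delta d e = qs_count (fun j : 'I_N => delta * j)%N (fun=> false) d e.
Proof.
move=> delta_gt0 d e lt_dN; rewrite qs_countE /qs_geom.
have [/dvdnP[j def_d]|ndvd] := boolP (delta %| d)%N; last first.
  rewrite big1 // => j _; case: eqP => // def_d.
  by rewrite -def_d dvdn_mulr in ndvd.
have lt_jN : (j < N)%N.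
  by apply: leq_ltn_trans lt_dN; rewrite def_d leq_pmulr.
rewrite (bigD1 (Ordinal lt_jN)) //= mulnC -def_d eqxx big1 ?addr0.
  by case: e.
move=> i; rewrite -val_eqE /= => /negPf ne_ij.
by rewrite def_d mulnC eqn_pmul2r // ne_ij.
Qed.

End Counting.

(** * Dual bases of a Frobenius superalgebra *)

(** Applied with gr' the grading that a homogeneous basis defines, whose pieces
    lie in those of gr: so homogeneity for gr can be read off coordinates. *)
Lemma grading_sub_full (k : comNzRingType) (M : lmodType k)
    (gr gr' : nat -> bool -> M -> Prop) :
  is_grading gr -> is_grading gr' -> (forall d e v, gr' d e v -> gr d e v) ->
  forall d e v, gr d e v -> gr' d e v.
Proof.
move=> grP grP' sub d e v gv; have [N [w [gw def_v]]] := gr_span grP' v.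
(* The components of v for gr', with v subtracted in its degree for gr: these
   are homogeneous for gr and add up to zero. *)
pose w' d' e' := (if (d' < N)%N then w d' e' else 0)
  - ((d' == d) && (e' == e))%:R *: v.
have gw' d' e' : gr d' e' (w' d' e').
  rewrite /w' addrC -scaleNr; have [/andP[/eqP-> /eqP->]|_] := boolP (_ && _).
    apply: gr_lin => //; case: ifP => _; first exact/sub/gw.
    exact: gr_zero grP _ _.
  rewrite oppr0 scale0r add0r; case: ifP => _; first exact/sub/gw.
  exact: gr_zero grP _ _.
have sum_w' : \sum_(d' < maxn N d.+1) \sum_(e' : bool) w' d' e' = 0.
  rewrite /w'; under eq_bigr => d' _ do rewrite sumrB.
  rewrite sumrB; apply/eqP; rewrite subr_eq0; apply/eqP.
  apply/esym; rewrite (bigD1 (Ordinal (leq_maxr N d.+1))) //= (bigD1 e) //= !eqxx scale1r.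
  rewrite big1 ?addr0 => [|e' /negPf->]; last by rewrite andbF scale0r.
  rewrite [X in v + X]big1 ?addr0 => [|d']; last first.
    rewrite -val_eqE /= => /negPf ne_d.
    by apply: big1 => e' _; rewrite ne_d scale0r.
  rewrite def_v (big_ord_widen _ (fun d' => \sum_(e' : bool) w d' e') (leq_maxl N d.+1)).
  rewrite big_mkcond; apply: eq_bigr => d' _.
  by case: ifP => // _; rewrite big1.
have := gr_indep grP gw' sum_w' e (leq_maxr N d.+1).
rewrite /w' !eqxx scale1r => /eqP; rewrite subr_eq0 => /eqP<-.
by case: ifP => _ //; apply: gr_zero grP' _ _.
Qed.

Section Frobenius.

Variables (k : comNzRingType) (F : frob_superalg k).
Implicit Types (f g h : F) (b c : fB F).

Lemma fb_coordinates : is_coordinates (@fb k F) (@coord k F).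
Proof.
split=> [b c f g|b c|f]; [exact: coordZD|exact: coord_fb|].
by exists (index_enum (fB F)); [apply: index_enum_uniq|apply: coordE].
Qed.

Lemma fgr_coord d e f :
  fgr d e f <-> forall b, coord b f != 0 -> fdeg b = d /\ fpar b = e.
Proof.
have sub d' e' g : (forall b, coord b g != 0 -> fdeg b = d' /\ fpar b = e') ->
    fgr d' e' g.
  have grF := fgr_grading F.
  move=> gb; rewrite (coordE g); apply: (big_ind (fgr d' e')) => [|u v gu gv|b _].
  - exact: gr_zero grF _ _.
  - by rewrite -[u]scale1r; apply: gr_lin.
  have [->|/gb[<- <-]] := eqVneq (coord b g) 0.
    by rewrite scale0r; apply: gr_zero grF _ _.
  by rewrite -[_ *: _]addr0; apply: gr_lin (fb_gr _) (gr_zero grF _ _).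
split=> [gf|]; last exact: sub.
pose gr' d' e' (g : F) :=
  forall b, coord b g != 0 -> fdeg b = d' /\ fpar b = e'.
apply: (@grading_sub_full _ _ _ gr' (fgr_grading F) _ sub d e f gf).
by apply: (coords_is_grading fb_coordinates) => d' e' g; apply: iff_refl.
Qed.

Lemma ftr_gr d e f : fgr d e f -> ftr F f != 0 -> d = fdelta F /\ e = false.
Proof.
move=> gf nz; split; last first.
  by case: e gf => // /ftr_even f0; rewrite f0 eqxx in nz.
by apply/eqP; apply: contraR nz => /eqP ne; rewrite (ftr_deg gf ne).
Qed.

(** Let G be the matrix of the form (b, c) |-> tr(b c) and D that of the fdual b
    on the basis. The duality reads D G = 1, whence G D = 1: so the form is
    nondegenerate on the left as well. *)
Lemma ftr_fb_inj f g : (forall b, ftr F (f * fb b) = ftr F (g * fb b)) -> f = g.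
Proof.
move=> fg; have {fg}: forall b, ftr F ((f - g) * fb b) = 0.
  by move=> b; rewrite mulrBl linearB fg subrr.
move: (f - g) (@subr0_eq F f g) => u u_fg u0; apply: u_fg.
pose G := \matrix_(i, j < #|fB F|) ftr F (fb (enum_val i) * fb (enum_val j)).
pose D := \matrix_(i, j < #|fB F|) coord (enum_val j) (fdual (enum_val i)).
have DG : D *m G = 1%:M.
  apply/matrixP => i j; rewrite !mxE -[i == j](inj_eq enum_val_inj) -fdualP.
  rewrite {1}(coordE (fdual (enum_val i))) mulr_suml linear_sum.
  rewrite (reindex _ (onW_bij _ (@enum_val_bij (fB F)))) /=.
  by apply: eq_bigr => l _; rewrite !mxE -scalerAl linearZ.
apply: (coords_inj fb_coordinates) => b.
pose r := \row_(i < #|fB F|) coord (enum_val i) u.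
have rG : r *m G = 0.
  apply/rowP => j; rewrite !mxE -[RHS](u0 (enum_val j)) [in RHS](coordE u).
  rewrite mulr_suml linear_sum (reindex _ (onW_bij _ (@enum_val_bij (fB F)))) /=.
  by apply: eq_bigr => l _; rewrite !mxE -scalerAl linearZ.
have : r *m (G *m D) = 0 by rewrite mulmxA rG mul0mx.
rewrite (mulmx1C DG) mulmx1 => /rowP/(_ (enum_rank b)).
by rewrite !mxE enum_rankK (coords0 fb_coordinates).
Qed.

Lemma fdual_span f : f = \sum_b ftr F (f * fb b) *: fdual b.
Proof.
apply: ftr_fb_inj => c; rewrite mulr_suml linear_sum (bigD1 c) //=.
rewrite -scalerAl linearZ /= fdualP eqxx mulr1 big1 ?addr0 // => b /negPf bc.
by rewrite -scalerAl linearZ /= fdualP bc mulr0.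
Qed.

(** The homogeneous component of f of degree d and parity e. *)
Definition fpart d e f : F :=
  \sum_(b | (fdeg b == d) && (fpar b == e)) coord b f *: fb b.

Lemma coord_fpart d e f b :
  coord b (fpart d e f) = if (fdeg b == d) && (fpar b == e) then coord b f else 0.
Proof.
rewrite /fpart big_mkcond /= (coords_sum fb_coordinates) (bigD1 b) //=.
case: ifP => _.
  rewrite (coordsZ fb_coordinates) coord_fb eqxx mulr1 big1 ?addr0 // => c.
  rewrite eq_sym => /negPf bc.
  case: ifP => _; last exact: (coords0 fb_coordinates).
  by rewrite (coordsZ fb_coordinates) coord_fb bc mulr0.
rewrite (coords0 fb_coordinates) add0r big1 // => c.
rewrite eq_sym => /negPf bc.
case: ifP => _; last exact: (coords0 fb_coordinates).
by rewrite (coordsZ fb_coordinates) coord_fb bc mulr0.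
Qed.

Lemma ftr_fb2 b c : ftr F (fb b * fb c) != 0 ->
  (fdeg b + fdeg c)%N = fdelta F /\ fpar b = fpar c.
Proof.
move=> nz; have [-> /eqP] := ftr_gr (fgr_mul (fb_gr b) (fb_gr c)) nz.
by case: (fpar b); case: (fpar c).
Qed.

Lemma ftr_fpart d e f c : ftr F (fpart d e f * fb c) =
  if (d + fdeg c == fdelta F)%N && (e == fpar c) then ftr F (f * fb c) else 0.
Proof.
transitivity (\sum_(b | (fdeg b == d) && (fpar b == e))
    coord b f * ftr F (fb b * fb c)).
  by rewrite mulr_suml linear_sum; apply: eq_bigr => b _; rewrite -scalerAl linearZ.
have [/andP[/eqP dc /eqP ec]|ne] := boolP (_ && _); last first.
  apply: big1 => b /andP[/eqP db /eqP eb]; apply/eqP.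
  apply: contraR ne => nz; suff: ftr F (fb b * fb c) != 0.
    by case/ftr_fb2; rewrite db eb => -> ->; rewrite !eqxx.
  by apply: contraNneq nz => ->; rewrite mulr0.
rewrite [in RHS](coordE f) mulr_suml linear_sum big_mkcond /=.
apply: eq_bigr => b _; rewrite -scalerAl linearZ /=.
case: ifPn => // ne; apply/esym/eqP; apply: contraR ne => nz.
suff: ftr F (fb b * fb c) != 0.
  by case/ftr_fb2 => bc ->; rewrite ec eqxx andbT -(eqn_add2r (fdeg c)) bc dc.
by apply: contraNneq nz => ->; rewrite mulr0.
Qed.

Lemma fdeg_le b : (fdeg b <= fdelta F)%N.
Proof.
apply: (fdelta_max (fb_gr b)) => b0.
have := fdualP b b; rewrite b0 mulr0 linear0 eqxx => /esym/eqP.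
by rewrite oner_eq0.
Qed.

(** The trace pairs the pieces of degrees d and delta - d: a component of the dual
    of b in another degree or parity has zero trace against the whole basis. *)
Lemma fdual_gr b : fgr (fdelta F - fdeg b)%N (fpar b) (fdual b).
Proof.
apply/fgr_coord => c nz.
suff: (fdeg c + fdeg b == fdelta F)%N && (fpar c == fpar b).
  by case/andP=> /eqP<- /eqP->; rewrite addnK.
apply: contraR nz => ne; apply/eqP.
have := coord_fpart (fdeg c) (fpar c) (fdual b) c; rewrite !eqxx /= => <-.
suff -> : fpart (fdeg c) (fpar c) (fdual b) = 0 by apply: (coords0 fb_coordinates).
apply: ftr_fb_inj => a; rewrite mul0r linear0 ftr_fpart fdualP.
have [<-|_] := eqVneq b a; first by rewrite (negPf ne).
by case: ifP.
Qed.

End Frobenius.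

(** * Tensor factors and superpermutations *)

Section TensorFactors.

Variables (k : comNzRingType) (F : frob_superalg k) (n : nat).
Local Notation T := (tens F n).
Local Notation W := {ffun 'I_n -> fB F}.
Implicit Types (i j l : 'I_n) (f g : F) (p q : 'I_n -> bool) (s : 'S_n).

(** The parities of the factors of tens_at i f, for f of parity e. *)
Definition single_par i (e : bool) : 'I_n -> bool := fun j => (j == i) && e.

Lemma has_parities_at i d e f : fgr d e f ->
  has_parities (single_par i e) (fun j => if j == i then f else 1).
Proof.
move=> gf j; rewrite /single_par; case: eqP => _; first by exists d.
by exists 0%N; apply: fgr_one.
Qed.

Lemma ksign_at i j e e' :
  ksign k (single_par i e) (single_par j e') = (-1) ^+ [&& (j < i)%N, e & e'].
Proof.
rewrite /ksign (bigD1 i) //= [X in _ * X]big1 ?mulr1 => [|l /negPf li]; last first.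
  by apply: big1 => m _; rewrite /single_par li.
have [ji|ij] := boolP (j < i)%N; last first.
  apply: big1 => l li; rewrite /single_par eqxx /=; case: eqP => [lj|_].
    by rewrite -lj li in ij.
  by rewrite andbF.
rewrite (bigD1 j) //= /single_par !eqxx /= big1 ?mulr1 // => l /andP[_ /negPf->].
by rewrite andbF.
Qed.

Lemma tens_at_lin i (c : k) f g :
  tens_at i (c *: f + g) = c *: tens_at i f + tens_at i g.
Proof.
apply/ffunP => w; rewrite !ffunE !(bigD1 i (P := predT)) //= eqxx coordZD.
set x := \prod_(j | _) _; set y := \prod_(j | _) _; set z := \prod_(j | _) _.
have -> : x = z by apply: eq_bigr => j /negPf->.
have -> : y = z by apply: eq_bigr => j /negPf->.
by rewrite [_ *: _]mulrA mulrDl.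
Qed.

HB.instance Definition _ i :=
  GRing.isLinear.Build k F T *:%R (@tens_at k F n i) (tens_at_lin i).

Lemma linear_fb_ext (V : lmodType k) (L L' : {linear F -> V}) :
  (forall b, L (fb b) = L' (fb b)) -> L =1 L'.
Proof.
by move=> LL' f; rewrite (coordE f) !linear_sum; apply: eq_bigr => b _; rewrite !linearZ /= LL'.
Qed.

Lemma tens_atM i f g : tens_at i (f * g) = tens_at i f * tens_at i g :> T.
Proof.
rewrite (coordE f) mulr_suml !linear_sum mulr_suml; apply: eq_bigr => b _.
rewrite -scalerAl !linearZ -scalerAl; congr (_ *: _).
rewrite (coordE g) mulr_sumr !linear_sum mulr_sumr; apply: eq_bigr => c _.
rewrite -scalerAr !linearZ -scalerAr; congr (_ *: _) => /=.
rewrite (pureM (has_parities_at i (fb_gr b)) (has_parities_at i (fb_gr c))).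
rewrite ksign_at ltnn scale1r; congr pure; apply/funext => j.
by case: eqP => // _; rewrite mulr1.
Qed.

Lemma tens_at_comm i j d e d' e' f g : i != j -> fgr d e f -> fgr d' e' g ->
  tens_at i f * tens_at j g
  = (-1) ^+ (e && e') *: (tens_at j g * tens_at i f) :> T.
Proof.
move=> ij gf gg.
rewrite (pureM (has_parities_at i gf) (has_parities_at j gg)).
rewrite (pureM (has_parities_at j gg) (has_parities_at i gf)) scalerA !ksign_at.
congr (_ *: pure _); last first.
  apply/funext => l; have [->|_] := eqVneq l i; last by rewrite mul1r mulr1.
  by rewrite (negPf ij) mul1r mulr1.
rewrite -signr_addb; move: ij; rewrite -val_eqE /=.
by case: ltngtP; case: e {gf}; case: e' {gg}.
Qed.

(** A pure tensor is the product in increasing order of its factors. No sign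
    appears, as the factors never move past each other. *)
Lemma pure_take (w : W) (m : nat) (lt_mn : (m < n)%N) :
  pure (fun i => if (i < m.+1)%N then fb (w i) else 1) =
  pure (fun i => if (i < m)%N then fb (w i) else 1)
    * tens_at (Ordinal lt_mn) (fb (w (Ordinal lt_mn))) :> T.
Proof.
pose p (i : 'I_n) := (i < m)%N && fpar (w i).
have hp : has_parities p (fun i => if (i < m)%N then fb (w i) else 1).
  move=> i; rewrite /p; case: ltnP => _; first by exists (fdeg (w i)); apply: fb_gr.
  by exists 0%N; apply: fgr_one.
rewrite (pureM hp (has_parities_at _ (fb_gr _))) /ksign big1 ?scale1r => [|i _].
  congr pure; apply/funext => i; rewrite -val_eqE /= ltnS leq_eqVlt.
  have [im|_] := eqVneq (i : nat) m; last by rewrite mulr1.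
  by rewrite im ltnn /= mul1r; congr (fb (w _)); apply: val_inj.
apply: big1 => j ji; rewrite /p /single_par -val_eqE /=.
have [jm|] := eqVneq (j : nat) m; last by rewrite andbF.
have -> // : (i < m)%N = false by apply: negbTE; rewrite -leqNgt -jm ltnW.
Qed.

(** By pure_take, F^(x)n is generated as an algebra by its tensor factors. *)
Lemma tens_gen_ind (Q : T -> Prop) :
  (forall (c : k) (f g : T), Q f -> Q g -> Q (c *: f + g)) -> Q 1 ->
  (forall (f : T) i b, Q f -> Q (f * tens_at i (fb b))) -> forall f : T, Q f.
Proof.
move=> Qlin Q1 Qat.
have Q0 : Q 0 by have := Qlin (-1) _ _ Q1 Q1; rewrite scaleN1r addNr.
elim/tens_ind => [f g Qf Qg|c f Qf|w|//].
- by rewrite -[f]scale1r; apply: Qlin.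
- by rewrite -[_ *: _]addr0; apply: Qlin.
have Qm m : (m <= n)%N -> Q (pure (fun i => if (i < m)%N then fb (w i) else 1)).
  elim: m => [_|m IHm lt_mn]; first exact: Q1.
  by rewrite (pure_take w lt_mn); apply/Qat/IHm/ltnW.
have := Qm n (leqnn n); congr (Q (pure _)).
by apply/funext => i; rewrite ltn_ord.
Qed.

(** The sign in tens_perm s on a pure tensor with factors of parities p. *)
Definition perm_sign s p : k :=
  \prod_(i < n) \prod_(j < n | (i < j)%N && (s j < s i)%N) (-1) ^+ (p i && p j).

Lemma sum_pure_perm s (h : 'I_n -> F) :
  \sum_(w : W) (\prod_i coord (w i) (h i)) *: pure (fun i => fb (w ((s^-1)%g i)))
  = pure (fun i => h ((s^-1)%g i)) :> T.
Proof.
rewrite [RHS]tensE.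
rewrite [RHS](reindex (fun w : W => [ffun i => w ((s^-1)%g i)])) /=; last first.
  exists (fun w : W => [ffun i => w (s i)]) => w _; apply/ffunP => i;
  by rewrite !ffunE ?permK ?permKV.
apply: eq_bigr => w _; rewrite ffunE; congr (_ *: pure _); last first.
  by apply/funext => i; rewrite ffunE.
by rewrite [LHS](reindex_perm (s^-1)%g); apply: eq_bigr => i _; rewrite ffunE.
Qed.

Lemma tens_perm_lin s (c : k) (f g : T) :
  tens_perm s (c *: f + g) = c *: tens_perm s f + tens_perm s g.
Proof.
rewrite /tens_perm scaler_sumr -big_split; apply: eq_bigr => w _ /=.
by rewrite scalerA -scalerDl !ffunE !mulrDl !mulrA.
Qed.

HB.instance Definition _ s :=
  GRing.isLinear.Build k T T *:%R (@tens_perm k F n s) (tens_perm_lin s).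

Lemma tens_perm_pure s p h : has_parities p h ->
  tens_perm s (pure h) = perm_sign s p *: pure (fun i => h ((s^-1)%g i)) :> T.
Proof.
move=> hp; rewrite -sum_pure_perm scaler_sumr; apply: eq_bigr => w _.
rewrite scalerA mulrC ffunE.
have [->|nz] := eqVneq (\prod_i coord (w i) (h i)) 0; first by rewrite !mulr0.
congr (_ * _ *: _); apply: eq_bigr => i _; apply: eq_bigr => j _.
suff eqp l : fpar (w l) = p l by rewrite !eqp.
apply/eqP; apply: contraNT nz => wl; have [d hd] := hp l.
by rewrite (bigD1 l) //= (coord_parity hd wl) mul0r.
Qed.

(** Expanding the parities p + q of products in perm_sign leaves, besides the signs
    for p and for q, the cross terms p i q j over all pairs that s inverts, in
    either order. These turn the pairs with j < i of ksign into those with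
    s j < s i. *)
Lemma perm_signD s p q :
  ksign k p q * perm_sign s (fun i => p i (+) q i) =
  perm_sign s p * perm_sign s q *
    ksign k (fun i => p ((s^-1)%g i)) (fun i => q ((s^-1)%g i)).
Proof.
pose inv (i j : 'I_n) := (i < j)%N && (s j < s i)%N.
have signE (r : rel 'I_n) (t : 'I_n -> 'I_n -> bool) :
    \prod_(i < n) \prod_(j < n | r i j) (-1) ^+ (t i j)
    = \prod_i \prod_j (-1) ^+ (r i j && t i j) :> k.
  apply: eq_bigr => i _; rewrite big_mkcond; apply: eq_bigr => j _.
  by case: ifP.
have -> : ksign k (fun i => p ((s^-1)%g i)) (fun i => q ((s^-1)%g i)) =
    \prod_i \prod_j (-1) ^+ [&& (s j < s i)%N, p i & q j].
  rewrite /ksign (signE (fun i j => j < i)%N) (reindex_perm s).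
  apply: eq_bigr => i _; rewrite (reindex_perm s).
  by apply: eq_bigr => j _; rewrite !permK.
rewrite /ksign /perm_sign (signE (fun i j => j < i)%N) !(signE inv).
have -> : \prod_i \prod_j (-1) ^+ (inv i j && ((p i (+) q i) && (p j (+) q j)))
    = (\prod_i \prod_j (-1) ^+ (inv i j && (p i && p j))) *
      (\prod_i \prod_j (-1) ^+ (inv i j && (q i && q j))) *
      (\prod_i \prod_j (-1) ^+ (inv i j && (p i && q j))) *
      (\prod_i \prod_j (-1) ^+ (inv j i && (p i && q j))) :> k.
  rewrite [X in _ = _ * X]exchange_big -!big_split; apply: eq_bigr => i _ /=.
  rewrite -!big_split; apply: eq_bigr => j _ /=; rewrite -!signr_addb.
  by congr (_ ^+ nat_of_bool _); case: (inv i j); case: (p i); case: (p j);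
     case: (q i); case: (q j).
rewrite mulrC -!mulrA; congr (_ * (_ * _)).
rewrite -!big_split; apply: eq_bigr => i _ /=.
rewrite -!big_split; apply: eq_bigr => j _ /=; rewrite -!signr_addb.
congr (_ ^+ nat_of_bool _); rewrite -!andb_addl; congr (_ && _); rewrite /inv.
have [->|ne_ij] := eqVneq i j; first by rewrite !ltnn.
have ne_s : (s i : nat) != s j by rewrite (inj_eq val_inj) (inj_eq perm_inj).
have ne_v : (i : nat) != j by rewrite (inj_eq val_inj).
by case: (ltngtP (s i) (s j)) ne_s; case: (ltngtP i j) ne_v.
Qed.

Lemma tens_permM s (f g : T) : tens_perm s (f * g) = tens_perm s f * tens_perm s g.
Proof.
rewrite (tensE f) mulr_suml !linear_sum mulr_suml; apply: eq_bigr => w _.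
rewrite -scalerAl !linearZ -scalerAl; congr (_ *: _).
rewrite (tensE g) mulr_sumr !linear_sum mulr_sumr; apply: eq_bigr => v _.
rewrite -scalerAr !linearZ -scalerAr; congr (_ *: _) => /=.
have [pw pv] := (has_parities_fb w, has_parities_fb v).
rewrite (pureM pw pv) linearZ /= (tens_perm_pure s (has_paritiesM pw pv)).
rewrite (tens_perm_pure s pw) (tens_perm_pure s pv) -scalerAl -scalerAr.
have shift u : has_parities (fun i => fpar (u ((s^-1)%g i)))
    (fun i => fb (u ((s^-1)%g i)) : F).
  by move=> i; exists (fdeg (u ((s^-1)%g i))); apply: fb_gr.
by rewrite (pureM (shift w) (shift v)) !scalerA perm_signD.
Qed.

Lemma tens_perm1 s : tens_perm s (1 : T) = 1.
Proof.
rewrite [LHS](tens_perm_pure s (@has_parities1 k F n)) /perm_sign.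
by rewrite big1 ?scale1r // => i _; apply: big1.
Qed.

Lemma tens_perm_at s i f : tens_perm s (tens_at i f) = tens_at (s i) f :> T.
Proof.
move: f; apply: (@linear_fb_ext _ (tens_perm s \o tens_at i) (tens_at (s i))) => b /=.
rewrite (tens_perm_pure s (has_parities_at i (fb_gr b))) /perm_sign.
rewrite big1 ?scale1r => [|j _].
  by congr pure; apply/funext => j; rewrite (canF_eq (permKV s)).
apply: big1 => l /andP[lt_jl _]; rewrite /single_par.
have [ji|_//] := eqVneq j i; have [li|] := eqVneq l i; last by rewrite andbF.
by rewrite ji li ltnn in lt_jl.
Qed.

(** Both sides are algebra morphisms, so no signs have to be compared: it suffices
    to look at the tensor factors. *)
Lemma tens_perm_comp s s' (f : T) :
  tens_perm (pcomp s s') f = tens_perm s (tens_perm s' f).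
Proof.
elim/tens_gen_ind: f => [c f g IHf IHg||f i b IHf].
- by rewrite !linearP /= IHf IHg.
- by rewrite !tens_perm1.
by rewrite !tens_permM IHf !tens_perm_at permM.
Qed.

Lemma tens_perm_id (f : T) : tens_perm 1 f = f.
Proof.
elim/tens_gen_ind: f => [c f g IHf IHg||f i b IHf].
- by rewrite !linearP /= IHf IHg.
- exact: tens_perm1.
by rewrite !tens_permM IHf !tens_perm_at perm1.
Qed.

Lemma tens_psi_at (m : 'X_{1..n}) i f :
  tens_psi m (tens_at i f) = tens_at i (iter (m i) (fpsi F) f) :> T.
Proof.
rewrite tens_psi_pure; congr pure; apply/funext => j.
have [->//|_] := eqVneq j i.
by elim: (m j) => //= m' ->; rewrite rmorph1.
Qed.

End TensorFactors.

(** * The elements t_ij *)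

Section Casimir.

Variables (k : comNzRingType) (F : frob_superalg k) (n : nat).
Local Notation T := (tens F n).
Implicit Types (i j l : 'I_n) (f g : F) (b c : fB F) (s : 'S_n).

Local Notation at_ := (@tens_at k F n).

Lemma fdual_par b : exists d, fgr d (fpar b) (fdual b).
Proof. by exists (fdelta F - fdeg b)%N; apply: fdual_gr. Qed.

Lemma tens_at_sum i (a : fB F -> k) (h : fB F -> F) :
  at_ i (\sum_b a b *: h b) = \sum_b a b *: at_ i (h b).
Proof. by rewrite linear_sum; apply: eq_bigr => b _; rewrite linearZ. Qed.

Lemma signr_scaleK (e : bool) (V : lmodType k) (v : V) :
  (-1) ^+ e *: ((-1) ^+ e *: v) = v.
Proof. by rewrite scalerA -signr_addb addbb scale1r. Qed.

Lemma tens_perm_t s i j : tens_perm s (tens_t F i j) = tens_t F (s i) (s j).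
Proof.
rewrite linear_sum; apply: eq_bigr => b _ /=.
by rewrite tens_permM !tens_perm_at. Qed.

(** From sum_b f b (x) b^vee = sum_b b (x) b^vee f, by expanding f b on the basis
    and b^vee f on the dual basis. *)
Lemma tens_at_t_left i j f : at_ i f * tens_t F i j = tens_t F i j * at_ j f.
Proof.
rewrite mulr_sumr mulr_suml.
transitivity (\sum_b \sum_c coord c (f * fb b) *: (at_ i (fb c) * at_ j (fdual b))).
  apply: eq_bigr => b _; rewrite mulrA -tens_atM [in LHS](coordE (f * fb b)).
  by rewrite tens_at_sum mulr_suml; apply: eq_bigr => c _; rewrite -scalerAl.
rewrite exchange_big; apply: eq_bigr => c _ /=.
rewrite -mulrA -tens_atM [in RHS](fdual_span (fdual c * f)) tens_at_sum mulr_sumr.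
by apply: eq_bigr => b _; rewrite -scalerAr /coord !mulrA.
Qed.

(** Here the expansions of b psi(f) and f b^vee match because of
    tr(f c^vee b) = +- tr(c^vee b psi(f)); this is where psi enters. *)
Lemma tens_at_t_right i j f : i != j ->
  at_ j f * tens_t F i j = tens_t F i j * at_ i (fpsi F f).
Proof.
move=> ij; have ji : j != i by rewrite eq_sym.
rewrite (coordE f) !linear_sum mulr_suml mulr_sumr /=; apply: eq_bigr => g _.
rewrite !linearZ -scalerAl -scalerAr; congr (_ *: _) => /=.
have psi_g : fgr (fdeg g) (fpar g) (fpsi F (fb g)) by apply/fpsi_gr/fb_gr.
rewrite mulr_sumr mulr_suml.
transitivity (\sum_b \sum_c (-1) ^+ (fpar g && fpar b) *:
   (ftr F (fb g * fdual b * fb c) *: (at_ i (fb b) * at_ j (fdual c)))).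
  apply: eq_bigr => b _; rewrite mulrA (tens_at_comm ji (fb_gr g) (fb_gr b)).
  rewrite -scalerAl -mulrA -tens_atM [in LHS](fdual_span (fb g * fdual b)) tens_at_sum.
  rewrite mulr_sumr scaler_sumr; apply: eq_bigr => c _.
  by rewrite -scalerAr.
rewrite exchange_big; apply: eq_bigr => c _ /=.
have [d gd] := fdual_par c.
rewrite -mulrA (tens_at_comm ji gd psi_g) -scalerAr mulrA -tens_atM.
rewrite [in RHS](coordE (fb c * fpsi F (fb g))) tens_at_sum mulr_suml scaler_sumr.
apply: eq_bigr => b _; rewrite -scalerAl /coord !scalerA; congr (_ *: _).
have [d' gb] := fdual_par b.
rewrite -mulrA (fpsi_tr (fb_gr g) (fgr_mul gb (fb_gr c))) mulrA -!mulrA.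
rewrite !mulrA -!signr_addb; congr (_ ^+ nat_of_bool _ * _).
by case: (fpar b); case: (fpar c); case: (fpar g).
Qed.

Lemma tens_at_t_far i j l f : l != i -> l != j ->
  at_ l f * tens_t F i j = tens_t F i j * at_ l f.
Proof.
move=> li lj; rewrite (coordE f) !linear_sum mulr_suml mulr_sumr /=.
apply: eq_bigr => g _; rewrite linearZ -scalerAl -scalerAr; congr (_ *: _).
rewrite mulr_sumr mulr_suml; apply: eq_bigr => b _; have [d gb] := fdual_par b.
rewrite mulrA (tens_at_comm li (fb_gr g) (fb_gr b)) -scalerAl -mulrA.
by rewrite (tens_at_comm lj (fb_gr g) gb) -scalerAr signr_scaleK mulrA.
Qed.

Lemma tens_psi1E l i f :
  tens_psi U_(l)%MM (at_ i f) = at_ i (if l == i then fpsi F f else f).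
Proof. by rewrite tens_psi_at mnm1E; case: (l == i). Qed.

(** The coefficients of psi(b^vee) on the basis are tr(c^vee psi(b^vee)) =
    +- tr(b^vee c^vee); exchanging the sums turns them into those of c^vee. *)
Lemma tens_psi_t i j : i != j ->
  tens_psi U_(j)%MM (tens_t F i j) = tens_t F j i.
Proof.
move=> ij; have ji : j != i by rewrite eq_sym.
rewrite linear_sum /=.
transitivity (\sum_b \sum_c (-1) ^+ (fpar b && fpar c) *:
   (ftr F (fdual b * fdual c) *: (at_ i (fb b) * at_ j (fb c)))).
  apply: eq_bigr => b _; rewrite tens_psiM !tens_psi1E (negPf ji) eqxx.
  rewrite [in LHS](coordE (fpsi F (fdual b))) tens_at_sum mulr_sumr.
  apply: eq_bigr => c _; rewrite -scalerAr scalerA; congr (_ *: _).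
  have [[d gb] [d' gc]] := (fdual_par b, fdual_par c).
  by rewrite (fpsi_tr gb gc) mulrA -signr_addb addbb mul1r.
rewrite exchange_big; apply: eq_bigr => c _ /=.
have [d gc] := fdual_par c.
rewrite (tens_at_comm ji (fb_gr c) gc) andbb [in RHS](coordE (fdual c)).
rewrite tens_at_sum mulr_suml scaler_sumr; apply: eq_bigr => b _.
rewrite -scalerAl /coord; have [->|nz] := eqVneq (ftr F (fdual b * fdual c)) 0.
  by rewrite !scale0r !scaler0.
have [d' gb] := fdual_par b.
have [_] := ftr_gr (fgr_mul gb gc) nz.
by case: (fpar b); case: (fpar c).
Qed.

Lemma tens_psi_t_far i j l : l != i -> l != j ->
  tens_psi U_(l)%MM (tens_t F i j) = tens_t F i j.
Proof.
move=> li lj; rewrite linear_sum; apply: eq_bigr => b _ /=.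
by rewrite tens_psiM !tens_psi1E (negPf li) (negPf lj).
Qed.

Lemma tens_perm_psi s l (f : T) :
  tens_perm s (tens_psi U_(l)%MM f) = tens_psi U_(s l)%MM (tens_perm s f).
Proof.
elim/tens_gen_ind: f => [c f g IHf IHg||f i b IHf].
- by rewrite !linearP /= IHf IHg.
- by rewrite tens_psi1 tens_perm1 tens_psi1.
rewrite tens_psiM !tens_permM tens_psiM IHf tens_psi1E !tens_perm_at tens_psi1E.
by rewrite (inj_eq perm_inj).
Qed.

(** The relation f x_i = x_i psi_i(f), to which Delta_i is applied. It holds for
    all f once it does on tensor factors. *)
Lemma tens_t_exchange i j (f : T) : i != j ->
  tens_perm (tperm i j) f * tens_t F i j
  = tens_t F i j * tens_psi U_(i)%MM f.
Proof.
move=> ij; elim/tens_gen_ind: f => [c f g IHf IHg||f l b IHf].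
- by rewrite !linearP /= mulrDl mulrDr -scalerAl -scalerAr IHf IHg.
- by rewrite tens_perm1 tens_psi1 mul1r mulr1.
rewrite tens_permM tens_psiM tens_perm_at tens_psi1E mulrA -IHf -!mulrA.
congr (_ * _); case: tpermP => [->|->|/eqP li /eqP lj].
- by rewrite eqxx tens_at_t_right.
- by rewrite (negPf ij) tens_at_t_left.
by rewrite [i == l]eq_sym (negPf li) tens_at_t_far.
Qed.

End Casimir.

(** * The polynomial algebra P_n(F) *)

Lemma mnm_ind n (Q : 'X_{1..n} -> Prop) :
  Q 0%MM -> (forall i m, Q m -> Q (U_(i) + m)%MM) -> forall m, Q m.
Proof.
move=> Q0 QU m; have [d] := ubnP (mdeg m); elim: d m => // d IHd m lt_md.
have [m0|[i mi]] : m = 0%MM \/ exists i, m i != 0%N.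
- have [m0|] := boolP [forall i, m i == 0%N]; last by move/forallPn; right.
  by left; apply/mnmP => i; rewrite mnm0E; apply/eqP/(forallP m0).
- by rewrite m0.
have def_m : m = (U_(i) + (m - U_(i)))%MM by rewrite addmC submK // lep1mP.
rewrite def_m; apply/QU/IHd.
by move: lt_md; rewrite {1}def_m mdegD mdeg1.
Qed.

Section Polynomials.

Variables (k : comNzRingType) (F : frob_superalg k) (n : nat).
Local Notation T := (tens F n).
Local Notation P := (polt F n).
Implicit Types (i j l : 'I_n) (f g : T) (a b : P) (m : 'X_{1..n}) (s : 'S_n).

Local Notation px := (@polx k F n).

Lemma mono0 m : mono 0 m = 0 :> P.
Proof. by rewrite -(scale0r (0 : T)) -polt_scale_mono scale0r. Qed.

Lemma polf_lin (c : k) f g : polf (c *: f + g) = c *: polf f + polf g.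
Proof. by rewrite /polf monoD polt_scale_mono. Qed.

Lemma polfM f g : polf (f * g) = polf f * polf g.
Proof. by rewrite /polf poltM tens_psi0 addm0. Qed.

Lemma polf_x f i : polf f * px i = px i * polf (tens_psi U_(i)%MM f).
Proof. by rewrite /polf /polx !poltM tens_psi1 mul1r mulr1 add0m addm0. Qed.

Lemma polxC i j : px i * px j = px j * px i.
Proof. by rewrite /polx !poltM !tens_psi1 addmC. Qed.

Lemma polx_mono i f m : px i * mono f m = mono f (U_(i) + m)%MM.
Proof. by rewrite /polx poltM tens_psi1 mul1r. Qed.

(** P_n(F) is spanned by the products of generators x_i with an element of
    F^(x)n placed last. *)
Lemma polt_gen_ind (Q : P -> Prop) :
  (forall (c : k) a b, Q a -> Q b -> Q (c *: a + b)) ->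
  (forall f, Q (polf f)) -> (forall i a, Q a -> Q (px i * a)) -> forall a, Q a.
Proof.
move=> Qlin Qf Qx; have Q0 : Q 0 by rewrite -(mono0 0%MM); apply: Qf.
elim/polt_ind => [//|a b Qa Qb|f m].
  by rewrite -[a]scale1r; apply: Qlin.
by elim/mnm_ind: m => [|i m IHm]; [apply: Qf | rewrite -polx_mono; apply: Qx].
Qed.

Section Lift.

Variables (R : pzRingType) (phi : T -> R) (X : 'I_n -> R).
Hypothesis phiD : forall f g, phi (f + g) = phi f + phi g.
Hypothesis phi1 : phi 1 = 1.
Hypothesis phiM : forall f g, phi (f * g) = phi f * phi g.
Hypothesis XC : forall i j, X i * X j = X j * X i.
Hypothesis phiX : forall f i, phi f * X i = X i * phi (tens_psi U_(i)%MM f).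

Definition xpow m : R := \prod_(i < n) X i ^+ m i.
(** The universal property of P_n(F): it is generated by F^(x)n and commuting
    x_i subject to f x_i = x_i psi_i(f) only. *)
Definition polt_lift a : R := \sum_(m <- msupp a) xpow m * phi a@_m.

Lemma xpow0 : xpow 0 = 1.
Proof. by apply: big1 => i _; rewrite mnm0E. Qed.

Lemma xpowD m m' : xpow (m + m') = xpow m * xpow m'.
Proof.
rewrite -prodrM_comm => [|i j _ _]; last exact/commrX/commr_sym/commrX/XC.
by apply: eq_bigr => i _; rewrite mnmDE exprD.
Qed.

Lemma xpowU i : xpow U_(i)%MM = X i.
Proof.
rewrite /xpow (big_only1 i) // => [|j /negPf ji _]; first by rewrite mnm1E eqxx.
by rewrite mnm1E eq_sym ji.
Qed.

Lemma phi_xpow f m : phi f * xpow m = xpow m * phi (tens_psi m f).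
Proof.
elim/mnm_ind: m f => [|i m IHm] f; first by rewrite xpow0 tens_psi0 mulr1 mul1r.
by rewrite xpowD xpowU mulrA phiX -mulrA IHm mulrA tens_psiD addmC.
Qed.

Lemma polt_lift_wide a (r : seq 'X_{1..n}) : uniq r -> {subset msupp a <= r} ->
  polt_lift a = \sum_(m <- r) xpow m * phi a@_m.
Proof.
have phi0 : phi 0 = 0 by apply: (addrI (phi 0)); rewrite -phiD !addr0.
move=> r_uniq sub_r; rewrite [RHS](bigID (mem (msupp a))) /= addrC big1 ?add0r.
  rewrite -[RHS]big_filter; apply: perm_big; apply: uniq_perm => //.
    by rewrite filter_uniq.
  by move=> m; rewrite mem_filter /= andb_idr //; apply: sub_r.
by move=> m /memN_msupp_eq0->; rewrite phi0 mulr0.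
Qed.

Lemma polt_liftD a b : polt_lift (a + b) = polt_lift a + polt_lift b.
Proof.
pose r := undup (msupp a ++ msupp b ++ msupp (a + b)).
rewrite !(@polt_lift_wide _ r) ?undup_uniq //; first 1 last.
- by move=> m; rewrite mem_undup !mem_cat => ->; rewrite orbT.
- by move=> m; rewrite mem_undup !mem_cat => ->.
- by move=> m; rewrite mem_undup !mem_cat => ->; rewrite !orbT.
by rewrite -big_split; apply: eq_bigr => m _; rewrite mcoeffD phiD mulrDr.
Qed.

Lemma polt_lift0 : polt_lift 0 = 0.
Proof. by apply: (addrI (polt_lift 0)); rewrite -polt_liftD !addr0. Qed.

Lemma polt_lift_mono f m : polt_lift (mono f m) = xpow m * phi f.
Proof.
rewrite (@polt_lift_wide _ [:: m]) //; first by rewrite big_seq1 coeff_mono eqxx mul1r.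
move=> m'; rewrite mcoeff_msupp coeff_mono inE [m' == m]eq_sym.
by have [//|_] := eqVneq m m'; rewrite mul0r eqxx.
Qed.

Lemma polt_lift_f f : polt_lift (polf f) = phi f.
Proof. by rewrite polt_lift_mono xpow0 mul1r. Qed.

Lemma polt_lift_x i : polt_lift (px i) = X i.
Proof. by rewrite polt_lift_mono xpowU phi1 mulr1. Qed.

Lemma polt_liftM a b : polt_lift (a * b) = polt_lift a * polt_lift b.
Proof.
elim/polt_ind: a => [|a a' IHa IHa'|f m].
- by rewrite mul0r polt_lift0 mul0r.
- by rewrite mulrDl !polt_liftD mulrDl IHa IHa'.
elim/polt_ind: b => [|b b' IHb IHb'|f' m'].
- by rewrite mulr0 polt_lift0 mulr0.
- by rewrite mulrDr !polt_liftD mulrDr IHb IHb'.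
rewrite poltM !polt_lift_mono xpowD phiM mulrA -[RHS]mulrA [phi f * _]mulrA.
by rewrite phi_xpow !mulrA.
Qed.

End Lift.

Definition permm s m : 'X_{1..n} := [multinom m ((s^-1)%g i) | i < n].

Lemma permmD s m m' : permm s (m + m') = (permm s m + permm s m')%MM.
Proof. by apply/mnmP => i; rewrite !mnmE. Qed.

Lemma permm0 s : permm s 0%MM = 0%MM.
Proof. by apply/mnmP => i; rewrite !mnmE. Qed.

Lemma permmU s i : permm s U_(i)%MM = U_(s i)%MM.
Proof. by apply/mnmP => j; rewrite !mnmE eq_sym (canF_eq (permKV s)) eq_sym. Qed.

Lemma polt_perm_mono s f m : polt_perm s (mono f m) = mono (tens_perm s f) (permm s m).
Proof.
rewrite /polt_perm (sum_msupp_mono (E := fun m f => mono (tens_perm s f) (permm s m))) //.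
by move=> m' g g'; rewrite linearD monoD.
Qed.

Lemma polt_permD s a b : polt_perm s (a + b) = polt_perm s a + polt_perm s b.
Proof.
rewrite /polt_perm (sum_msuppD (E := fun m f => mono (tens_perm s f) (permm s m))) //.
by move=> m' g g'; rewrite linearD monoD.
Qed.

Lemma polt_perm0 s : polt_perm s 0 = 0 :> P.
Proof. by rewrite -(mono0 0%MM) polt_perm_mono linear0 !mono0. Qed.

Lemma polt_permZ s (c : k) a : polt_perm s (c *: a) = c *: polt_perm s a.
Proof.
elim/polt_ind: a => [|a a' IHa IHa'|f m].
- by rewrite scaler0 polt_perm0 scaler0.
- by rewrite scalerDr !polt_permD IHa IHa' scalerDr.
by rewrite polt_scale_mono !polt_perm_mono linearZ polt_scale_mono.
Qed.

Lemma polt_perm_f s f : polt_perm s (polf f) = polf (tens_perm s f).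
Proof. by rewrite polt_perm_mono permm0. Qed.

Lemma polt_perm_x s i : polt_perm s (px i) = px (s i).
Proof. by rewrite polt_perm_mono permmU tens_perm1. Qed.

Lemma tens_perm_psim s m f :
  tens_perm s (tens_psi m f) = tens_psi (permm s m) (tens_perm s f).
Proof.
elim/mnm_ind: m f => [|i m IHm] f; first by rewrite permm0 !tens_psi0.
by rewrite permmD permmU -!tens_psiD tens_perm_psi IHm.
Qed.

Lemma polt_permM s a b : polt_perm s (a * b) = polt_perm s a * polt_perm s b.
Proof.
elim/polt_ind: a => [|a a' IHa IHa'|f m].
- by rewrite mul0r polt_perm0 mul0r.
- by rewrite mulrDl !polt_permD mulrDl IHa IHa'.
elim/polt_ind: b => [|b b' IHb IHb'|f' m'].
- by rewrite mulr0 polt_perm0 mulr0.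
- by rewrite mulrDr !polt_permD mulrDr IHb IHb'.
rewrite (poltM f) (polt_perm_mono s (_ * _)) (polt_perm_mono s f) (polt_perm_mono s f').
by rewrite [RHS]poltM permmD tens_permM tens_perm_psim.
Qed.

End Polynomials.

(** * The twisted derivations Delta_i *)

Section Triangular.

Variable R : nzRingType.

Definition trimx (u v w : R) : 'M[R]_2 :=
  \matrix_(i, j) (if i == 0 then if j == 0 then u else v
                  else if j == 0 then 0 else w).

Lemma trimxD u v w u' v' w' :
  trimx u v w + trimx u' v' w' = trimx (u + u') (v + v') (w + w').
Proof.
by apply/matrixP => i j; rewrite !mxE; case: ifP => _; case: ifP => _ //; rewrite addr0.
Qed.

Lemma trimxM u v w u' v' w' :
  trimx u v w * trimx u' v' w' = trimx (u * u') (u * v' + v * w') (w * w').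
Proof.
apply/matrixP => i j; rewrite !mxE !big_ord_recl big_ord0 !mxE /= addr0.
by case: (i == 0); case: (j == 0); rewrite ?mul0r ?mulr0 ?addr0 ?add0r.
Qed.

Lemma trimx0 : trimx 0 0 0 = 0.
Proof. by apply/matrixP => i j; rewrite !mxE; case: ifP; case: ifP. Qed.

Lemma eq_trimx u v w u' v' w' :
  u = u' -> v = v' -> w = w' -> trimx u v w = trimx u' v' w'.
Proof. by move=> -> -> ->. Qed.

Lemma trimx1 : trimx 1 0 1 = 1.
Proof.
apply/matrixP => i j; rewrite !mxE.
by case: i => [[|[]]] //= ?; case: j => [[|[]]].
Qed.

Lemma trimxE u v w : trimx u v w 0 1 = v.
Proof. by rewrite mxE. Qed.

(** With x the commuting variables, permuted by s, and d the values of a twisted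
    derivation on them, the conclusion says that the derivation takes the same
    value on x j * x l and on x l * x j. *)
Lemma twisted_comm (I : eqType) (x d : I -> R) (s : I -> I) (lo hi : I) :
  s lo = hi -> s hi = lo -> (forall j, j != lo -> j != hi -> s j = j) ->
  (forall j, j != lo -> j != hi -> d j = 0) ->
  (forall j, j != lo -> j != hi -> d lo * x j = x j * d lo) ->
  (forall j, j != lo -> j != hi -> d hi * x j = x j * d hi) ->
  d lo * x hi = - (x hi * d hi) -> d hi * x lo = - (x lo * d lo) ->
  forall j l, x (s j) * d l + d j * x l = x (s l) * d j + d l * x j.
Proof.
move=> slo shi sj dj dlo dhi key key2 j l.
have [->|jl] := eqVneq j lo; have [->|ll] := eqVneq l lo => //.
- have [->|lh] := eqVneq l hi; first by rewrite slo shi key key2 !subrr.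
  by rewrite (dj l) // (sj l) // mulr0 mul0r add0r addr0 dlo.
- have [->|jh] := eqVneq j hi; first by rewrite slo shi key key2 !subrr.
  by rewrite (dj j) // (sj j) // mulr0 mul0r add0r addr0 dlo.
have [->|jh] := eqVneq j hi; have [->|lh] := eqVneq l hi => //.
- by rewrite (dj l) // (sj l) // mulr0 mul0r add0r addr0 dhi.
- by rewrite (dj j) // (sj j) // mulr0 mul0r add0r addr0 dhi.
by rewrite (dj j) // (dj l) // !mulr0 !mul0r.
Qed.

End Triangular.

Section Delta.

Variables (k : comNzRingType) (F : frob_superalg k) (n : nat).
Local Notation T := (tens F n).
Local Notation P := (polt F n).
Local Notation px := (@polx k F n).

Lemma idx_neq (i : 'I_n.-1) : idx_lo i != idx_hi i.
Proof. by rewrite -val_eqE /= ltn_eqF. Qed.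

Variable i : 'I_n.-1.
Local Notation lo := (idx_lo i).
Local Notation hi := (idx_hi i).
Local Notation s := (simple_tr i).
Implicit Types (f g : T) (a b : P) (j l : 'I_n).

Definition Delta_gen j : P :=
  if j == lo then polf (tens_t F lo hi)
  else if j == hi then - polf (tens_t F hi lo) else 0.

Lemma polfN f : polf (- f) = - polf f.
Proof. by rewrite -[- f]scaleN1r -[RHS]scaleN1r [RHS]polt_scale_mono. Qed.

Lemma Delta_gen_tens j f :
  polf (tens_perm s f) * Delta_gen j = Delta_gen j * polf (tens_psi U_(j)%MM f).
Proof.
have hl : hi != lo by rewrite eq_sym idx_neq.
rewrite /Delta_gen; case: eqP => [->|_]; first by rewrite -!polfM tens_t_exchange // idx_neq.
case: eqP => [->|_]; last by rewrite mulr0 mul0r.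
by rewrite mulrN mulNr -!polfM /simple_tr tpermC tens_t_exchange.
Qed.

Lemma Delta_gen_comm j l :
  px (s j) * Delta_gen l + Delta_gen j * px l = px (s l) * Delta_gen j + Delta_gen l * px j.
Proof.
have lh := idx_neq i; have hl : hi != lo by rewrite eq_sym.
have dl : Delta_gen lo = polf (tens_t F lo hi) by rewrite /Delta_gen eqxx.
have dh : Delta_gen hi = - polf (tens_t F hi lo) by rewrite /Delta_gen (negPf hl) eqxx.
have tx m c d : m != c -> m != d ->
    polf (tens_t F c d) * px m = px m * polf (tens_t F c d).
  by move=> mc md; rewrite [LHS]polf_x tens_psi_t_far.
have tx_swap c d : c != d ->
    polf (tens_t F c d) * px d = px d * polf (tens_t F d c).
  by move=> cd; rewrite [LHS]polf_x tens_psi_t.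
apply: (@twisted_comm _ _ px Delta_gen s lo hi) => [||m ml mh|m ml mh|m ml mh|m ml mh||].
- exact: tpermL.
- exact: tpermR.
- by rewrite tpermD // eq_sym.
- by rewrite /Delta_gen (negPf ml) (negPf mh).
- by rewrite dl; apply: tx.
- by rewrite dh [LHS]mulNr [RHS]mulrN tx.
- by rewrite dl dh [in RHS]mulrN opprK; apply: tx_swap.
- by rewrite dl dh [LHS]mulNr tx_swap.
Qed.

(** A map D is a derivation twisted by s exactly when a |-> [[s a, D a], [0, a]] is
    multiplicative, so that D can be obtained from the universal property. *)
Definition delta_lift : P -> 'M[P]_2 :=
  polt_lift (fun f => trimx (polf (tens_perm s f)) 0 (polf f))
            (fun j => trimx (px (s j)) (Delta_gen j) (px j)).

Definition delta a : P := delta_lift a 0 1.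

Let phiD f g : trimx (polf (tens_perm s (f + g))) 0 (polf (f + g)) =
  trimx (polf (tens_perm s f)) 0 (polf f) + trimx (polf (tens_perm s g)) 0 (polf g).
Proof. by rewrite trimxD linearD /polf /= !monoD addr0. Qed.

Let phi1 : trimx (polf (tens_perm s 1)) 0 (polf (1 : T)) = 1.
Proof. by rewrite tens_perm1 -trimx1. Qed.

Let phiM f g : trimx (polf (tens_perm s (f * g))) 0 (polf (f * g)) =
  trimx (polf (tens_perm s f)) 0 (polf f) * trimx (polf (tens_perm s g)) 0 (polf g).
Proof. by rewrite trimxM tens_permM !polfM mulr0 mul0r addr0. Qed.

Let XC j l : trimx (px (s j)) (Delta_gen j) (px j) * trimx (px (s l)) (Delta_gen l) (px l) =
  trimx (px (s l)) (Delta_gen l) (px l) * trimx (px (s j)) (Delta_gen j) (px j).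
Proof.
rewrite [LHS]trimxM [RHS]trimxM.
by apply: eq_trimx; [apply: polxC|apply: Delta_gen_comm|apply: polxC].
Qed.

Let phiX f j : trimx (polf (tens_perm s f)) 0 (polf f) * trimx (px (s j)) (Delta_gen j) (px j) =
  trimx (px (s j)) (Delta_gen j) (px j) *
  trimx (polf (tens_perm s (tens_psi U_(j)%MM f))) 0 (polf (tens_psi U_(j)%MM f)).
Proof.
rewrite [LHS]trimxM [RHS]trimxM; apply: eq_trimx.
- by rewrite [LHS]polf_x tens_perm_psi.
- by rewrite [_ * 0]mulr0 [0 * _]mul0r addr0 add0r Delta_gen_tens.
- exact: polf_x.
Qed.

Lemma delta_liftE a : delta_lift a = trimx (polt_perm s a) (delta a) a.
Proof.
suff [v def_v] : exists v, delta_lift a = trimx (polt_perm s a) v a.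
  by rewrite /delta def_v trimxE.
rewrite /delta_lift; elim/polt_ind: a => [|a a' [v IHa] [v' IHa']|f m].
- by exists 0; rewrite (polt_lift0 _ phiD) polt_perm0 trimx0.
- by exists (v + v'); rewrite (polt_liftD _ phiD) IHa IHa' trimxD polt_permD.
elim/mnm_ind: m => [|j m [v IHm]].
  by exists 0; rewrite (polt_lift_f _ phiD) polt_perm_f.
exists (px (s j) * v + Delta_gen j * mono f m); rewrite -polx_mono.
rewrite (polt_liftM phiD phiM XC phiX) (polt_lift_x _ phiD phi1).
by rewrite IHm trimxM polt_permM polt_perm_x.
Qed.

Lemma deltaM a b : delta (a * b) = delta a * b + polt_perm s a * delta b.
Proof.
have : delta_lift (a * b) = delta_lift a * delta_lift b.
  exact: (polt_liftM phiD phiM XC phiX).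
rewrite !delta_liftE trimxM => /matrixP/(_ 0 1).
by rewrite !trimxE addrC.
Qed.

Lemma delta_f f : delta (polf f) = 0.
Proof. by rewrite /delta /delta_lift (polt_lift_f _ phiD) trimxE. Qed.

Lemma delta_x j : delta (px j) = Delta_gen j.
Proof. by rewrite /delta /delta_lift (polt_lift_x _ phiD phi1) trimxE. Qed.

Lemma polt_scaleE (c : k) a : c *: a = polf (c *: 1) * a.
Proof.
have -> : polf (c *: (1 : T)) = c *: (1 : P) by apply/esym/polt_scale_mono.
by rewrite -[RHS]scalerAl mul1r.
Qed.

Lemma Delta_x (D : P -> P) j : is_Delta i D -> D (px j) = Delta_gen j.
Proof.
move=> DP; rewrite /Delta_gen; case: eqP => [->|/eqP jlo]; first exact: Delta_lo DP.
case: eqP => [->|/eqP jhi]; first exact: Delta_hi DP.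
exact: (Delta_far DP jlo jhi).
Qed.

Lemma Delta0 (D : P -> P) : is_Delta i D -> D 0 = 0.
Proof.
move=> DP; have := Delta_lin DP (-1) 0 0.
by rewrite scaleN1r addNr => ->; rewrite scaleN1r addNr.
Qed.

Lemma is_Delta_delta : is_Delta i delta.
Proof.
have hl : hi != lo by rewrite eq_sym idx_neq.
split=> [c a b|f|||j jl jh|a b].
- transitivity (delta (c *: a) + delta b).
    by rewrite /delta /delta_lift (polt_liftD _ phiD) mxE.
  rewrite polt_scaleE deltaM delta_f mul0r add0r polt_perm_f.
  by rewrite linearZ /= tens_perm1 -polt_scaleE.
- exact: delta_f.
- by rewrite delta_x /Delta_gen eqxx.
- by rewrite delta_x /Delta_gen (negPf hl) eqxx.
- by rewrite delta_x /Delta_gen (negPf jl) (negPf jh).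
- exact: deltaM.
Qed.

End Delta.

(** * The operators of the s_i and the symmetric group *)

Section Words.

Variable n : nat.
Implicit Types (r : seq 'I_n.-1) (w : 'S_n) (i : 'I_n.-1).

Definition wprod r : 'S_n := foldr (fun i w => pcomp (simple_tr i) w) 1%g r.

Lemma wprod_cat r r' : wprod (r ++ r') = pcomp (wprod r) (wprod r').
Proof. by elim: r => [|i r IHr] /=; rewrite /pcomp ?mulg1 // IHr /pcomp mulgA. Qed.

(** A transposition of distant indices is conjugate by a simple one to a
    transposition of closer indices. *)
Lemma wprod_surj w : exists r, wprod r = w.
Proof.
pose Q w := exists r, wprod r = w.
have Q1 : Q 1%g by exists [::].
have QM w1 w2 : Q w1 -> Q w2 -> Q (w1 * w2)%g.
  by move=> [r1 <-] [r2 <-]; exists (r2 ++ r1); apply: wprod_cat.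
have Qs i : Q (simple_tr i) by exists [:: i]; rewrite /= /pcomp mul1g.
have Qlt d (a b : 'I_n) : (a + d.+1 = b)%N -> Q (tperm a b).
  elim: d b => [|d IHd] b def_b.
    have lt_a : (a < n.-1)%N.
      by rewrite ltn_predRL; move: (ltn_ord b); rewrite -def_b addn1.
    have -> : tperm a b = simple_tr (Ordinal lt_a); last exact: Qs.
    by rewrite /simple_tr; congr tperm; apply: val_inj; rewrite //= -def_b addn1.
  have lt_c : (a + d.+1 < n.-1)%N.
    by rewrite ltn_predRL; move: (ltn_ord b); rewrite -def_b addnS.
  pose i := Ordinal lt_c.
  have hi_b : idx_hi i = b by apply: val_inj; rewrite /= -def_b [RHS]addnS.
  have ne_lo : idx_lo i != a.
    by rewrite -val_eqE /= -{2}[a : nat]addn0 eqn_add2l.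
  have ne_hi : idx_hi i != a.
    by rewrite hi_b -val_eqE /= -def_b -{2}[a : nat]addn0 eqn_add2l.
  have <- : (tperm a (idx_lo i) ^ simple_tr i)%g = tperm a b.
    by rewrite tpermJ tpermD // tpermL hi_b.
  by rewrite conjgE tpermV; apply: (QM) (Qs i) _; apply: (QM) (Qs i); apply: IHd.
have Qt a b : Q (tperm a b).
  have [ab|ba|/val_inj->] := ltngtP a b; last by rewrite tperm1.
    by apply: (@Qlt (b - a.+1)%N); rewrite addnS -addSn subnKC.
  by rewrite tpermC; apply: (@Qlt (a - b.+1)%N); rewrite addnS -addSn subnKC.
have [ts -> _] := prod_tpermP w.
by apply: (big_ind Q) => // t _; apply: Qt.
Qed.

(** The pair of i and i + 1 is the only one whose order is changed. *)
Lemma simple_tr_lt i (a b : 'I_n) :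
  (a != idx_lo i) || (b != idx_hi i) -> (a != idx_hi i) || (b != idx_lo i) ->
  (simple_tr i a < simple_tr i b)%N = (a < b)%N.
Proof.
rewrite /simple_tr !permE /= -!val_eqE /=.
by do !case: ifP => /=; lia.
Qed.

End Words.

Lemma scaler_sub_lin (k : comNzRingType) (M : lmodType k) (c : k) (a b d e : M) :
  c *: a + b - (c *: d + e) = c *: (a - d) + (b - e).
Proof. by rewrite scalerBr opprD addrACA. Qed.

Section Representation.

Variables (k : comNzRingType) (F : frob_superalg k) (n : nat).
Local Notation T := (tens F n).
Local Notation P := (polt F n).
Local Notation V := (wreath_mod F n).
Local Notation px := (@polx k F n).
Implicit Types (i : 'I_n.-1) (j l : 'I_n) (w u : 'S_n) (v : V) (a z : P) (f : T).
Implicit Types (r : seq 'I_n.-1).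

Definition polact z v : V := [ffun u => z * v u].

Lemma polact_lin z : linear (polact z).
Proof.
by move=> c v v'; apply/ffunP => u; rewrite !ffunE mulrDr -[z * (_ *: _)]scalerAr.
Qed.

HB.instance Definition _ z := GRing.isLinear.Build k V V *:%R (polact z) (polact_lin z).

Lemma polactM z z' v : polact (z * z') v = polact z (polact z' v).
Proof. by apply/ffunP => u; rewrite !ffunE mulrA. Qed.

Lemma polactD z z' v : polact (z + z') v = polact z v + polact z' v.
Proof. by apply/ffunP => u; rewrite !ffunE mulrDl. Qed.

Lemma polactZ (c : k) z v : polact (c *: z) v = c *: polact z v.
Proof. by apply/ffunP => u; rewrite !ffunE [RHS]scalerAl. Qed.

Lemma polact1 v : polact 1 v = v.
Proof. by apply/ffunP => u; rewrite !ffunE mul1r. Qed.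

Lemma polactN z v : polact (- z) v = - polact z v.
Proof. by apply/ffunP => u; rewrite !ffunE mulNr. Qed.

Lemma polact0 v : polact 0 v = 0.
Proof. by apply/ffunP => u; rewrite !ffunE mul0r. Qed.

Lemma polact_ptensor z a u : polact z (ptensor a u) = ptensor (z * a) u.
Proof. by apply/ffunP => u'; rewrite !ffunE; case: eqP => //; rewrite mulr0. Qed.

Lemma ptensor_lin u : linear (fun a : P => ptensor a u).
Proof.
move=> c a b; apply/ffunP => u'; rewrite !ffunE.
by case: eqP => //; rewrite scaler0 addr0.
Qed.

Lemma ptensor0 u : ptensor (0 : P) u = 0.
Proof. by apply/ffunP => u'; rewrite !ffunE; case: ifP. Qed.

Lemma wreath_modE v : v = \sum_u ptensor (v u) u.
Proof.
apply/ffunP => u; rewrite sum_ffunE (bigD1 u) //= ffunE eqxx big1 ?addr0 // => u'.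
by rewrite ffunE eq_sym => /negPf->.
Qed.

(** All of V is reached from the f (x) u by multiplication by the x_j. *)
Lemma wreath_mod_ind (Q : V -> Prop) :
  (forall (c : k) v v', Q v -> Q v' -> Q (c *: v + v')) ->
  (forall f u, Q (ptensor (polf f) u)) -> (forall j v, Q v -> Q (polact (px j) v)) ->
  forall v, Q v.
Proof.
move=> Qlin Qf Qx v; have Q0 : Q 0.
  by have := Qlin (-1) _ _ (Qf 0 1%g) (Qf 0 1%g); rewrite scaleN1r addNr.
rewrite (wreath_modE v); apply: (big_ind Q) => // [v1 v2 Q1 Q2|u _].
  by rewrite -[v1]scale1r; apply: Qlin.
elim/polt_gen_ind: (v u) => [c a b Qa Qb|f|j a Qa].
- by rewrite ptensor_lin; apply: Qlin.
- exact: Qf.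
by rewrite -polact_ptensor; apply: Qx.
Qed.

Variable D : 'I_n.-1 -> P -> P.
Hypothesis DP : forall i, is_Delta i (D i).

Definition sigma i v : V :=
  [ffun u => polt_perm (simple_tr i) (v (pcomp (simple_tr i) u)) - D i (v u)].

Lemma sigmaE i v u : sigma i v u =
  polt_perm (simple_tr i) (v (pcomp (simple_tr i) u)) - D i (v u).
Proof. by rewrite ffunE. Qed.

Lemma wreath_lin_at (c : k) v v' u : (c *: v + v') u = c *: v u + v' u.
Proof. by rewrite !ffunE. Qed.

Lemma sigma_lin i : linear (sigma i).
Proof.
move=> c v v'; apply/ffunP => u.
rewrite [LHS]sigmaE [RHS]wreath_lin_at.
rewrite [sigma i v u]sigmaE [sigma i v' u]sigmaE.
have wE u' := wreath_lin_at c v v' u'.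
rewrite (wE u) (wE (pcomp (simple_tr i) u)).
rewrite (polt_permD _ (c *: v (pcomp (simple_tr i) u))) polt_permZ.
by rewrite (Delta_lin (DP i)) scaler_sub_lin.
Qed.

HB.instance Definition _ i := GRing.isLinear.Build k V V *:%R (sigma i) (sigma_lin i).

Lemma sigma_ptensor i a w : sigma i (ptensor a w) =
  ptensor (polt_perm (simple_tr i) a) (pcomp (simple_tr i) w) - ptensor (D i a) w.
Proof.
apply/ffunP => u; rewrite !ffunE /pcomp.
have -> : ((u * simple_tr i)%g == w) = (u == (w * simple_tr i)%g).
  by apply/eqP/eqP => [<-|->]; rewrite -mulgA tperm2 mulg1.
by congr (_ - _); case: eqP => // _; [apply: polt_perm0|apply: Delta0 (DP i)].
Qed.

Lemma sigma_x i j v : sigma i (polact (px j) v) =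
  polact (px (simple_tr i j)) (sigma i v) - polact (D i (px j)) v.
Proof.
apply/ffunP => u; rewrite !ffunE [polt_perm _ _]polt_permM polt_perm_x.
rewrite [D i _](Delta_mul (DP i)) polt_perm_x mulrBr opprD -!addrA.
by congr (_ + _); apply: addrC.
Qed.

Lemma sigma_f i f v : sigma i (polact (polf f) v) =
  polact (polf (tens_perm (simple_tr i) f)) (sigma i v).
Proof.
apply/ffunP => u; rewrite !ffunE [polt_perm _ _]polt_permM polt_perm_f.
by rewrite [D i _](Delta_mul (DP i)) (Delta_tens (DP i)) polt_perm_f [0 * _]mul0r add0r mulrBr.
Qed.

Definition sigmas r v : V := foldr sigma v r.

Lemma sigmas_lin r : linear (sigmas r).
Proof. by move=> c v v'; elim: r => //= i r ->; rewrite linearP. Qed.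

Definition word_independent v := exists g : 'S_n -> V, forall r, sigmas r v = g (wprod r).

Lemma word_independent_lin (c : k) v v' :
  word_independent v -> word_independent v' -> word_independent (c *: v + v').
Proof.
move=> [g gP] [g' gP']; exists (fun w => c *: g w + g' w) => r.
by rewrite sigmas_lin gP gP'.
Qed.

Lemma word_independent_f f u : word_independent (ptensor (polf f) u).
Proof.
exists (fun w => ptensor (polf (tens_perm w f)) (pcomp w u)).
elim=> [|i r IHr] /=; first by rewrite tens_perm_id /pcomp mulg1.
rewrite IHr sigma_ptensor (Delta_tens (DP i)) polt_perm_f -tens_perm_comp.
by rewrite /pcomp mulgA ptensor0 subr0.
Qed.

(** The coefficient of t_{w l, w j} w s_jl in w x_j - x_{w j} w: it is -1 or 1
    if w inverts the pair of j and l, and zero otherwise. *)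
Definition inv_sign w j l : k := (l < j)%N%:R - (w l < w j)%N%:R.

(** For w = s_i, at most one term of the commutation rule survives. *)
Lemma sum_simple_tr i j (E : 'I_n -> V) :
  \sum_l inv_sign (simple_tr i) j l *: E l =
  if j == idx_lo i then - E (idx_hi i)
  else if j == idx_hi i then E (idx_lo i) else 0.
Proof.
have lo_hi : (idx_lo i < idx_hi i)%N by [].
have hi_lo : idx_hi i != idx_lo i by rewrite eq_sym idx_neq.
have swap_lo : simple_tr i (idx_lo i) = idx_hi i by apply: tpermL.
have swap_hi : simple_tr i (idx_hi i) = idx_lo i by apply: tpermR.
case: eqP => [->|/eqP jlo].
  rewrite (big_only1 (idx_hi i)) // => [|l lhi _].
    by rewrite /inv_sign swap_lo swap_hi lo_hi ltnNge ltnW // sub0r scaleN1r.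
  by rewrite /inv_sign simple_tr_lt ?lhi ?idx_neq ?orbT // subrr scale0r.
case: eqP => [->|/eqP jhi].
  rewrite (big_only1 (idx_lo i)) // => [|l llo _].
    by rewrite /inv_sign swap_lo swap_hi lo_hi ltnNge ltnW // subr0 scale1r.
  by rewrite /inv_sign simple_tr_lt ?llo ?hi_lo ?orbT // subrr scale0r.
apply: big1 => l _.
by rewrite /inv_sign simple_tr_lt ?jlo ?jhi ?orbT // subrr scale0r.
Qed.

(** Let w be spelled by the word r, so that sigmas r (x_j v) is given by
    w x_j = x_{w j} w + sum_l inv_sign w j l t_{w l, w j} w s_jl. Applying s_i on
    the left, the terms of the sum become those for s_i w, up to their signs,
    which change by inv_sign s_i (w j) (w l); and by sum_simple_tr this change
    is accounted for by s_i x_{w j} = x_{s_i w j} s_i - Delta_i(x_{w j}). *)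
Lemma word_independent_x j v : word_independent v -> word_independent (polact (px j) v).
Proof.
move=> [g gP].
(* The term of the sum for l, with u in the place of w s_jl. *)
pose E w u l := polact (polf (tens_t F (w l) (w j))) (g u).
exists (fun w => polact (px (w j)) (g w)
  + \sum_l inv_sign w j l *: E w (pcomp w (tperm j l)) l).
have sg i w : sigma i (g w) = g (pcomp (simple_tr i) w).
  by have [r <-] := wprod_surj w; rewrite -gP -[RHS](gP (i :: r)).
elim=> [|i r IHr].
  rewrite /= -(gP [::]) perm1 big1 ?addr0 // => l _.
  by rewrite /inv_sign !perm1 subrr scale0r.
rewrite [LHS]/= {}IHr linearD /= sigma_x sg linear_sum /=.
set w := wprod r; set s := simple_tr i.
have -> : \sum_l sigma i (inv_sign w j l *: E w (pcomp w (tperm j l)) l) =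
    \sum_l inv_sign w j l *: E (pcomp s w) (pcomp (pcomp s w) (tperm j l)) l.
  apply: eq_bigr => l _; rewrite linearZ /E /=; congr (_ *: _).
  by rewrite sigma_f tens_perm_t sg /pcomp !permM mulgA.
rewrite -addrA {1}/pcomp permM; congr (_ + _).
pose E' l := E (pcomp s w) (pcomp (pcomp s w) (tperm j l)) l.
(* After the substitution of w^-1 l for l, at most the l with s_{w j, l} = s_i
   is left, and for it s_i w s_{j, w^-1 l} = w. *)
have key : \sum_l (inv_sign (pcomp s w) j l - inv_sign w j l) *: E' l =
    - polact (D i (px (w j))) (g w).
  have signE l : inv_sign (pcomp s w) j l - inv_sign w j l = inv_sign s (w j) (w l).
    by rewrite /inv_sign /pcomp !permM; ring.
  under eq_bigr => l _ do rewrite signE.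
  rewrite (reindex_perm (w^-1)%g); under eq_bigr => l _ do rewrite permKV.
  have E'E l : tperm (w j) l = s ->
      E' ((w^-1)%g l) = polact (polf (tens_t F (w j) l)) (g w).
    move=> def_s; rewrite /E' /E {1 2}/pcomp !permM permKV -def_s tpermL tpermR.
    congr (polact _ (g _)); rewrite /pcomp.
    have -> : tperm j ((w^-1)%g l) = (w * tperm (w j) l * w^-1)%g.
      by rewrite -{1}(permK w j) -tpermJ conjgE invgK mulgA.
    by rewrite !mulgA mulgKV -mulgA tperm2 mulg1.
  rewrite (sum_simple_tr i (w j) (fun l => E' ((w^-1)%g l))) (Delta_x _ (DP i)) /Delta_gen.
  case: eqP => [wj|_]; first by rewrite E'E wj.
  case: eqP => [wj|_]; last by rewrite polact0 oppr0.
  by rewrite E'E wj ?polactN ?opprK // tpermC.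
rewrite addrC -key -big_split; apply: eq_bigr => l _ /=.
by rewrite -[E _ _ _]/(E' l) -scalerDl addrC subrK.
Qed.

End Representation.

(** * The action of A_n(F) *)

Section PresentedAction.

Variables (k : comNzRingType) (G : Type) (R : term k G -> term k G -> Prop).
Variables (M : lmodType k) (ga : G -> M -> M).
Hypothesis ga_lin : forall x, linear (ga x).

Fixpoint term_act (t : term k G) (v : M) : M :=
  match t with
  | tgen x => ga x v
  | tzero => 0
  | tone => v
  | tadd s t => term_act s v + term_act t v
  | topp s => - term_act s v
  | tmul s t => term_act s (term_act t v)
  | tscale c s => c *: term_act s v
  end.

Lemma term_act_lin t : linear (term_act t).
Proof.
elim: t => [x|||s IHs t IHt|s IHs|s IHs t IHt|c s IHs] a u v /=.
- exact: ga_lin.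
- by rewrite scaler0 addr0.
- by [].
- by rewrite IHs IHt scalerDr addrACA.
- by rewrite IHs opprD scalerN.
- by rewrite IHt IHs.
- by rewrite IHs scalerDr !scalerA mulrC.
Qed.

Hypothesis ga_rel : forall s t, R s t -> term_act s =1 term_act t.

(** Linearity of the operators is what makes products distribute over sums in their
    right factor. *)
Lemma term_act_eq s t : pres_eq R s t -> term_act s =1 term_act t.
Proof.
elim=> {s t} [s t /ga_rel //|//|s t _ IH v|s t u _ IH _ IH' v|s s' t t' _ IH _ IH' v
  |s s' _ IH v|s s' t t' _ IH _ IH' v|c s s' _ IH v|s t u v|s t v|t v|t v
  |//|//|//|s t u v|s t u v|c c' t v|t v|c s t v|c c' t v|//|c s t v] /=.
- by rewrite IH.
- by rewrite IH IH'.
- by rewrite IH IH'.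
- by rewrite IH.
- by rewrite IH' IH.
- by rewrite IH.
- exact: addrA.
- exact: addrC.
- exact: add0r.
- exact: addNr.
- by [].
- have := term_act_lin s 1 (term_act t v) (term_act u v).
  by rewrite !scale1r.
- exact: scalerA.
- exact: scale1r.
- exact: scalerDr.
- exact: scalerDl.
- have := term_act_lin s c (term_act t v) 0; rewrite !addr0 => ->.
  have := term_act_lin s (-1) 0 0.
  by rewrite scaleN1r addNr => ->; rewrite scaleN1r addNr addr0.
Qed.

Definition pres_act (a : presented R) : M -> M := term_act (repr a).

Lemma pres_actE t v : pres_act (pclass R t) v = term_act t v.
Proof. exact/term_act_eq/repr_pclass. Qed.

Lemma pres_act1 v : pres_act 1 v = v.
Proof. exact: (pres_actE tone). Qed.

Lemma pres_actM a b v : pres_act (a * b) v = pres_act a (pres_act b v).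
Proof. exact: (pres_actE (tmul (repr a) (repr b))). Qed.

Lemma pres_actD a b v : pres_act (a + b) v = pres_act a v + pres_act b v.
Proof. exact: (pres_actE (tadd (repr a) (repr b))). Qed.

Lemma pres_actZ c a v : pres_act (c *: a) v = c *: pres_act a v.
Proof. exact: (pres_actE (tscale c (repr a))). Qed.

End PresentedAction.

Section Relations.

Variables (k : comNzRingType) (F : frob_superalg k) (n : nat).
Local Notation T := (tens F n).
Local Notation P := (polt F n).
Local Notation A := (awr F n).
Local Notation px := (@polx k F n).
Implicit Types (i : 'I_n.-1) (j l : 'I_n) (w u : 'S_n) (a b z : P) (f g : T).

Lemma awr_eq s t : awr_rel s t -> pclass (@awr_rel k F n) s = pclass (@awr_rel k F n) t.
Proof. by move=> st; apply/pclassP/pres_rel. Qed.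

Lemma awxC j l : awx F j * awx F l = awx F l * awx F j :> A.
Proof. by rewrite /awx /*%R /= !pres_mulpE; apply/awr_eq/awr_xx. Qed.

Lemma awf_lin (c : k) f g : awf (c *: f + g) = c *: awf f + awf g :> A.
Proof.
by rewrite /awf /+%R /*:%R /= pres_scalepE pres_addpE; apply/awr_eq/awr_flin.
Qed.

Lemma awf1 : awf (1 : T) = 1 :> A.
Proof. exact/awr_eq/awr_f1. Qed.

Lemma awfM f g : awf (f * g) = awf f * awf g :> A.
Proof. by rewrite /awf [in RHS]/*%R /= pres_mulpE; apply/awr_eq/awr_ff. Qed.

Lemma aws1 : aws F 1 = 1 :> A.
Proof. exact/awr_eq/awr_s1. Qed.

Lemma awsM p q : aws F (pcomp p q) = aws F p * aws F q :> A.
Proof. by rewrite /aws /*%R /= pres_mulpE; apply/awr_eq/awr_ss. Qed.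

Lemma awf_x f j : awf f * awx F j = awx F j * awf (tens_psi U_(j)%MM f) :> A.
Proof. by rewrite /awf /awx /*%R /= !pres_mulpE; apply/awr_eq/awr_fx. Qed.

Lemma aws_x_far i j : j != idx_lo i -> j != idx_hi i ->
  aws F (simple_tr i) * awx F j = awx F j * aws F (simple_tr i) :> A.
Proof.
by move=> jlo jhi; rewrite /aws /awx /*%R /= !pres_mulpE; apply/awr_eq/awr_sx_far.
Qed.

Lemma aws_x_lo i : aws F (simple_tr i) * awx F (idx_lo i) =
  awx F (idx_hi i) * aws F (simple_tr i) - awf (tens_t F (idx_lo i) (idx_hi i)) :> A.
Proof.
rewrite /aws /awx /awf /*%R /+%R /-%R /= !pres_mulpE pres_opppE pres_addpE.
exact/awr_eq/awr_sx.
Qed.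

Lemma aws_f w f : aws F w * awf f = awf (tens_perm w f) * aws F w :> A.
Proof. by rewrite /aws /awf /*%R /= !pres_mulpE; apply/awr_eq/awr_sf. Qed.

Lemma awfD f g : awf (f + g) = awf f + awf g :> A.
Proof. by have := awf_lin 1 f g; rewrite !scale1r. Qed.

Lemma awf0 : awf (0 : T) = 0 :> A.
Proof. by apply: (addrI (awf 0)); rewrite -awfD !addr0. Qed.

Lemma awfZ c f : awf (c *: f) = c *: awf f :> A.
Proof. by have := awf_lin c f 0; rewrite awf0 !addr0. Qed.

Lemma awr_pol_f f : awr_pol (polf f) = awf f.
Proof. exact: (polt_lift_f _ awfD). Qed.

Lemma awr_pol_x j : awr_pol (px j) = awx F j.
Proof. exact: (polt_lift_x _ awfD awf1). Qed.

Lemma awr_polM a b : awr_pol (a * b) = awr_pol a * awr_pol b.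
Proof. exact: (polt_liftM awfD awfM awxC awf_x). Qed.

Lemma awr_polD a b : awr_pol (a + b) = awr_pol a + awr_pol b.
Proof. exact: (polt_liftD _ awfD). Qed.

Lemma awr_polZ c a : awr_pol (c *: a) = c *: awr_pol a.
Proof.
rewrite polt_scaleE awr_polM awr_pol_f awfZ awf1.
by rewrite -[LHS]presented_scalerAl mul1r.
Qed.

Lemma awr_pol_lin (c : k) a b : awr_pol (c *: a + b) = c *: awr_pol a + awr_pol b.
Proof. by rewrite awr_polD awr_polZ. Qed.

(** This is aws_x_lo multiplied by s_i on both sides. *)
Lemma aws_x_hi i : aws F (simple_tr i) * awx F (idx_hi i) =
  awx F (idx_lo i) * aws F (simple_tr i) + awf (tens_t F (idx_hi i) (idx_lo i)) :> A.
Proof.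
have ss : aws F (simple_tr i) * aws F (simple_tr i) = 1 :> A.
  by rewrite -awsM /pcomp tperm2 aws1.
have := congr1 (fun c : A => aws F (simple_tr i) * c * aws F (simple_tr i)) (aws_x_lo i).
rewrite mulrA ss mul1r mulrBr aws_f tens_perm_t /simple_tr tpermL tpermR -/(simple_tr i).
rewrite mulrBl mulrA -[X in _ = X - _]mulrA ss mulr1 -[X in _ = _ - X]mulrA ss mulr1.
by move=> ->; rewrite subrK.
Qed.

(** Both sides are determined by their values on generators, since the right-hand
    side has the same behaviour on products as the left-hand side, by the
    twisted Leibniz rule. *)
Lemma aws_pol i (D : P -> P) a : is_Delta i D ->
  aws F (simple_tr i) * awr_pol a =
  awr_pol (polt_perm (simple_tr i) a) * aws F (simple_tr i) - awr_pol (D a).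
Proof.
move=> DP; elim/polt_gen_ind: a => [c a b IHa IHb|f|j a IHa].
- rewrite awr_pol_lin (Delta_lin DP) awr_pol_lin polt_permD polt_permZ awr_pol_lin.
  rewrite mulrDr -[aws _ _ * (c *: _)]presented_scalerAr IHa IHb mulrDl.
  by rewrite -(presented_scalerAl c) scaler_sub_lin.
- rewrite awr_pol_f (Delta_tens DP) polt_perm_f !awr_pol_f aws_f.
  by rewrite -[0](@mono0 k F n 0%MM) awr_pol_f awf0 subr0.
rewrite (Delta_mul DP) awr_polD polt_permM !awr_polM polt_perm_x !awr_pol_x.
have -> : aws F (simple_tr i) * (awx F j * awr_pol a) =
    awx F (simple_tr i j) * (aws F (simple_tr i) * awr_pol a) - awr_pol (D (px j)) * awr_pol a.
  rewrite mulrA.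
  have [->|jlo] := eqVneq j (idx_lo i).
    by rewrite aws_x_lo (Delta_lo DP) awr_pol_f mulrBl !mulrA tpermL.
  have [->|jhi] := eqVneq j (idx_hi i).
    rewrite aws_x_hi (Delta_hi DP) -polfN awr_pol_f -[- tens_t _ _ _]scaleN1r awfZ scaleN1r.
    by rewrite mulNr opprK mulrDl !mulrA tpermR.
  rewrite (aws_x_far jlo jhi) (Delta_far DP jlo jhi) -(@mono0 k F n 0%MM) awr_pol_f awf0.
  by rewrite mul0r subr0 /simple_tr tpermD ?mulrA // eq_sym.
by rewrite IHa mulrBr !mulrA opprD -!addrA; congr (_ + _); apply: addrC.
Qed.

End Relations.

Section Existence.

Variables (k : comNzRingType) (F : frob_superalg k) (n : nat).
Local Notation T := (tens F n).
Local Notation P := (polt F n).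
Local Notation V := (wreath_mod F n).
Local Notation px := (@polx k F n).
Implicit Types (i : 'I_n.-1) (j l : 'I_n) (w u : 'S_n) (v : V) (a z : P) (f : T).
Implicit Types (r : seq 'I_n.-1).

Variable D : 'I_n.-1 -> P -> P.
Hypothesis DP : forall i, is_Delta i (D i).

Lemma word_independentT v : word_independent D v.
Proof.
elim/wreath_mod_ind: v => [c v v'|f u|j v].
- exact: word_independent_lin DP c v v'.
- exact: word_independent_f DP f u.
- exact: word_independent_x DP j v.
Qed.

(** By word_independentT, any word for w gives the same operator. *)
Definition permact w v : V := sigmas D (sval (cid (wprod_surj w))) v.

Lemma permactE r v : permact (wprod r) v = sigmas D r v.
Proof.
rewrite /permact; case: cid => r' /= def_r.
by have [g gP] := word_independentT v; rewrite !gP def_r.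
Qed.

Lemma permact_lin w : linear (permact w).
Proof. exact: sigmas_lin DP _. Qed.

Lemma permact1 v : permact 1 v = v.
Proof. exact: (permactE [::]). Qed.

Lemma permact_s i v : permact (simple_tr i) v = sigma D i v.
Proof. by rewrite -[RHS](permactE [:: i]) /= /pcomp mul1g. Qed.

Lemma permactM p q v : permact (pcomp p q) v = permact p (permact q v).
Proof.
have [[r <-] [r' <-]] := (wprod_surj p, wprod_surj q).
by rewrite -wprod_cat !permactE /sigmas foldr_cat.
Qed.

Lemma permact_f w f v :
  permact w (polact (polf f) v) = polact (polf (tens_perm w f)) (permact w v).
Proof.
have [r <-] := wprod_surj w; rewrite !permactE.
elim: r => [|i r IHr] /=; first by rewrite tens_perm_id.
by rewrite IHr (sigma_f DP) tens_perm_comp.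
Qed.

Definition gen_act (x : awr_gen F n) : V -> V :=
  match x with
  | gen_x j => polact (px j)
  | gen_f f => polact (polf f)
  | gen_s w => permact w
  end.

Lemma gen_act_lin x : linear (gen_act x).
Proof. by case: x => [j|f|w]; [apply: polact_lin|apply: polact_lin|apply: permact_lin]. Qed.

Lemma gen_act_rel s t : awr_rel s t -> term_act gen_act s =1 term_act gen_act t.
Proof.
case=> {s t} [i j|c f g||f g||p q|i f|i j jlo jhi|i|p f] v /=.
- by rewrite -!polactM polxC.
- by rewrite polf_lin polactD polactZ.
- exact: polact1.
- by rewrite polfM polactM.
- exact: permact1.
- exact: permactM.
- by rewrite -!polactM polf_x.
- rewrite !permact_s (sigma_x DP) (Delta_far (DP i) jlo jhi) polact0 subr0.
  by rewrite /simple_tr tpermD // eq_sym.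
- rewrite !permact_s (sigma_x DP) (Delta_lo (DP i)).
  by rewrite /simple_tr tpermL.
- exact: permact_f.
Qed.

Definition wreath_act (a : awr F n) : V -> V := pres_act gen_act a.

Lemma wreath_act_lin (a : awr F n) : linear (wreath_act a).
Proof. exact: term_act_lin gen_act_lin _. Qed.

Lemma wreath_act_module : is_module wreath_act.
Proof.
split=> [v|a b v|c a b v|a c u v].
- exact: (pres_act1 gen_act_lin gen_act_rel v).
- exact: (pres_actM gen_act_lin gen_act_rel a b v).
- by rewrite -(pres_actZ gen_act_lin gen_act_rel) -(pres_actD gen_act_lin gen_act_rel).
- exact: wreath_act_lin.
Qed.

Lemma wreath_act_pol z v : wreath_act (awr_pol z) v = polact z v.
Proof.
elim/polt_gen_ind: z v => [c a b IHa IHb|f|j a IHa] v.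
- by rewrite awr_pol_lin (act_linl wreath_act_module) IHa IHb polactD polactZ.
- by rewrite awr_pol_f [LHS](pres_actE gen_act_lin gen_act_rel).
rewrite awr_polM awr_pol_x (act_mul wreath_act_module) IHa polactM.
exact: (pres_actE gen_act_lin gen_act_rel).
Qed.

Lemma wreath_act_wreath_action : is_wreath_action wreath_act.
Proof.
split; first exact: wreath_act_module.
  by move=> z a w; rewrite wreath_act_pol polact_ptensor.
exists D; split=> // i a w.
rewrite [LHS](pres_actE gen_act_lin gen_act_rel) /= permact_s.
exact: sigma_ptensor DP i a w.
Qed.

End Existence.

(** * Degrees *)

Section Degrees.

Variables (k : comNzRingType) (F : frob_superalg k) (n : nat).
Local Notation T := (tens F n).
Local Notation W := {ffun 'I_n -> fB F}.
Local Notation P := (polt F n).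
Local Notation px := (@polx k F n).
Implicit Types (i j l : 'I_n) (s w u : 'S_n) (a b z : P) (f g : T) (m : 'X_{1..n}).

Lemma tens_gr0 d e : tens_gr d e (0 : T).
Proof. by move=> w; rewrite ffunE eqxx. Qed.

Lemma tens_gr_lin d e (c : k) f g :
  tens_gr d e f -> tens_gr d e g -> tens_gr d e (c *: f + g).
Proof.
move=> gf gg w; rewrite !ffunE; have [f0|/gf//] := eqVneq (f w) 0.
have [g0|/gg//] := eqVneq (g w) 0.
by rewrite f0 g0 addr0 [_ *: _]mulr0 eqxx.
Qed.

Lemma tens_gr_sum d e (I : finType) (c : I -> k) (f : I -> T) :
  (forall x, c x != 0 -> tens_gr d e (f x)) -> tens_gr d e (\sum_x c x *: f x).
Proof.
move=> gf; apply: (big_ind (tens_gr d e)) => [|f1 f2 g1 g2|x _].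
- exact: tens_gr0.
- by rewrite -[f1]scale1r; apply: tens_gr_lin.
rewrite -[_ *: _]addr0; have [->|/gf gx] := eqVneq (c x) 0.
  by rewrite scale0r addr0; apply: tens_gr0.
exact: tens_gr_lin gx (tens_gr0 _ _).
Qed.

Lemma tens_gr_pure (d : 'I_n -> nat) (e : 'I_n -> bool) (h : 'I_n -> F) :
  (forall i, fgr (d i) (e i) (h i)) ->
  tens_gr (\sum_i d i)%N (\big[addb/false]_i e i) (pure h : T).
Proof.
move=> gh w; rewrite ffunE => nz.
have dw i : fdeg (w i) = d i /\ fpar (w i) = e i.
  have /fgr_coord := gh i; apply; apply: contraNneq nz => w0.
  by rewrite (bigD1 i) //= w0 mul0r.
by split; apply: eq_bigr => i _; have [] := dw i.
Qed.

Lemma tens_gr1 : tens_gr 0 false (1 : T).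
Proof.
have := @tens_gr_pure (fun=> 0%N) (fun=> false) (fun=> 1) (fun=> fgr_one F).
by rewrite !big1.
Qed.

Lemma tens_gr_mul d e d' e' f g :
  tens_gr d e f -> tens_gr d' e' g -> tens_gr (d + d') (e (+) e') (f * g).
Proof.
move=> gf gg; rewrite [f * g]/(tens_mul f g) /tens_mul pair_bigA /=.
apply: (@tens_gr_sum _ _ _ (fun p : W * W => f p.1 * g p.2 * _)) => -[w v] /= nz.
have /gf[<- <-] : f w != 0 by apply: contraNneq nz => ->; rewrite !mul0r.
have /gg[<- <-] : g v != 0 by apply: contraNneq nz => ->; rewrite mulr0 mul0r.
by rewrite -!big_split; apply: tens_gr_pure => i; apply: fgr_mul; apply: fb_gr.
Qed.

Lemma tens_gr_psi d e m f : tens_gr d e f -> tens_gr d e (tens_psi m f).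
Proof.
move=> gf; apply: tens_gr_sum => w /gf[<- <-]; apply: tens_gr_pure => i.
by elim: (m i) => [|j IHj] /=; [apply: fb_gr|apply: fpsi_gr].
Qed.

Lemma tens_gr_perm d e s f : tens_gr d e f -> tens_gr d e (tens_perm s f).
Proof.
move=> gf; apply: tens_gr_sum => w nz.
have /gf[<- <-] : f w != 0 by apply: contraNneq nz => ->; rewrite mul0r.
rewrite (reindex_perm (s^-1)%g) [X in tens_gr _ X](reindex_perm (s^-1)%g) /=.
by apply: tens_gr_pure => i; apply: fb_gr.
Qed.

Lemma tens_gr_at d e i (f : F) : fgr d e f -> tens_gr d e (tens_at i f).
Proof.
move=> gf; have := @tens_gr_pure (fun j => if j == i then d else 0)%N
  (fun j => (j == i) && e) (fun j => if j == i then f else 1).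
rewrite (big_only1 i) ?eqxx // => [|j /negPf-> //].
rewrite (big_only1 i) ?eqxx // => [|j /negPf-> //]; apply=> j.
by case: eqP => _ //; apply: fgr_one.
Qed.

Lemma tens_gr_t i j : tens_gr (fdelta F) false (tens_t F i j).
Proof.
rewrite /tens_t; under eq_bigr => b _ do rewrite -[_ * _]scale1r.
apply: (@tens_gr_sum _ _ _ (fun=> 1)) => b _.
have := tens_gr_mul (tens_gr_at (i := i) (fb_gr b)) (tens_gr_at (i := j) (fdual_gr b)).
by rewrite subnKC ?fdeg_le // addbb.
Qed.

Lemma polt_gr0 d e : polt_gr d e (0 : P).
Proof. by move=> m; rewrite mcoeff0 eqxx. Qed.

Lemma coeff_polt_scale (c : k) a m : (c *: a)@_m = c *: a@_m.
Proof. by rewrite [LHS]mcoeffZ -scalerAl mul1r. Qed.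

Lemma polt_gr_lin d e (c : k) a b :
  polt_gr d e a -> polt_gr d e b -> polt_gr d e (c *: a + b).
Proof.
move=> ga gb m; rewrite mcoeffD coeff_polt_scale.
have [a0|/ga[d1 [def_d ga1]]] := eqVneq a@_m 0.
  by rewrite a0 scaler0 add0r; apply: gb.
have [b0|/gb[d2 [def_d2 gb2]]] := eqVneq b@_m 0.
  rewrite b0 addr0; exists d1; split=> //; rewrite -[_ *: _]addr0.
  exact: tens_gr_lin ga1 (tens_gr0 _ _).
exists d1; split=> //; apply: tens_gr_lin => //.
by have -> : d1 = d2 by apply: (@addnI (fdelta F * mdeg m)%N); rewrite -def_d.
Qed.

Lemma polt_gr_mono d e f m :
  tens_gr d e f -> polt_gr (fdelta F * mdeg m + d) e (mono f m).
Proof.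
move=> gf m'; rewrite coeff_mono; have [<-|_] := eqVneq m m'.
  by rewrite mul1r; exists d.
by rewrite mul0r eqxx.
Qed.

Lemma polt_gr_ind d e (Q : P -> Prop) : Q 0 -> (forall a b, Q a -> Q b -> Q (a + b)) ->
  (forall f m d', d = (fdelta F * mdeg m + d')%N -> tens_gr d' e f -> Q (mono f m)) ->
  forall a, polt_gr d e a -> Q a.
Proof.
move=> Q0 QD Qm a ga; rewrite (poltE a) big_seq; apply: (big_ind Q) => // m.
rewrite mcoeff_msupp => /ga[d' [def_d ga']]; exact: Qm def_d ga'.
Qed.

Lemma polt_grD d e a b : polt_gr d e a -> polt_gr d e b -> polt_gr d e (a + b).
Proof. by rewrite -[a in a + b]scale1r; apply: polt_gr_lin. Qed.

Lemma polt_gr_mul d e d' e' a b :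
  polt_gr d e a -> polt_gr d' e' b -> polt_gr (d + d') (e (+) e') (a * b).
Proof.
move=> ga gb; elim/polt_gr_ind: ga => {a} [|a a' IHa IHa'|f m d1 -> gf].
- by rewrite mul0r; apply: polt_gr0.
- by rewrite mulrDl; apply: polt_grD.
elim/polt_gr_ind: gb => {b} [|b b' IHb IHb'|g m' d2 -> gg].
- by rewrite mulr0; apply: polt_gr0.
- by rewrite mulrDr; apply: polt_grD.
rewrite poltM addnACA -mulnDr -mdegD.
by apply/polt_gr_mono/tens_gr_mul => //; apply: tens_gr_psi.
Qed.

Lemma polt_gr_f d e f : tens_gr d e f -> polt_gr d e (polf f).
Proof. by move=> gf; have := polt_gr_mono (m := 0%MM) gf; rewrite mdeg0 muln0. Qed.

Lemma polt_gr_x j : polt_gr (fdelta F) false (px j).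
Proof.
by have := polt_gr_mono (m := U_(j)%MM) tens_gr1; rewrite mdeg1 muln1 addn0.
Qed.

Lemma mdeg_permm s m : mdeg (permm s m) = mdeg m.
Proof.
rewrite !mdegE (reindex_perm s); apply: eq_bigr => i _.
by rewrite mnmE permK.
Qed.

Lemma polt_gr_perm d e s a : polt_gr d e a -> polt_gr d e (polt_perm s a).
Proof.
elim/polt_gr_ind=> [|a' b IHa IHb|f m d' -> gf].
- by rewrite polt_perm0; apply: polt_gr0.
- by rewrite polt_permD; apply: polt_grD.
by rewrite polt_perm_mono -(mdeg_permm s); apply/polt_gr_mono/tens_gr_perm.
Qed.

(** The element t_ij has degree delta, like x_i, and is even. *)
Lemma polt_gr_Delta (i : 'I_n.-1) (D : P -> P) d e a :
  is_Delta i D -> polt_gr d e a -> polt_gr d e (D a).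
Proof.
move=> DP.
have Dx j : polt_gr (fdelta F) false (D (px j)).
  rewrite (Delta_x _ DP) /Delta_gen; case: eqP => _; first exact/polt_gr_f/tens_gr_t.
  case: eqP => _; last exact: polt_gr0.
  rewrite -polfN -scaleN1r -[_ *: _]addr0.
  by apply/polt_gr_f/tens_gr_lin/tens_gr0/tens_gr_t.
elim/polt_gr_ind=> [|a' b IHa IHb|f m d' -> gf].
- by rewrite (Delta0 DP); apply: polt_gr0.
- rewrite -[a']scale1r (Delta_lin DP) scale1r; exact: polt_grD.
elim/mnm_ind: m => [|j m IHm].
  by rewrite (Delta_tens DP); apply: polt_gr0.
rewrite -polx_mono (Delta_mul DP) mdegD mdeg1 mulnDr muln1 -addnA polt_perm_x.
apply: polt_grD; first exact: (polt_gr_mul (Dx j) (polt_gr_mono gf)).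
exact: (polt_gr_mul (polt_gr_x (j := simple_tr i j)) IHm).
Qed.

End Degrees.

(** * The isomorphism *)

Lemma coords_transport (k : comNzRingType) (M N : lmodType k) (J : eqType)
    (b : J -> M) (x : J -> M -> k) (phi : M -> N) (psi : N -> M) :
  linear phi -> cancel phi psi -> cancel psi phi -> is_coordinates b x ->
  is_coordinates (phi \o b) (fun j => x j \o psi).
Proof.
move=> phi_lin phiK psiK xP.
have psi_lin : linear psi.
  by move=> c u v; apply: (can_inj phiK); rewrite phi_lin !psiK.
pose phiL := GRing.isLinear.Build k M N *:%R phi phi_lin.
pose Phi : {linear M -> N} := HB.pack phi phiL.
split=> [j c u v|i j|v] /=.
- by rewrite psi_lin (coords_lin xP).
- by rewrite phiK (coords_basis xP).
have [s s_uniq def_v] := coords_span xP (psi v).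
exists s; rewrite // -{1}(psiK v) {1}def_v -[phi]/(Phi : M -> N) linear_sum.
by apply: eq_bigr => j _; rewrite linearZ.
Qed.

Section WreathBasis.

Variables (k : comNzRingType) (F : frob_superalg k) (n : nat).
Local Notation T := (tens F n).
Local Notation W := {ffun 'I_n -> fB F}.
Local Notation P := (polt F n).
Local Notation V := (wreath_mod F n).

Definition wreath_idx : Type := ('S_n * W * 'X_{1..n})%type.
HB.instance Definition _ := Equality.on wreath_idx.

Implicit Types (x : wreath_idx) (v : V).

Definition wreath_basis x : V :=
  ptensor (mono (pure (fun i => fb (x.1.2 i))) x.2) x.1.1.

Definition wreath_coord x v : k := (v x.1.1)@_(x.2) x.1.2.

Definition wreath_deg x : nat :=
  (fdelta F * mdeg x.2 + \sum_i fdeg (x.1.2 i))%N.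

Definition wreath_par x : bool := \big[addb/false]_i fpar (x.1.2 i).

Lemma pure_fbE (w u : W) : (pure (fun i => fb (w i)) : T) u = (u == w)%:R.
Proof.
rewrite ffunE; have [->|ne] := eqVneq u w.
  by rewrite big1 // => i _; rewrite coord_fb eqxx.
have [i ui] : exists i, u i != w i.
  apply/existsP; apply: contraR ne => /existsPn eq_uw.
  by apply/eqP/ffunP => i; apply/eqP/negPn/eq_uw.
by rewrite (bigD1 i) //= coord_fb (negPf ui) mul0r.
Qed.

Lemma wreath_coordinates : is_coordinates wreath_basis wreath_coord.
Proof.
split=> [[[u w] m] c v v'|[[u w] m] [[u' w'] m']|v].
- by rewrite /wreath_coord wreath_lin_at mcoeffD coeff_polt_scale !ffunE.
- rewrite /wreath_coord /wreath_basis /= ffunE !xpair_eqE.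
  case: eqP => _; last by rewrite mcoeff0 ffunE.
  rewrite coeff_mono eq_sym; have [_|_] := eqVneq m m'; last first.
    by rewrite mul0r ffunE andbF.
  by rewrite mul1r pure_fbE andbT.
exists [seq (uw, m) | uw <- index_enum ('S_n * W)%type, m <- msupp (v uw.1)].
  apply: allpairs_uniq_dep => [|uw _|[uw m] [uw' m'] _ _ /= [-> ->] //].
    exact: index_enum_uniq.
  exact: msupp_uniq.
rewrite big_allpairs_dep /= -(pair_bigA _ (fun u w => \sum_(m <- msupp (v u))
  wreath_coord (u, w, m) v *: wreath_basis (u, w, m))) /=.
rewrite {1}(wreath_modE v); apply: eq_bigr => u _.
rewrite exchange_big /=.
have pt_sum (I : Type) (r : seq I) (a : I -> P) :
    ptensor (\sum_(i <- r) a i) u = \sum_(i <- r) ptensor (a i) u.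
  apply: (big_morph (fun a => ptensor a u)) => [a1 a2|].
    by have := ptensor_lin u 1 a1 a2; rewrite !scale1r.
  exact: ptensor0.
rewrite {1}(poltE (v u)) pt_sum; apply: eq_bigr => m _.
rewrite {1}(tensE (v u)@_m).
have mono_sum (a : W -> k) (f : W -> T) :
    mono (\sum_w a w *: f w) m = \sum_w (a w *: mono (f w) m : P).
  rewrite (big_morph (fun g : T => mono g m) (fun g h => monoD g h m) (mono0 _ m)).
  by apply: eq_bigr => w _; rewrite polt_scale_mono.
rewrite mono_sum.
rewrite pt_sum; apply: eq_bigr => w _.
have := @ptensor_lin k F n u ((v u)@_m w) (mono (pure (fun i => fb (w i))) m) 0.
rewrite !addr0 => ->.
by rewrite ptensor0 addr0.
Qed.

Lemma wreath_mod_grE d e v : wreath_mod_gr d e v <->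
  forall x, wreath_coord x v != 0 -> wreath_deg x = d /\ wreath_par x = e.
Proof.
split=> [gv [[u w] m] nz|gv u m nz].
  have vm : (v u)@_m != 0 by apply: contraNneq nz => v0; rewrite /wreath_coord v0 ffunE.
  have [d' [-> gd]] := gv u m vm.
  by rewrite /wreath_deg /wreath_par /=; have [-> ->] := gd w nz.
have [w0 nz0] : exists w, (v u)@_m w != 0.
  apply/existsP; apply: contraR nz => /existsPn v0; apply/eqP/ffunP => w.
  by rewrite [RHS]ffunE; apply/eqP/negPn/v0.
have [def_d _] := gv (u, w0, m) nz0.
exists (\sum_i fdeg (w0 i))%N; split=> [|w nzw]; first exact/esym.
have [def_dw par_w] := gv (u, w, m) nzw.
split=> //; apply: (@addnI (fdelta F * mdeg m)%N).
by rewrite [LHS]def_dw [RHS]def_d.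
Qed.

End WreathBasis.

Section WreathIso.

Variables (k : comNzRingType) (F : frob_superalg k) (n : nat).
Local Notation T := (tens F n).
Local Notation P := (polt F n).
Local Notation V := (wreath_mod F n).
Local Notation A := (awr F n).
Local Notation px := (@polx k F n).
Local Notation wmap := (@wreath_map k F n).
Implicit Types (v : V) (w : 'S_n) (z : P).

Lemma awr_ind (Q : A -> Prop) :
  (forall (c : k) a b, Q a -> Q b -> Q (c *: a + b)) -> Q 1 ->
  (forall a b, Q a -> Q b -> Q (a * b)) ->
  (forall j, Q (awx F j)) -> (forall f, Q (awf f)) ->
  (forall i, Q (aws F (simple_tr i))) -> forall a, Q a.
Proof.
move=> Qlin Q1 QM Qx Qf Qs.
have Q0 : Q 0 by have := Qlin (-1) _ _ Q1 Q1; rewrite scaleN1r addNr.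
have Qw w : Q (aws F w).
  have [r <-] := wprod_surj w.
  by elim: r => [|i r IHr] /=; rewrite ?aws1 // awsM; apply: QM.
elim/pclass_ind; elim=> [[j|f|w]|||s IHs t IHt|s IHs|s IHs t IHt|c s IHs].
- exact: Qx.
- exact: Qf.
- exact: Qw.
- exact: Q0.
- exact: Q1.
- have := Qlin 1 _ _ IHs IHt; rewrite scale1r /+%R /= pres_addpE; exact.
- have := Qlin (-1) _ _ IHs Q0; rewrite scaleN1r addr0 /-%R /= pres_opppE; exact.
- have := QM _ _ IHs IHt; rewrite /*%R /= pres_mulpE; exact.
have := Qlin c _ _ IHs Q0; rewrite addr0 /*:%R /= pres_scalepE; exact.
Qed.

Lemma wreath_map_lin : linear wmap.
Proof.
move=> c u v; rewrite /wreath_map scaler_sumr -big_split; apply: eq_bigr => w _ /=.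
rewrite wreath_lin_at awr_pol_lin mulrDl; congr (_ + _).
by rewrite [RHS]presented_scalerAl.
Qed.

Lemma wreath_map_ptensor z w : wmap (ptensor z w) = awr_pol z * aws F w.
Proof.
rewrite /wreath_map (big_only1 w) // => [|u /negPf ne _]; rewrite ffunE ?eqxx // ne.
by rewrite -(mono0 F 0%MM) awr_pol_f awf0 mul0r.
Qed.

Lemma wreath_map_sum (I : Type) (r : seq I) (v : I -> V) :
  wmap (\sum_(i <- r) v i) = \sum_(i <- r) wmap (v i).
Proof.
apply: (big_morph wmap) => [u u'|].
  by have := wreath_map_lin 1 u u'; rewrite !scale1r.
by have := wreath_map_lin (-1) 0 0; rewrite !scaleN1r !addNr.
Qed.

Variables (act : A -> V -> V) (D : 'I_n.-1 -> P -> P).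
Hypothesis act_mod : is_module act.
Hypothesis act_pol : forall z a w, act (awr_pol z) (ptensor a w) = ptensor (z * a) w.
Hypothesis DP : forall i, is_Delta i (D i).
Hypothesis act_s : forall i a w, act (aws F (simple_tr i)) (ptensor a w) =
  ptensor (polt_perm (simple_tr i) a) (pcomp (simple_tr i) w) - ptensor (D i a) w.

Lemma act0l v : act 0 v = 0.
Proof. by have := act_linl act_mod (-1) 0 0 v; rewrite !scaleN1r !addNr. Qed.

Lemma act_sum a (I : Type) (r : seq I) (v : I -> V) :
  act a (\sum_(i <- r) v i) = \sum_(i <- r) act a (v i).
Proof.
apply: (big_morph (act a)) => [u u'|].
  by have := act_linr act_mod a 1 u u'; rewrite !scale1r.
by have := act_linr act_mod a (-1) 0 0; rewrite !scaleN1r !addNr.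
Qed.

(** Among the generators a, the claim is awr_polM for the x_j and f, and aws_pol for
    the s_i. *)
Lemma wreath_map_act a v : wmap (act a v) = a * wmap v.
Proof.
have ptensor_suff b : (forall z w, wmap (act b (ptensor z w)) = b * wmap (ptensor z w)) ->
    forall u, wmap (act b u) = b * wmap u.
  move=> IH u; rewrite (wreath_modE u) act_sum !wreath_map_sum mulr_sumr.
  by apply: eq_bigr => w _; apply: IH.
have pol z u : wmap (act (awr_pol z) u) = awr_pol z * wmap u.
  apply: ptensor_suff => {}u w.
  by rewrite act_pol !wreath_map_ptensor awr_polM mulrA.
elim/awr_ind: a v => [c a b IHa IHb||a b IHa IHb|j|f|i] v.
- rewrite (act_linl act_mod) wreath_map_lin IHa IHb mulrDl; congr (_ + _).
  by rewrite [LHS]presented_scalerAl.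
- by rewrite (act_one act_mod) mul1r.
- by rewrite (act_mul act_mod) IHa IHb mulrA.
- by rewrite -awr_pol_x.
- by rewrite -awr_pol_f.
apply: ptensor_suff => z w; rewrite act_s.
have -> : ptensor (polt_perm (simple_tr i) z) (pcomp (simple_tr i) w) - ptensor (D i z) w
    = -1 *: ptensor (D i z) w + ptensor (polt_perm (simple_tr i) z) (pcomp (simple_tr i) w).
  by rewrite scaleN1r addrC.
rewrite wreath_map_lin !wreath_map_ptensor mulrA (aws_pol _ (DP i)) awsM.
by rewrite scaleN1r mulrBl addrC mulrA.
Qed.

(** The inverse of a (x) w |-> a w. *)
Definition wreath_inv a : V := act a (ptensor 1 1%g).

Lemma act_aws w : wreath_inv (aws F w) = ptensor 1 w.
Proof.
have D1 i : D i 1 = 0 by apply: (Delta_tens (DP i) 1).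
have [r <-] := wprod_surj w; elim: r => [|i r IHr] /=.
  by rewrite /wreath_inv aws1 (act_one act_mod).
rewrite /wreath_inv awsM (act_mul act_mod) [act _ (ptensor _ _)]IHr act_s D1.
rewrite -[1]/(polf 1) polt_perm_f tens_perm1.
by rewrite ptensor0 subr0.
Qed.

Lemma wreath_invK : cancel wreath_inv wmap.
Proof.
move=> a; rewrite /wreath_inv wreath_map_act wreath_map_ptensor aws1 mulr1.
by rewrite [awr_pol 1](awr_pol_f 1) awf1 mulr1.
Qed.

Lemma wreath_mapK : cancel wmap wreath_inv.
Proof.
move=> v; rewrite [in RHS](wreath_modE v) /wreath_map /wreath_inv.
have actD a b u : act (a + b) u = act a u + act b u.
  by have := act_linl act_mod 1 a b u; rewrite !scale1r.
rewrite (big_morph (act^~ (ptensor 1 1%g)) (fun a b => actD a b _) (act0l _)).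
apply: eq_bigr => w _; rewrite (act_mul act_mod) [act (aws _ _) _]act_aws.
by rewrite act_pol mulr1.
Qed.

Lemma ptensor_gr d e z w : polt_gr d e z -> wreath_mod_gr d e (ptensor z w).
Proof. by move=> gz u; rewrite ffunE; case: eqP => _ //; apply: polt_gr0. Qed.

Lemma wreath_mod_gr_lin d e (c : k) u v :
  wreath_mod_gr d e u -> wreath_mod_gr d e v -> wreath_mod_gr d e (c *: u + v).
Proof. by move=> gu gv w; rewrite wreath_lin_at; apply: polt_gr_lin. Qed.

Lemma wreath_mod_gr0 d e : wreath_mod_gr d e (0 : V).
Proof. by move=> w; rewrite ffunE; apply: polt_gr0. Qed.

Lemma wreath_mod_gr_sum d e (I : Type) (r : seq I) (v : I -> V) :
  (forall i, wreath_mod_gr d e (v i)) -> wreath_mod_gr d e (\sum_(i <- r) v i).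
Proof.
move=> gv; apply: (big_ind (wreath_mod_gr d e)) => [|u u' gu gu'|//].
  exact: wreath_mod_gr0.
by rewrite -[u]scale1r; apply: wreath_mod_gr_lin.
Qed.

Lemma act_gr d e d' e' a v : awr_gr d e a -> wreath_mod_gr d' e' v ->
  wreath_mod_gr (d + d') (e (+) e') (act a v).
Proof.
move=> ga; elim: ga d' e' v => {d e a} [j|d e f gf|w||d e|d e c a b _ IHa _ IHb
  |d1 e1 d2 e2 a b _ IHa _ IHb] d' e' v gv.
- rewrite -awr_pol_x (wreath_modE v) act_sum; apply: wreath_mod_gr_sum => u.
  by rewrite act_pol; apply/ptensor_gr/polt_gr_mul/gv/polt_gr_x.
- rewrite -awr_pol_f (wreath_modE v) act_sum; apply: wreath_mod_gr_sum => u.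
  by rewrite act_pol; apply/ptensor_gr/polt_gr_mul/gv/polt_gr_f.
- have [r <-] := wprod_surj w; rewrite add0n addFb.
  elim: r => [|i r IHr] /=; first by rewrite aws1 (act_one act_mod).
  rewrite awsM (act_mul act_mod) [act (aws _ (wprod r)) v]wreath_modE act_sum.
  apply: wreath_mod_gr_sum => u; rewrite act_s addrC -scaleN1r.
  apply: wreath_mod_gr_lin; apply: ptensor_gr; first exact: polt_gr_Delta (DP i) _.
  exact: polt_gr_perm.
- by rewrite (act_one act_mod).
- by rewrite act0l; apply: wreath_mod_gr0.
- by rewrite (act_linl act_mod); apply: wreath_mod_gr_lin; [apply: IHa|apply: IHb].
by rewrite (act_mul act_mod) -addnA -addbA; apply/IHa/IHb.
Qed.

Lemma wreath_map_gr d e v : wreath_mod_gr d e v -> awr_gr d e (wmap v).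
Proof.
have grD a b : awr_gr d e a -> awr_gr d e b -> awr_gr d e (a + b).
  by move=> ga gb; rewrite -[a]scale1r; apply: awr_gr_lin.
move=> gv; apply: (big_ind (awr_gr d e)) => [||w _]; [exact: awr_gr_0|exact: grD|].
rewrite -[d]addn0 -[e]addbF; apply: awr_gr_mul; last exact: awr_gr_s.
elim/polt_gr_ind: (gv w) => [|a b|f m d' -> gf].
- rewrite -(mono0 F 0%MM) awr_pol_f awf0; exact: awr_gr_0.
- by rewrite awr_polD; apply: grD.
elim/mnm_ind: m => [|j m IHm]; first by rewrite awr_pol_f mdeg0 muln0; apply: awr_gr_f.
rewrite -polx_mono awr_polM awr_pol_x mdegD mdeg1 mulnDr muln1 -addnA.
exact: (awr_gr_mul (awr_gr_x F j) IHm).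
Qed.

(** Both a (x) w |-> a w and its inverse respect degrees, the second since the
    action does. *)
Lemma wreath_map_grE d e v : wreath_mod_gr d e v <-> awr_gr d e (wmap v).
Proof.
split=> [|ga]; first exact: wreath_map_gr.
rewrite -(wreath_mapK v) -[d]addn0 -[e]addbF; apply: act_gr => //.
exact/ptensor_gr/polt_gr_f/tens_gr1.
Qed.

End WreathIso.

(** * The graded dimension *)

Section GradedDimension.

Variables (k : comNzRingType) (F : frob_superalg k) (n : nat).
Local Notation W := {ffun 'I_n -> fB F}.

Lemma grdim_fgr d e : grdim (@fgr k F) d e = qs_count (@fdeg k F) (@fpar k F) d e.
Proof.
pose I := {b : fB F | (fdeg b == d) && (fpar b == e)}.
have := @coords_has_rank k F _ _ _ (fb_coordinates F) _ _ _ (@fgr_coord k F) d e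
  I val val_inj.
move=> /(_ _)/rankE rk; rewrite /grdim rk ?card_sig // => b; split.
  move=> [db pb]; have bP : (fdeg b == d) && (fpar b == e) by rewrite db pb !eqxx.
  by exists (exist _ b bP).
by move=> [[b' bP] ->] /=; have /andP[/eqP-> /eqP->] := bP.
Qed.

(** The degree and parity of the product of the basis vector u.1 of F with the
    power u.2 of a variable of degree delta. *)
Definition fdegx N (u : fB F * 'I_N) : nat := (fdeg u.1 + fdelta F * u.2)%N.
Definition fparx N (u : fB F * 'I_N) : bool := fpar u.1 (+) false.

(** Up to regrouping, the indices of the basis of V of degree d and parity e. When
    delta > 0, the exponents are at most d. *)
Definition wreath_piece (d : nat) e (x : 'S_n * {ffun 'I_n -> fB F * 'I_d.+1}) : bool :=
  (\sum_i fdegx (x.2 i) == d)%N && (\big[addb/false]_i fparx (x.2 i) == e).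

Definition wreath_of (d : nat) e (x : {x | @wreath_piece d e x}) : wreath_idx F n :=
  ((val x).1, [ffun i => ((val x).2 i).1],
   [multinom ((val x).2 i).2 : nat | i < n]).

Lemma wreath_of_inj d e : injective (@wreath_of d e).
Proof.
move=> [[u g] gP] [[u' g'] gP'] eq_x; apply: val_inj => /=.
have := congr1 (fun x => x.1.1) eq_x; rewrite /= => ->; congr (_, _).
apply/ffunP => i.
have := congr1 (fun x : wreath_idx F n => x.1.2 i) eq_x; rewrite !ffunE /= => eq_b.
have := congr1 (fun x : wreath_idx F n => x.2 i) eq_x; rewrite !mnmE /=.
by move/val_inj=> eq_j; apply/eqP; rewrite -pair_eqE /= eq_b eq_j !eqxx.
Qed.

Lemma sum_fdegx N (g : {ffun 'I_n -> fB F * 'I_N}) :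
  (\sum_i fdegx (g i) =
   fdelta F * mdeg [multinom (g i).2 : nat | i < n] + \sum_i fdeg (g i).1)%N.
Proof.
rewrite big_split /= -big_distrr /= addnC mdegE; congr (_ * _ + _)%N.
by apply: eq_bigr => i _; rewrite mnmE.
Qed.

Lemma wreath_ofP d e (x : wreath_idx F n) : (0 < fdelta F)%N ->
  (wreath_deg x = d /\ wreath_par x = e <-> exists y : {x | @wreath_piece d e x}, x = wreath_of y).
Proof.
move=> delta_gt0; split=> [|[[[u g] gP] ->]]; last first.
  have /andP[/eqP dg /eqP pg] := gP.
  rewrite /wreath_deg /wreath_par /=; split.
    rewrite -[RHS]dg sum_fdegx; congr (_ + _)%N.
    by apply: eq_bigr => i _; rewrite ffunE.
  by rewrite -[RHS]pg; apply: eq_bigr => i _; rewrite ffunE /fparx addbF.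
case: x => [[u w] m]; rewrite /wreath_deg /wreath_par /= => -[Delta_gen px].
have lt_m i : (m i < d.+1)%N.
  rewrite ltnS -Delta_gen (leq_trans _ (leq_addr _ _)) //.
  rewrite (leq_trans _ (leq_pmull _ delta_gt0)) // mdegE (bigD1 i) //=.
  exact: leq_addr.
pose g := [ffun i => (w i, Ordinal (lt_m i))] : {ffun 'I_n -> fB F * 'I_d.+1}.
have def_m : [multinom (g i).2 : nat | i < n] = m.
  by apply/mnmP => i; rewrite mnmE ffunE.
have gP : @wreath_piece d e (u, g).
  apply/andP; split; apply/eqP.
    rewrite sum_fdegx def_m -[RHS]Delta_gen; congr (_ + _)%N.
    by apply: eq_bigr => i _; rewrite ffunE.
  by rewrite -[RHS]px; apply: eq_bigr => i _; rewrite /fparx ffunE addbF.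
exists (exist _ (u, g) gP); rewrite /wreath_of /= def_m; congr (_, _, _).
by apply/ffunP => i; rewrite !ffunE.
Qed.

Lemma card_wreath_piece d e : (0 < fdelta F)%N ->
  #|{: {x | @wreath_piece d e x}}|%:Z =
  n`!%:Z * qs_exp (qs_mul (grdim (@fgr k F)) (qs_geom (fdelta F))) n d e.
Proof.
move=> delta_gt0; rewrite card_sig.
rewrite (@eq_qs_exp _ (qs_count (@fdegx d.+1) (@fparx d.+1))) => [|i e' le_id].
  rewrite qs_exp_count /qs_count -PoszM; congr Posz; rewrite -card_Sn.
  rewrite -cardX; apply: eq_card => -[u g].
  by rewrite !inE.
transitivity (qs_mul (qs_count (@fdeg k F) (@fpar k F))
    (qs_count (fun j : 'I_d.+1 => fdelta F * j)%N (fun=> false)) i e').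
  apply: eq_bigr => j _; apply: eq_bigr => u _.
  rewrite grdim_fgr (@qs_geom_count _ d.+1) //.
  by rewrite ltnS (leq_trans (leq_subr _ _)).
exact: qs_count_prod.
Qed.

End GradedDimension.

Theorem theorem4p6 (k : comNzRingType) (p : nat) (F : frob_superalg k)
    (theta n : nat)
    (k_char : has_char k p) (p_neq2 : p <> 2%N)
    (psi_order : has_order (fpsi F) theta) (p_theta : ~~ (p %| theta)%N)
    (psi_eigen : has_eigenbasis (fpsi F))
    (n_gt0 : (0 < n)%N) :
  [/\ exists act, @is_wreath_action k F n act,
      forall act, @is_wreath_action k F n act ->
        is_graded_iso act (@wreath_mod_gr k F n)
          (fun a b : awr F n => a * b) (@awr_gr k F n) (@wreath_map k F n),
      free_module (awr F n)
    & (0 < fdelta F)%N ->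
        (forall d e, exists m, has_rank (@awr_gr k F n d e) m) /\
        forall d e, grdim (@awr_gr k F n) d e
          = n`!%:Z * qs_exp (qs_mul (grdim (@fgr k F)) (qs_geom (fdelta F))) n d e].
Proof.
have DP (i : 'I_n.-1) : is_Delta i (delta (F := F) i) := is_Delta_delta F i.
have actP := wreath_act_wreath_action DP.
have coordA act : @is_wreath_action k F n act ->
    is_coordinates (@wreath_map k F n \o @wreath_basis k F n)
      (fun j => wreath_coord j \o wreath_inv act) /\
    forall d e a, awr_gr d e a <-> forall j, wreath_coord j (wreath_inv act a) != 0 ->
      wreath_deg j = d /\ wreath_par j = e.
  move=> [act_mod act_pol [D [DP' act_s]]]; split.
    apply: coords_transport (@wreath_map_lin k F n) _ _ (wreath_coordinates F n).
      exact: (wreath_mapK act_mod act_pol DP' act_s).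
    exact: (wreath_invK act_mod act_pol DP' act_s).
  move=> d e a; rewrite -wreath_mod_grE (wreath_map_grE act_mod act_pol DP' act_s).
  by rewrite (wreath_invK act_mod act_pol DP' act_s).
have [xP grP] := coordA _ actP.
split.
- by eexists; apply: actP.
- move=> act act_wreath; have [act_mod act_pol [D [DP' act_s]]] := act_wreath.
  split.
  + split=> //.
      exact: (coords_is_grading (wreath_coordinates F n) (@wreath_mod_grE k F n)).
    move=> d e d' e' a v; exact: (act_gr act_mod act_pol DP' act_s).
  + split.
    * split=> [v|a b v|c a b v|a c u v].
      - exact: mul1r.
      - exact/esym/mulrA.
      - by rewrite mulrDl -presented_scalerAl.
      - by rewrite mulrDr -presented_scalerAr.
    * exact: (coords_is_grading xP grP).
    * move=> d e d' e' a v; exact: awr_gr_mul.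
  + exact: wreath_map_lin.
  + exact: (wreath_map_act act_mod act_pol DP' act_s).
  + exact: (wreath_map_grE act_mod act_pol DP' act_s).
  exists (wreath_inv act).
    exact: (wreath_mapK act_mod act_pol DP' act_s).
  exact: (wreath_invK act_mod act_pol DP' act_s).
- exists (wreath_idx F n); exists (@wreath_map k F n \o @wreath_basis k F n).
  exact: (coords_basisT xP).
move=> delta_gt0.
have rk d e : has_rank (@awr_gr k F n d e) #|{: {x | @wreath_piece k F n d e x}}|.
  apply: (coords_has_rank xP grP (@wreath_of_inj k F n d e)) => j.
  exact: wreath_ofP.
split=> d e; first by eexists; apply: rk.
by rewrite /grdim (rankE (rk d e)) card_wreath_piece.
Qed.
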